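(* Let $d\ge1$, let $f$ be an arbitrary probability density on $\mathbb{R}^d$, and let $(r_n)$ be positive reals with $r_n \to 0$ and $n r_n^d \to \infty$. Let $X_1,\ldots,X_n$ be i.i.d. with density $f$ and let $G_n$ be the graph on $[n]$ with edge $\{i,j\}$ ($i\neq j$) iff $\|X_i-X_j\|\le r_n$ (Euclidean norm). Let $D_1$ be the degree of vertex $1$ and $\delta_1$ the number of edges of $G_n$ between neighbors of vertex $1$, and set $W_4 = \delta_1/\binom{D_1}{2}$ when $D_1\ge 2$ and $W_4=0$ otherwise. Let $w_d = \mathbb{P}\{\|X-Y\|\le1\}$ for $X,Y$ independent uniform on the unit ball of $\mathbb{R}^d$. Then $W_4 \to w_d$ in probability as $n\to\infty$, and hence $\Delta_n = \mathrm{argmin}_{s\ge1}|W_4 - w_s| \to d$ in probability. *)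

(* Defs.v *)
From HB Require Import structures.
From mathcomp Require Import all_boot all_order all_algebra.
From mathcomp Require Import all_classical all_reals all_analysis.
Set Implicit Arguments. Unset Strict Implicit. Unset Printing Implicit Defensive.
Import Order.TTheory GRing.Theory Num.Theory.
Import numFieldNormedType.Exports.
Local Open Scope classical_set_scope.
Local Open Scope ring_scope.

(* Points of R^d are d-tuples of reals; [d.-tuple R] carries the product
   (= Borel) sigma-algebra of the library (generated by the coordinates). *)

Definition eucl_dist {R : realType} {d : nat} (x y : d.-tuple R) : R :=
  Num.sqrt (\sum_(i < d) (tnth x i - tnth y i) ^+ 2).

(* Integral w.r.t. d-dimensional Lebesgue measure, as the iterated integral
   of one-dimensional Lebesgue integrals (Tonelli: this is the Lebesgue
   integral on R^d for non-negative measurable integrands). *)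
Fixpoint lebesgue_int {R : realType} (d : nat) :
    (d.-tuple R -> \bar R) -> \bar R :=
  match d with
  | 0 => fun g => g [tuple]
  | d'.+1 => fun g =>
      (\int[@lebesgue_measure R]_(x in setT)
          lebesgue_int (fun t : d'.-tuple R => g (cons_tuple x t)))%E
  end.

Definition prob_density {R : realType} (d : nat) (f : d.-tuple R -> R) :=
  [/\ forall x, 0 <= f x, measurable_fun setT f &
      lebesgue_int (fun x => (f x)%:E) = 1%E].

Definition has_density {R : realType} {dT : measure_display}
    {T : measurableType dT} (P : probability T R) (d : nat)
    (Y : T -> d.-tuple R) (f : d.-tuple R -> R) :=
  forall A : set (d.-tuple R), measurable A ->
    P (Y @^-1` A) = lebesgue_int (fun x => (f x * \1_A x)%:E).

Definition mutually_independent {R : realType} {dT : measure_display}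
    {T : measurableType dT} (P : probability T R) (d : nat)
    (X : nat -> T -> d.-tuple R) :=
  forall (I : seq nat) (A : nat -> set (d.-tuple R)), uniq I ->
    (forall i, i \in I -> measurable (A i)) ->
    P (\big[setI/setT]_(i <- I) (X i @^-1` A i)) =
    (\prod_(i <- I) P (X i @^-1` A i))%E.

Definition unit_ball {R : realType} (d : nat) : set (d.-tuple R) :=
  [set x | eucl_dist x (nseq_tuple d 0) <= 1].
Arguments unit_ball {R} d.

(* w_d = P{ |X - Y| <= 1 } for X, Y independent uniform on the unit ball:
   the Lebesgue measure of {(x,y) in B x B : |x-y| <= 1} divided by vol(B)^2. *)
Definition w_const {R : realType} (d : nat) : R :=
  fine (lebesgue_int (fun x : d.-tuple R =>
          lebesgue_int (fun y : d.-tuple R =>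
            ((\1_(unit_ball d) x * \1_(unit_ball d) y *
              \1_[set z | eucl_dist x z <= 1] y : R)%:E)))) /
  (fine (lebesgue_int (fun x : d.-tuple R => (\1_(unit_ball d) x : R)%:E))) ^+ 2.

(* Random geometric graph on vertices 0..n-1 (vertex 0 plays the role of the
   paper's vertex 1): i ~ j iff i <> j and |X_i - X_j| <= r. *)
Definition rgg_adj {R : realType} {T : Type} (d : nat)
    (X : nat -> T -> d.-tuple R) (r : R) (w : T) (i j : nat) : bool :=
  (i != j) && (eucl_dist (X i w) (X j w) <= r).

Definition deg0 {R : realType} {T : Type} (d : nat)
    (X : nat -> T -> d.-tuple R) (n : nat) (r : R) (w : T) : nat :=
  \sum_(0 <= j < n) rgg_adj X r w 0 j.

Definition tri0 {R : realType} {T : Type} (d : nat)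
    (X : nat -> T -> d.-tuple R) (n : nat) (r : R) (w : T) : nat :=
  \sum_(0 <= j < n) \sum_(j.+1 <= k < n)
     [&& rgg_adj X r w 0 j, rgg_adj X r w 0 k & rgg_adj X r w j k].

Definition W4 {R : realType} {T : Type} (d : nat)
    (X : nat -> T -> d.-tuple R) (n : nat) (r : R) (w : T) : R :=
  if (2 <= deg0 X n r w)%N
  then (tri0 X n r w)%:R / ('C(deg0 X n r w, 2))%:R
  else 0.

(* Main.v *)
(* Condition on the position x of vertex 0. The degree is then binomial with
   mean n p, and the number of edges between neighbours is a sum over pairs whose
   second moment is controlled by n p alone; Chebyshev gives a bound on the
   deviation of W_4 from q / p^2 that only involves n p and tends to 0 as n p
   grows. For almost every x (up to a set of small mass) the density is nearly
   constant in mean on the ball of radius r_n around x: the L^1 modulus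
   int int_{|z|<=1} |f(x + r_n z) - f(x)| dz dx tends to 0 by continuity of
   translations in L^1, so no Lebesgue differentiation is needed. At such points
   p is of order r_n^d and q / p^2 is close to w_d.

   To separate the w_s, split {|x|, |y|, |x - y| <= 1} by the longest side of the
   triangle 0, x, y; scaling and rotation invariance give w_d = (3/2) L / vol,
   with L the volume of the intersection of two unit balls at distance 1. Slicing
   along the axis, L / vol = A / (A + B), where A and B are the integrals of
   sqrt(1 - t^2)^(d-1) over [1/2, 1] and [0, 1/2], and A / B strictly decreases
   with d because sqrt(1 - t^2) is smaller on the first interval. *)
Require Import Defs.
From HB Require Import structures.
From mathcomp Require Import all_boot all_order all_algebra.
From mathcomp Require Import all_classical all_reals all_analysis.
From mathcomp Require Import ring lra measurable_realfun.
Set Implicit Arguments. Unset Strict Implicit. Unset Printing Implicit Defensive.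
Import Order.TTheory GRing.Theory Num.Theory.
Import numFieldNormedType.Exports.
Local Open Scope classical_set_scope.
Local Open Scope ring_scope.

(** The pair sum is a U-statistic with kernel 1[both neighbours, adjacent] - q 1[both neighbours].
    Its mean vanishes, but its projection on one point does not, because a point near the boundary
    of the ball sees fewer neighbours. Hence the second moment carries m^3 beside m^2, with m = n p;
    both are negligible against squared binomials of order m^4, whatever f is.

    The factor 3/2: each choice of the longest side contributes J L, with J the integral of |x|^d
    over the unit ball. Comparing the norms of two points of the ball gives vol^2 = 2 J vol, hence J
    = vol / 2 without polar coordinates.

    Order of choices: a lower bound kappa and an upper bound M for f are fixed first, at the price
    of a small mass; only then does n grow, and Markov's inequality with weight f <= M controls the
    points of large oscillation.

    Rotation invariance is not visible in an iterated integral. It is needed only for involutive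
    isometries (reflections and the central symmetry), where the uniqueness argument for translation
    invariant measures is short. *)

(** * Lebesgue measure on tuples as a power measure *)

(* [pushforward m f] as a bundled measure, with the measurability proof explicit. *)
Definition pushm d1 d2 (T1 : measurableType d1) (T2 : measurableType d2)
    (R : realType) (m : {measure set T1 -> \bar R}) (f : T1 -> T2)
    (mf : measurable_fun setT f) : {measure set T2 -> \bar R} :=
  measure_function_pushforward__canonical__measure_function_Measure m mf.

Section power_measure.
Context d1 (T : measurableType d1) (R : realType).
Local Open Scope ereal_scope.

Definition consp n (p : T * n.-tuple T) : n.+1.-tuple T := cons_tuple p.1 p.2.

Lemma measurable_consp n : measurable_fun setT (@consp n).
Proof. exact: measurable_cons. Qed.

Section consm.
Variables (m1 : {sigma_finite_measure set T -> \bar R}) (n : nat).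
Variable (m2 : {sigma_finite_measure set (n.-tuple T) -> \bar R}).

Definition consm : set (n.+1.-tuple T) -> \bar R :=
  pushforward (m1 \x m2) (@consp n).

Let mcons : measurable_fun setT (@consp n) := @measurable_consp n.

Let consm0 : consm set0 = 0.
Proof. by rewrite /consm /pushforward preimage_set0 measure0. Qed.

Let consm_ge0 A : 0 <= consm A.
Proof. exact: (measure_ge0 (pushforward (m1 \x m2) (@consp n))). Qed.

Let consm_sigma : semi_sigma_additive consm.
Proof. exact: (@measure_semi_sigma_additive _ _ _ (pushforward (m1 \x m2) (@consp n))). Qed.

HB.instance Definition _ := isMeasure.Build _ _ _ consm consm0 consm_ge0 consm_sigma.

Let consm_sigma_finite : sigma_finite setT consm.
Proof.
have /sigma_finiteP[F [TF ndF Foo]] := sigma_finiteT m1.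
have /sigma_finiteP[G [TG ndG Goo]] := sigma_finiteT m2.
have mt : measurable_fun setT (fun t : n.+1.-tuple T => [tuple of behead t] : n.-tuple T).
  exact: measurable_behead.
(* Both exhaustions are increasing, so a tuple with head in [F i] and tail in [G j] lies in the set
   of index [maxn i j]. *)
exists (fun k => [set t : n.+1.-tuple T | F k (thead t)] `&`
                 [set t : n.+1.-tuple T | G k [tuple of behead t]]).
  apply/seteqP; split => t // _.
  have : [set: T] (thead t) by [].
  have : [set: n.-tuple T] [tuple of behead t] by [].
  rewrite TF TG => -[j _ Gj] [i _ Fi]; exists (maxn i j) => //; split => /=.
  - by move: Fi; exact/subsetPset/ndF/leq_maxl.
  - by move: Gj; exact/subsetPset/ndG/leq_maxr.
move=> k; have [mF Fk] := Foo k; have [mG Gk] := Goo k; split.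
  apply: measurableI; first by rewrite -[X in measurable X]setTI; exact: measurable_tnth.
  by rewrite -[X in measurable X]setTI; exact: mt.
rewrite /consm /pushforward /= (_ : _ @^-1` _ = F k `*` G k).
  by rewrite product_measure1E// lte_mul_pinfty// ge0_fin_numE.
have tbE (x : T) (t : n.-tuple T) : [tuple of behead (cons_tuple x t)] = t :> n.-tuple T.
  exact: val_inj.
by apply/seteqP; split => -[x t] /=; rewrite /consp /= theadE tbE.
Qed.

HB.instance Definition _ := Measure_isSigmaFinite.Build _ _ _ consm consm_sigma_finite.

End consm.

(** The base is arbitrary because the construction serves twice: with Lebesgue measure on the line
    it gives volume in dimension n, with the law of one vertex it gives the law of n independent
    vertices. *)
Fixpoint pw (m : {sigma_finite_measure set T -> \bar R}) n :
    {sigma_finite_measure set (n.-tuple T) -> \bar R} :=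
  match n with
  | 0 => [the {sigma_finite_measure set (0.-tuple T) -> \bar R} of dirac ([tuple] : 0.-tuple T)]
  | n'.+1 => [the {sigma_finite_measure set (n'.+1.-tuple T) -> \bar R} of consm m (pw m n')]
  end.

Lemma ge0_integral_pw0 (m : {sigma_finite_measure set T -> \bar R}) (g : 0.-tuple T -> \bar R) :
  \int[pw m 0]_t g t = g [tuple].
Proof.
rewrite /= integral_dirac//; last first.
  (* On a one-point space every preimage is empty or full, so no measurability of [g] has to be
     assumed. *)
  move=> _ Y mY; rewrite setTI.
  have [h|h] := pselect (Y (g [tuple])).
    rewrite (_ : _ @^-1` _ = setT) //; apply/seteqP; split => t //= _.
    by rewrite tuple0.
  rewrite (_ : _ @^-1` _ = set0) //; apply/seteqP; split => t //=.
  by rewrite tuple0.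
by rewrite diracT mul1e.
Qed.

Lemma ge0_integral_pwS (m : {sigma_finite_measure set T -> \bar R}) n (g : n.+1.-tuple T -> \bar R) :
  measurable_fun setT g -> (forall t, 0 <= g t) ->
  \int[pw m n.+1]_t g t = \int[m]_x \int[pw m n]_t g (cons_tuple x t).
Proof.
move=> mg g0; rewrite /= /consm ge0_integral_pushforward //; last exact: measurable_consp.
rewrite fubini_tonelli1 //; last by move=> ?; exact: g0.
by apply: (measurableT_comp mg); exact: measurable_consp.

Qed.

End power_measure.

Section lebesgue_power.
Variable R : realType.
Local Open Scope ereal_scope.

(* [lebesgue_measure] lives on [measurableTypeR R], whose display differs from
   the one of [R] used for tuples: we transport it along the identity. *)
Definition idTR : measurableTypeR R -> R := idfun.

Lemma measurable_idTR : measurable_fun setT idTR.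
Proof. by move=> _ A mA; rewrite setTI. Qed.

Definition leb : set R -> \bar R := pushforward (@lebesgue_measure R) idTR.

Let leb0 : leb set0 = 0.
Proof. exact: (measure0 (@lebesgue_measure R)). Qed.

Let leb_ge0 A : 0 <= leb A.
Proof. exact: (measure_ge0 (@lebesgue_measure R)). Qed.

Let leb_sigma : semi_sigma_additive leb.
Proof. exact: (@measure_semi_sigma_additive _ _ _ (@lebesgue_measure R)). Qed.

HB.instance Definition _ := isMeasure.Build _ _ _ leb leb0 leb_ge0 leb_sigma.

Let leb_sigma_finite : sigma_finite setT leb.
Proof. exact: (sigma_finiteT (@lebesgue_measure R)). Qed.

HB.instance Definition _ := Measure_isSigmaFinite.Build _ _ _ leb leb_sigma_finite.

Lemma ge0_integral_leb (g : R -> \bar R) :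
  measurable_fun setT g -> (forall t, 0 <= g t) ->
  \int[leb]_x g x = \int[@lebesgue_measure R]_x g x.
Proof.
by move=> mg g0; rewrite ge0_integral_pushforward //; exact: measurable_idTR.
Qed.

Definition lam d : {sigma_finite_measure set (d.-tuple R) -> \bar R} := pw leb d.

Lemma measurable_integral_lam d (g : d.+1.-tuple R -> \bar R) :
  measurable_fun setT g -> (forall t, 0 <= g t) ->
  measurable_fun setT (fun x : R => \int[lam d]_t g (cons_tuple x t)).
Proof.
move=> mg g0.
apply: (@measurable_fun_fubini_tonelli_F _ _ _ _ _ (lam d) (g \o @consp _ R d)).
- by apply: (measurableT_comp mg); exact: measurable_consp.
- by move=> ?; exact: g0.
Qed.

(** Bridge from the iterated integral of the statement to a genuine measure, for which Tonelli and
    changes of variables hold. *)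
Lemma lebesgue_intE d (g : d.-tuple R -> \bar R) :
  measurable_fun setT g -> (forall t, 0 <= g t) ->
  lebesgue_int g = \int[lam d]_t g t.
Proof.
elim: d g => [|d IH] g mg g0; first by rewrite ge0_integral_pw0.
rewrite /lam ge0_integral_pwS // ge0_integral_leb//=.
- apply: eq_integral => x _; rewrite IH //.
  by apply: (measurableT_comp mg); exact: measurable_cons.
- exact: measurable_integral_lam.
- by move=> x; exact: integral_ge0.
Qed.
End lebesgue_power.
Arguments leb {R}.
Arguments lam {R} d.

(** * Measurability combinators *)

Section measurable_lemmas.
Context d1 (T : measurableType d1) (R : realType).
Implicit Types f g : T -> R.

Lemma measfD f g : measurable_fun setT f -> measurable_fun setT g ->
  measurable_fun setT (fun x => f x + g x).
Proof. exact: measurable_funD. Qed.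

Lemma measfB f g : measurable_fun setT f -> measurable_fun setT g ->
  measurable_fun setT (fun x => f x - g x).
Proof. exact: measurable_funB. Qed.

Lemma measfN f : measurable_fun setT f -> measurable_fun setT (fun x => - f x).
Proof. exact: measurable_funN. Qed.

Lemma measfM f g : measurable_fun setT f -> measurable_fun setT g ->
  measurable_fun setT (fun x => f x * g x).
Proof. exact: measurable_funM. Qed.

Lemma measfX f n : measurable_fun setT f -> measurable_fun setT (fun x => f x ^+ n).
Proof. exact: measurable_funX. Qed.

Lemma measf_norm f : measurable_fun setT f -> measurable_fun setT (fun x => `|f x|).
Proof. by move=> mf; apply: (measurableT_comp _ mf). Qed.

Lemma measf_sqrt f : measurable_fun setT f -> measurable_fun setT (fun x => Num.sqrt (f x)).
Proof.
move=> mf; apply: (measurableT_comp _ mf).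
by apply: continuous_measurable_fun; exact: sqrt_continuous.
Qed.

Lemma measf_sum (I : Type) (s : seq I) (h : I -> T -> R) :
  (forall i, measurable_fun setT (h i)) ->
  measurable_fun setT (fun x => \sum_(i <- s) h i x).
Proof. exact: measurable_sum. Qed.

Lemma measf_ler f g : measurable_fun setT f -> measurable_fun setT g ->
  measurable_fun setT (fun x => f x <= g x).
Proof. exact: measurable_fun_ler. Qed.

Lemma measf_ltr f g : measurable_fun setT f -> measurable_fun setT g ->
  measurable_fun setT (fun x => f x < g x).
Proof. exact: measurable_fun_ltr. Qed.

Lemma measf_and (p q : T -> bool) : measurable_fun setT p -> measurable_fun setT q ->
  measurable_fun setT (fun x => p x && q x).
Proof. exact: measurable_and. Qed.

Lemma measf_neg (p : T -> bool) : measurable_fun setT p ->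
  measurable_fun setT (fun x => ~~ p x).
Proof. exact: measurable_neg. Qed.

Lemma measurable_pred (p : T -> bool) : measurable_fun setT p -> measurable [set x | p x].
Proof.
move=> mp; rewrite (_ : [set x | p x] = p @^-1` [set true]).
  by rewrite -[X in measurable X]setTI; exact: mp.
by apply/seteqP; split.
Qed.

Lemma measf_natr (p : T -> bool) : measurable_fun setT p ->
  measurable_fun setT (fun x => (p x)%:R : R).
Proof.
move=> mp; rewrite (_ : (fun _ => _) = \1_[set x | p x]).
  by apply: measurable_indic; exact: measurable_pred.
apply/funext => x; rewrite indicE.
by case: (boolP (p x)) => px; [rewrite mem_set|rewrite memNset //=; exact/negP].
Qed.

Lemma measfE f : measurable_fun setT f -> measurable_fun setT (fun x => (f x)%:E).
Proof. by move=> ?; exact/measurable_EFinP. Qed.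

Lemma measf_tnth n (h : T -> n.-tuple R) i : measurable_fun setT h ->
  measurable_fun setT (fun x => tnth (h x) i).
Proof. by move=> mh; apply: (measurableT_comp (measurable_tnth i) mh). Qed.

Lemma measf_fst d2 d3 (T2 : measurableType d2) (T3 : measurableType d3) (h : T -> T2 * T3) :
  measurable_fun setT h -> measurable_fun setT (fun x => (h x).1).
Proof. by move=> mh; apply: (measurableT_comp measurable_fst mh). Qed.

Lemma measf_snd d2 d3 (T2 : measurableType d2) (T3 : measurableType d3) (h : T -> T2 * T3) :
  measurable_fun setT h -> measurable_fun setT (fun x => (h x).2).
Proof. by move=> mh; apply: (measurableT_comp measurable_snd mh). Qed.

Lemma measf_mktuple n (h : T -> 'I_n -> R) :
  (forall i, measurable_fun setT (h ^~ i)) ->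
  measurable_fun setT (fun x => [tuple h x i | i < n]).
Proof.
move=> mh; apply/measurable_fun_tnthP => i.
rewrite (_ : _ \o _ = h ^~ i); first exact: mh.
by apply/funext => x /=; rewrite tnth_mktuple.
Qed.

End measurable_lemmas.

(** * Euclidean vectors *)

Section vectors.
Context (R : realType) (d : nat).
Implicit Types x y z : d.-tuple R.

(** The only vector operation: sum, difference, multiple and opposite are [vlin 1 1], [vlin 1 (-1)],
    [vlin c 0 x x] and [vlin (-1) 0 x x], so bilinearity and measurability are proved once. *)
Definition vlin (a b : R) x y : d.-tuple R := [tuple a * tnth x i + b * tnth y i | i < d].

Definition vdot x y : R := \sum_(i < d) tnth x i * tnth y i.

Definition v0 : d.-tuple R := nseq_tuple d 0.

Definition nrm x : R := eucl_dist x v0.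

Lemma tnth_v0 i : tnth v0 i = 0.
Proof. by rewrite (tnth_nth 0) /= nth_nseq ltn_ord. Qed.

Lemma nrmE x : nrm x = Num.sqrt (vdot x x).
Proof.
rewrite /nrm /eucl_dist /vdot; congr Num.sqrt; apply: eq_bigr => i _.
by rewrite tnth_v0 subr0 expr2.
Qed.

Lemma vdot_ge0 x : 0 <= vdot x x.
Proof. by apply: sumr_ge0 => i _; rewrite -expr2 sqr_ge0. Qed.

Lemma nrm_ge0 x : 0 <= nrm x.
Proof. by rewrite nrmE sqrtr_ge0. Qed.

Lemma nrm2 x : nrm x ^+ 2 = vdot x x.
Proof. by rewrite nrmE sqr_sqrtr // vdot_ge0. Qed.

Lemma eucl_distE x y : eucl_dist x y = nrm (vlin 1 (-1) x y).
Proof.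
rewrite nrmE; congr Num.sqrt; apply: eq_bigr => i _.
by rewrite !tnth_mktuple expr2 mul1r mulN1r.
Qed.

Lemma vdotC x y : vdot x y = vdot y x.
Proof. by apply: eq_bigr => i _; rewrite mulrC. Qed.

Lemma vdotDl a b x y z : vdot (vlin a b x y) z = a * vdot x z + b * vdot y z.
Proof.
rewrite /vdot !mulr_sumr -big_split; apply: eq_bigr => i _.
by rewrite !tnth_mktuple /=; ring.
Qed.

Lemma vdotDr a b x y z : vdot z (vlin a b x y) = a * vdot z x + b * vdot z y.
Proof. by rewrite vdotC vdotDl !(vdotC z). Qed.

Lemma nrm_scale a x : 0 <= a -> nrm (vlin a 0 x x) = a * nrm x.
Proof.
move=> a0; rewrite !nrmE vdotDl vdotDr !mul0r !addr0 mulrA -expr2 sqrtrM ?sqr_ge0//.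
by rewrite sqrtr_sqr ger0_norm.
Qed.

Lemma nrmN x : nrm (vlin (-1) 0 x x) = nrm x.
Proof. by rewrite !nrmE vdotDl vdotDr !mul0r !addr0 mulrA mulrNN !mul1r. Qed.

Lemma eucl_distC x y : eucl_dist x y = eucl_dist y x.
Proof.
by rewrite /eucl_dist; congr Num.sqrt; apply: eq_bigr => i _; rewrite -sqrrN opprB.
Qed.

End vectors.
Arguments v0 {R d}.

Section measurable_vec.
Context d1 (T : measurableType d1) (R : realType) (d : nat).
Implicit Types f g : T -> d.-tuple R.

Lemma measf_vlin a b f g : measurable_fun setT f -> measurable_fun setT g ->
  measurable_fun setT (fun x => vlin a b (f x) (g x)).
Proof.
move=> mf mg; apply: measf_mktuple => i.
by apply: measfD; apply: measfM => //; exact: measf_tnth.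
Qed.

Lemma measf_vdot f g : measurable_fun setT f -> measurable_fun setT g ->
  measurable_fun setT (fun x => vdot (f x) (g x)).
Proof.
by move=> mf mg; apply: measf_sum => i; apply: measfM => //; exact: measf_tnth.
Qed.

Lemma measf_eucl f g : measurable_fun setT f -> measurable_fun setT g ->
  measurable_fun setT (fun x => eucl_dist (f x) (g x)).
Proof.
move=> mf mg; apply: measf_sqrt; apply: measf_sum => i; apply: measfX.
by apply: measfB; exact: measf_tnth.
Qed.

Lemma measf_nrm f : measurable_fun setT f -> measurable_fun setT (fun x => nrm (f x)).
Proof. by move=> mf; exact: measf_eucl. Qed.

End measurable_vec.

Lemma measfEM d1 (T : measurableType d1) (R : realType) (f g : T -> \bar R) :
  measurable_fun setT f -> measurable_fun setT g -> measurable_fun setT (fun x => f x * g x)%E.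
Proof. exact: emeasurable_funM. Qed.

Lemma measfED d1 (T : measurableType d1) (R : realType) (f g : T -> \bar R) :
  measurable_fun setT f -> measurable_fun setT g -> measurable_fun setT (fun x => f x + g x)%E.
Proof. exact: emeasurable_funD. Qed.

(** Syntax-directed measurability. The clauses on partial applications catch eta-reduced heads; the
    last one composes with a measurable function of the context. *)
Ltac meas1 := match goal with
  | |- _ => assumption
  | |- measurable_fun _ (fun _ => ?c) => exact: measurable_cst
  | |- measurable_fun _ (fun x => x) => exact: measurable_id
  | |- measurable_fun _ fst => exact: measurable_fst
  | |- measurable_fun _ snd => exact: measurable_snd
  | |- measurable_fun _ (fun x => (_ * _)%E) => apply: measfEM
  | |- measurable_fun _ (fun x => (_ + _)%E) => apply: measfED
  | |- measurable_fun _ (fun x => (_)%:E) => apply: measfE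
  | |- measurable_fun _ (fun x => (nat_of_bool _)%:R) => apply: measf_natr
  | |- measurable_fun _ (fun x => _ && _) => apply: measf_and
  | |- measurable_fun _ (fun x => ~~ _) => apply: measf_neg
  | |- measurable_fun _ (fun x => (_ <= _)%R) => apply: measf_ler
  | |- measurable_fun _ (fun x => (_ < _)%R) => apply: measf_ltr
  | |- measurable_fun _ (fun x => nrm _) => apply: measf_nrm
  | |- measurable_fun _ (fun x => eucl_dist _ _) => apply: measf_eucl
  | |- measurable_fun _ (fun x => vdot _ _) => apply: measf_vdot
  | |- measurable_fun _ (fun x => vlin _ _ _ _) => apply: measf_vlin
  | |- measurable_fun _ (fun x => (_ - _)%R) => apply: measfB
  | |- measurable_fun _ (fun x => (_ + _)%R) => first [apply: measfD | apply: measfED]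
  | |- measurable_fun _ (fun x => (- _)%R) => apply: measfN
  | |- measurable_fun _ (fun x => (_ * _)%R) => apply: measfM
  | |- measurable_fun _ (fun x => (_ ^+ _)%R) => apply: measfX
  | |- measurable_fun _ (fun x => (`| _ |)%R) => apply: measf_norm
  | |- measurable_fun _ (fun x => (Num.sqrt _)%R) => apply: measf_sqrt
  | |- measurable_fun _ (fun x => (_, _)) => apply: measurable_fun_pair
  | |- measurable_fun _ (fun x => (_).1) => apply: measf_fst
  | |- measurable_fun _ (fun x => (_).2) => apply: measf_snd
  | |- measurable_fun _ (eucl_dist ?x) => apply: (@measf_eucl _ _ _ _ (fun=> x) (fun y => y))
  | |- measurable_fun _ (Order.le ?c) => apply: (@measf_ler _ _ _ (fun=> c) (fun y => y))
  | |- measurable_fun _ (Order.lt ?c) => apply: (@measf_ltr _ _ _ (fun=> c) (fun y => y))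
  | |- measurable_fun _ (fun x => tnth _ _) => apply: measf_tnth
  | |- measurable_fun _ (@nrm _ _) => apply: (@measf_nrm _ _ _ _ (fun y => y))
  | |- measurable_fun _ (vdot ?x) => apply: (@measf_vdot _ _ _ _ (fun=> x) (fun y => y))
  | |- measurable_fun _ (vlin _ _ ?x) => apply: (@measf_vlin _ _ _ _ _ _ (fun=> x) (fun y => y))
  | H : measurable_fun _ ?h |- measurable_fun _ (fun x => ?h _) => apply: (measurableT_comp H)
  end.
Ltac meas := repeat meas1.

(** * Affine changes of variables *)

Section affine.
Variable R : realType.
(** The measure r [leb (phi^-1 A)], with phi x = a + r x, gives every half-open interval its length,
    so it is Lebesgue measure by uniqueness. *)
Lemma leb_aff (a r : R) (A : set R) : 0 < r -> measurable A ->
  (leb ((fun x : R => (a + r * x)%R) @^-1` A) = (r^-1)%:E * leb A)%E.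
Proof.
move=> r0 mA.
pose phi : measurableTypeR R -> measurableTypeR R := fun x => a + r * x.
have mphi : measurable_fun setT phi.
  by apply: (@measurable_funD _ _ R) => //; exact: (@measurable_funM _ _ R).
pose m := [the {measure set (measurableTypeR R) -> \bar R} of
   mscale (NngNum (ltW r0)) (pushm (@lebesgue_measure R) mphi)].
have H : lebesgue_measure A = m A.
  apply: lebesgue_measure_unique => // _ [[b c] _ <-] /=.
  have E : phi @^-1` `]b, c]%classic = `](b - a) / r, (c - a) / r]%classic.
    apply/seteqP; split => x /=; rewrite !in_itv /= /phi.
      by move=> /andP[h1 h2]; rewrite ltr_pdivrMr// ler_pdivlMr//; apply/andP; split; lra.
    by rewrite ltr_pdivrMr// ler_pdivlMr// => /andP[h1 h2]; apply/andP; split; lra.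
  have -> : m `]b, c]%classic = (r%:E * lebesgue_measure (phi @^-1` `]b, c]%classic))%E by [].
  rewrite E !lebesgue_measure_itv /= !lte_fin ltr_pM2r ?invr_gt0// ltrD2r.
  case: ifPn => _; last by rewrite mule0.
  rewrite -!EFinB -EFinM; congr (_%:E); field.
  by rewrite gt_eqF.
have -> : leb A = (r%:E * leb ((fun x : R => (a + r * x)%R) @^-1` A))%E by exact: H.
by rewrite muleA -EFinM mulVf ?gt_eqF// mul1e.
Qed.
End affine.

Section integral_wrappers.
Context d1 (T : measurableType d1) (R : realType) (m : {measure set T -> \bar R}).
Local Open Scope ereal_scope.
Implicit Types g h : T -> \bar R.

Lemma integral_pred (p : T -> bool) : measurable_fun setT p ->
  \int[m]_x (p x)%:R%:E = m [set x | p x].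
Proof.
move=> mp; rewrite -(setIT [set x | p x]) -integral_indic//; last exact: measurable_pred.
apply: eq_integral => x _; rewrite indicE.
by case: (boolP (p x)) => px; [rewrite mem_set|rewrite memNset //=; exact/negP].
Qed.

Lemma ge0_integral_preimage (phi : T -> T) (k : R) g : measurable_fun setT phi ->
  (0 <= k)%R -> (forall A, measurable A -> m (phi @^-1` A) = k%:E * m A) ->
  measurable_fun setT g -> (forall x, 0 <= g x) ->
  \int[m]_x g (phi x) = k%:E * \int[m]_x g x.
Proof.
move=> mphi k0 mE mg g0.
rewrite -(@ge0_integral_mscale _ _ _ m setT measurableT (NngNum k0) g)//.
rewrite [LHS](_ : _ = \int[pushforward m phi]_x g x); last first.
  by rewrite ge0_integral_pushforward.
by apply: (eq_measure_integral (mscale (NngNum k0) m)) => A mA _; exact: mE.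
Qed.

End integral_wrappers.

Section affine_change.
Variable R : realType.
Local Open Scope ereal_scope.

Lemma ge0_integral_leb_aff (a r : R) (g : R -> \bar R) : (0 < r)%R ->
  measurable_fun setT g -> (forall x, 0 <= g x) ->
  \int[leb]_x g (a + r * x)%R = (r^-1)%:E * \int[leb]_x g x.
Proof.
move=> r0 mg g0; apply: (@ge0_integral_preimage _ _ _ leb (fun x => a + r * x)%R) => //.
- by meas.
- by rewrite invr_ge0 ltW.
- by move=> A mA; exact: leb_aff.
Qed.

Lemma vlin_cons d (a b x y : R) (s t : d.-tuple R) :
  vlin a b (cons_tuple x s) (cons_tuple y t) =
  cons_tuple (a * x + b * y)%R (vlin a b s t).
Proof.
apply: eq_from_tnth => i; rewrite tnth_mktuple.
case: (unliftP ord0 i) => [j ->|->]; last by rewrite !tnth0.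
by rewrite !tnthS tnth_mktuple.
Qed.

Lemma cons_tuple_eta d (a : d.+1.-tuple R) :
  a = cons_tuple (thead a) (behead_tuple a).
Proof. by apply: val_inj; case: a => -[]. Qed.

(** Induction on the dimension: each coordinate contributes one factor 1 / r. *)
Lemma ge0_integral_lam_aff d (a : d.-tuple R) (r : R) (g : d.-tuple R -> \bar R) :
  (0 < r)%R -> measurable_fun setT g -> (forall x, 0 <= g x) ->
  \int[lam d]_x g (vlin 1 r a x) = (r^-1 ^+ d)%:E * \int[lam d]_x g x.
Proof.
move=> r0; elim: d a g => [|d IH] a g mg g0.
  by rewrite expr0 mul1e; apply: eq_integral => x _; congr (g _); apply: eq_from_tnth => -[].
have mv (b : d.+1.-tuple R) : measurable_fun setT (vlin 1 r b).
  by apply: measf_vlin => //; exact: measurable_id.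
have mc x : measurable_fun setT (fun t : d.-tuple R => g (cons_tuple x t)).
  by apply: (measurableT_comp mg); exact: measurable_cons.
rewrite /lam ge0_integral_pwS//; last exact: (measurableT_comp mg (mv a)).
rewrite ge0_integral_pwS// -/(lam d) (cons_tuple_eta a).
set a0 := thead a; set a' := behead_tuple a.
under eq_integral => x _.
  under eq_integral do rewrite vlin_cons.
  rewrite (IH a' (fun t => g (cons_tuple (1 * a0 + r * x)%R t)))// mul1r.
  over.
have r1 : (0 <= r^-1)%R by rewrite invr_ge0 ltW.
have mi : measurable_fun setT (fun x : R => \int[lam d]_t g (cons_tuple x t)).
  exact: measurable_integral_lam.
rewrite ge0_integralZl//=; first last.
- by rewrite lee_fin exprn_ge0.
- by move=> x _; exact: integral_ge0.
- by apply: (measurableT_comp mi); meas.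
rewrite (@ge0_integral_leb_aff a0 r (fun x => \int[lam d]_t g (cons_tuple x t)))//.
  by rewrite muleA -EFinM exprSr.
by move=> x; exact: integral_ge0.
Qed.

Lemma lam_aff d (a : d.-tuple R) (r : R) (A : set (d.-tuple R)) :
  (0 < r)%R -> measurable A ->
  lam d [set x | A (vlin 1 r a x)] = (r^-1 ^+ d)%:E * lam d A.
Proof.
move=> r0 mA.
have mv : measurable_fun setT (vlin 1 r a).
  by apply: measf_vlin => //; exact: measurable_id.
have mA' : measurable [set x | A (vlin 1 r a x)].
  by rewrite -[X in measurable X]setTI; exact: mv.
rewrite -[X in lam d X]setIT -integral_indic//.
rewrite -[in RHS](setIT A) -integral_indic//.
rewrite -(@ge0_integral_lam_aff d a r (fun x => (\1_A x)%:E))//.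
by apply/measurable_EFinP; exact: measurable_indic.
Qed.

Lemma ge0_integral_lam_shift d (a : d.-tuple R) (g : d.-tuple R -> \bar R) :
  measurable_fun setT g -> (forall x, 0 <= g x) ->
  \int[lam d]_x g (vlin 1 1 a x) = \int[lam d]_x g x.
Proof.
by move=> mg g0; rewrite ge0_integral_lam_aff// invr1 expr1n mul1e.
Qed.

End affine_change.

(** * Measure of boxes *)

Section rect.
Context d1 (T : measurableType d1) (R : realType).
Local Open Scope ereal_scope.

(** The sides are indexed by [nat] and not by ['I_n], so that the tail of a box is the shifted
    family and induction on [n] needs no cast. *)
Definition rect n (A : nat -> set T) : set (n.-tuple T) :=
  [set t | forall i : 'I_n, A i (tnth t i)].
Arguments rect n A : clear implicits.

Lemma measurable_rect n (A : nat -> set T) :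
  (forall i, measurable (A i)) -> measurable (rect n A).
Proof.
move=> mA.
rewrite (_ : rect n A = \bigcap_(i in [set: 'I_n]) ((fun t => tnth t i) @^-1` A i)).
  apply: fin_bigcap_measurable; first exact: finite_finset.
  by move=> i _; rewrite -[X in measurable X]setTI; exact: measurable_tnth.
by apply/seteqP; split => t h // i; [move=> _; exact: h|exact: (h i I)].
Qed.

Lemma pw_rect (m : {sigma_finite_measure set T -> \bar R}) n (A : nat -> set T) :
  (forall i, measurable (A i)) ->
  pw m n (rect n A) = \prod_(i < n) m (A i).
Proof.
elim: n A => [|n IH] A mA.
  rewrite big_ord0 -(setIT (rect _ _)) -integral_indic//; last exact: measurable_rect.
  by rewrite ge0_integral_pw0 indicE mem_set// => -[].
rewrite -(setIT (rect _ _)) -integral_indic//; last exact: measurable_rect.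
have mr := @measurable_rect n (fun i => A i.+1) (fun i => mA _).
rewrite ge0_integral_pwS//; last first.
  by apply/measurable_EFinP; apply: measurable_indic; exact: measurable_rect.
transitivity (\int[m]_x ((\1_(A 0%N) x)%:E * pw m n (rect n (fun i => A i.+1)))).
  apply: eq_integral => x _.
  rewrite -(setIT (rect n _)) -integral_indic//.
  rewrite -(@ge0_integralZl _ _ _ (pw m n) setT measurableT
    (fun t => (\1_(rect n (fun i => A i.+1)) t)%:E))//; last first.
    by apply/measurable_EFinP; exact: measurable_indic.
  apply: eq_integral => t _; rewrite -EFinM !indicE -natrM mulnb; congr (_%:R%:E).
  congr (nat_of_bool _); apply/idP/idP.
    move=> /set_mem h; apply/andP; split; apply/mem_set.
      by have := h ord0; rewrite tnth0.
    by move=> i; have := h (lift ord0 i); rewrite tnthS.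
  move=> /andP[/set_mem h0 /set_mem h]; apply/mem_set => i.
  case: (unliftP ord0 i) => [j ->|->]; last by rewrite tnth0.
  by rewrite tnthS; exact: h.
rewrite ge0_integralZr//; last by apply/measurable_EFinP; exact: measurable_indic.
by rewrite integral_indic// setIT IH// big_ord_recl.
Qed.

End rect.
Arguments rect {d1 T} n A.

Section ge0_integrals.
Context d1 (T : measurableType d1) (R : realType) (m : {measure set T -> \bar R}).
Local Open Scope ereal_scope.
Implicit Types g h : T -> \bar R.

Lemma int_scale (k : \bar R) g : 0 <= k -> measurable_fun setT g -> (forall x, 0 <= g x) ->
  \int[m]_x (k * g x) = k * \int[m]_x g x.
Proof. by move=> k0 mg g0; rewrite ge0_integralZl. Qed.

Lemma int_scaler (k : \bar R) g : 0 <= k -> measurable_fun setT g -> (forall x, 0 <= g x) ->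
  \int[m]_x (g x * k) = (\int[m]_x g x) * k.
Proof. by move=> k0 mg g0; rewrite ge0_integralZr. Qed.

Lemma int_le g h : measurable_fun setT g -> measurable_fun setT h -> (forall x, 0 <= g x) ->
  (forall x, g x <= h x) -> \int[m]_x g x <= \int[m]_x h x.
Proof. by move=> mg mh g0 gh; apply: ge0_le_integral. Qed.

Lemma int_add g h : measurable_fun setT g -> measurable_fun setT h -> (forall x, 0 <= g x) ->
  (forall x, 0 <= h x) -> \int[m]_x (g x + h x) = \int[m]_x g x + \int[m]_x h x.
Proof. by move=> mg mh g0 h0; rewrite ge0_integralD. Qed.

Lemma int_eq g h : (forall x, g x = h x) -> \int[m]_x g x = \int[m]_x h x.
Proof. by move=> gh; apply: eq_integral => x _. Qed.

End ge0_integrals.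

(** * Volume of balls and invariance under isometries *)

Section balls.
Variable R : realType.

Lemma coord_le_nrm d (x : d.-tuple R) i : `|tnth x i| <= nrm x.
Proof.
rewrite nrmE -sqrtr_sqr ler_sqrt ?vdot_ge0// /vdot (bigD1 i)//= expr2 lerDl.
by apply: sumr_ge0 => j _; rewrite -expr2 sqr_ge0.
Qed.

Lemma nrm_le_coord d (x : d.-tuple R) (c : R) : 0 <= c ->
  (forall i, `|tnth x i| <= c) -> nrm x <= d%:R * c.
Proof.
move=> c0 h; have dc : 0 <= d%:R * c by rewrite mulr_ge0.
rewrite nrmE -(ger0_norm dc) -sqrtr_sqr ler_sqrt ?sqr_ge0//.
apply: (@le_trans _ _ (\sum_(i < d) c ^+ 2)).
  apply: ler_sum => i _; rewrite -expr2 -real_normK ?num_real//.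
  by rewrite ler_pXn2r// nnegrE.
rewrite sumr_const card_ord -[X in X <= _]mulr_natl exprMn ler_wpM2r ?sqr_ge0//.
by rewrite -natrX ler_nat; case: (d) => // k; rewrite expnS leq_pmulr// expn_gt0.
Qed.

Local Open Scope ereal_scope.

Lemma measurable_ball d (x : d.-tuple R) (c : R) :
  measurable [set y | (eucl_dist x y <= c)%R].
Proof. by apply: measurable_pred; meas. Qed.

Lemma measurable_unit_ball d : measurable (@unit_ball R d).
Proof. by apply: (@measurable_pred _ _ (fun y => (nrm y <= 1)%R)); meas. Qed.

Lemma lam_ball_lty d : lam d (@unit_ball R d) < +oo.
Proof.
pose c : R := 1%R.
apply: (@le_lt_trans _ _ (lam d (rect d (fun=> `[(- c)%R, c]%classic)))).
  apply: le_measure; rewrite ?inE; [exact: measurable_unit_ball| |].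
    by apply: measurable_rect => i; exact: measurable_itv.
  move=> x /= xB i; rewrite /= in_itv /= -ler_norml.
  exact: (le_trans (coord_le_nrm x i)).
rewrite pw_rect; last by move=> i; exact: measurable_itv.
have loo : leb `[(- c)%R, c]%classic < +oo.
  by rewrite /leb /pushforward lebesgue_measure_itv /= lte_fin -EFinB; case: ifP; rewrite ltry.
elim: d => [|k IH]; first by rewrite big_ord0 ltry.
rewrite big_ord_recr /= lte_mul_pinfty//; first exact: prode_ge0.
by rewrite ge0_fin_numE//; exact: prode_ge0.
Qed.

Lemma lam_ball_gt0 d : 0 < lam d (@unit_ball R d).
Proof.
(* On the cube of half side 1/(d+1) the norm is at most d/(d+1) <= 1; the successor keeps [c]
   positive when d = 0. *)
pose c : R := (d.+1%:R^-1)%R.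
have c0 : (0 < c)%R by rewrite invr_gt0.
apply: (@lt_le_trans _ _ (lam d (rect d (fun=> `[(-c)%R, c]%classic)))); last first.
  apply: le_measure; rewrite ?inE; [|exact: measurable_unit_ball|].
    by apply: measurable_rect => i; exact: measurable_itv.
  move=> x xr; rewrite /unit_ball /= -/(nrm x).
  apply: (@le_trans _ _ (d%:R * c)%R); last by rewrite ler_pdivrMr// mul1r ler_nat.
  apply: nrm_le_coord => [|i]; first exact: ltW.
  by have := xr i; rewrite /= in_itv /= -ler_norml.
rewrite pw_rect; last by move=> i; exact: measurable_itv.
have l0 : 0 < leb `[(- c)%R, c]%classic.
  by rewrite /leb /pushforward lebesgue_measure_itv /= lte_fin -EFinB gtrN// lte_fin subr_gt0 gtrN.
elim: (X in \prod_(i < X) _) => [|k IH]; first by rewrite big_ord0 lte01.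
by rewrite big_ord_recr /= mule_gt0.
Qed.

Definition vol d : R := fine (lam d (@unit_ball R d)).

Lemma volE d : lam d (@unit_ball R d) = (vol d)%:E.
Proof. by rewrite fineK// ge0_fin_numE// lam_ball_lty. Qed.

Lemma vol_gt0 d : (0 < vol d)%R.
Proof. by rewrite -lte_fin -volE lam_ball_gt0. Qed.

Lemma lam_ball d (x : d.-tuple R) (c : R) : (0 < c)%R ->
  lam d [set y | (eucl_dist x y <= c)%R] = (c ^+ d * vol d)%:E.
Proof.
move=> c0; have := lam_aff x c0 (measurable_ball x c).
rewrite (_ : [set y | _] = @unit_ball R d); last first.
  have E y : (eucl_dist x (vlin 1 c x y) <= c)%R = (nrm y <= 1)%R.
    rewrite eucl_distE (_ : vlin _ _ _ _ = vlin (-1) 0 (vlin c 0 y y) (vlin c 0 y y)).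
      by rewrite nrmN (nrm_scale _ (ltW c0)) -{2}(mulr1 c) ler_pM2l.
    by apply: eq_from_tnth => i; rewrite !tnth_mktuple; ring.
  by apply/seteqP; split => y /=; rewrite E.
rewrite volE => /(congr1 (fun z => (c ^+ d)%:E * z)).
rewrite muleA -!EFinM -exprMn mulfV ?gt_eqF// expr1n mul1e => ->.
by [].
Qed.

Lemma integral_ball d (x : d.-tuple R) (c : R) : (0 < c)%R ->
  \int[lam d]_y ((eucl_dist x y <= c)%R%:R : R)%:E = (c ^+ d * vol d)%:E.
Proof. by move=> c0; rewrite integral_pred; [exact: lam_ball|meas]. Qed.

Lemma integral_unit_ball d :
  \int[lam d]_y ((nrm y <= 1)%R%:R : R)%:E = (vol d)%:E.
Proof. by rewrite integral_pred; [exact: volE|meas]. Qed.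

(* Uniqueness of Haar measure: [vol * lam (T^-1 A)] is rewritten by Tonelli and
   translation invariance as [lam A * vol], the ball being [T]-invariant. *)
Lemma lam_isometry d (T : d.-tuple R -> d.-tuple R) (A : set (d.-tuple R)) :
  measurable_fun setT T -> involutive T ->
  (forall x y, T (vlin 1 1 x y) = vlin 1 1 (T x) (T y)) ->
  (forall x y, eucl_dist (T x) (T y) = eucl_dist x y) ->
  measurable A -> lam d (T @^-1` A) = lam d A.
Proof.
move=> mT TT Tadd Tiso mA.
pose b (y : d.-tuple R) : \bar R := ((\1_A y)%:E).
have mb : measurable_fun setT b by apply/measurable_EFinP; exact: measurable_indic.
have b0 y : 0 <= b y by rewrite lee_fin.
have mA' : measurable (T @^-1` A) by rewrite -[X in measurable X]setTI; exact: mT.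
have bT : \int[lam d]_y b (T y) = lam d (T @^-1` A).
  by rewrite -[in RHS](setIT (T @^-1` A)) -integral_indic.
have bA : \int[lam d]_y b y = lam d A.
  by rewrite -[in RHS](setIT A) -integral_indic.
have mbT : measurable_fun setT (b \o T) by exact: measurableT_comp.
pose u (x : d.-tuple R) : \bar R := ((nrm x <= 1)%R%:R)%:E.
have u0 x : 0 <= u x by rewrite lee_fin.
have mu : measurable_fun setT u by rewrite /u; meas.
suff : (vol d)%:E * lam d (T @^-1` A) = (vol d)%:E * lam d A.
  move/(congr1 (fun z => ((vol d)^-1)%:E * z)).
  by rewrite !muleA -!EFinM mulVf ?gt_eqF ?vol_gt0// !mul1e.
rewrite -bT -bA -integral_unit_ball.
transitivity (\int[lam d]_x \int[lam d]_y (u x * b (vlin 1 1 x (T y)))).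
  rewrite -int_scaler//; last exact: integral_ge0.
  apply: int_eq => x.
  rewrite -int_scale//.
  rewrite -(@ge0_integral_lam_shift _ _ (T x) (fun y => u x * b (T y)))//.
  - by apply: int_eq => y; rewrite Tadd TT.
  - by meas.
  - by move=> y; rewrite mule_ge0.
have mvT : measurable_fun setT (fun p : d.-tuple R * d.-tuple R => vlin 1 1 p.1 (T p.2)).
  by apply: measf_vlin; [meas|apply: (measurableT_comp mT); meas].
rewrite (fubini_tonelli (fun p => u p.1 * b (vlin 1 1 p.1 (T p.2)))); first last.
- by move=> p; rewrite mule_ge0.
- apply: measfEM; first by apply: (measurableT_comp mu); meas.
  by apply: (measurableT_comp mb).
transitivity (\int[lam d]_y \int[lam d]_x (((eucl_dist x (T y) <= 1)%R%:R)%:E * b x)).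
  apply: int_eq => y.
  rewrite -[RHS](@ge0_integral_lam_shift _ _ (T y)).
  - apply: int_eq => x /=; rewrite (_ : vlin 1 1 (T y) x = vlin 1 1 x (T y)).
      rewrite eucl_distE (_ : vlin 1 (-1) _ _ = x)//.
      by apply: eq_from_tnth => i; rewrite !tnth_mktuple; ring.
    by apply: eq_from_tnth => i; rewrite !tnth_mktuple; ring.
  - by meas.
  - by move=> x; rewrite mule_ge0.
rewrite -(fubini_tonelli (fun p => ((eucl_dist p.1 (T p.2) <= 1)%R%:R)%:E * b p.1)); first last.
- by move=> p; rewrite mule_ge0// lee_fin.
- apply: measfEM; last by apply: (measurableT_comp mb); meas.
  by meas; apply: (measurableT_comp mT); meas.
rewrite -[RHS]int_scale//; last by apply: integral_ge0.
apply: eq_integral => x _ /=.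
(* The distance from x to T y is that from T x to y, so the integral over y is the volume of a unit
   ball centred at T x. *)
under eq_integral do rewrite -Tiso TT.
rewrite int_scaler//; last by meas.
by rewrite integral_ball// expr1n mul1r integral_unit_ball.
Qed.

End balls.

(** * Spheres, reflections and lenses *)

Section spheres.
Variable R : realType.
Local Open Scope ereal_scope.

Lemma vdot_cons d (x y : R) (s t : d.-tuple R) :
  vdot (cons_tuple x s) (cons_tuple y t) = (x * y + vdot s t)%R.
Proof.
rewrite /vdot big_ord_recl !tnth0; congr (_ + _)%R.
by apply: eq_bigr => i _; rewrite !tnthS.
Qed.

Lemma nrm_cons2 d (x : R) (t : d.-tuple R) : (nrm (cons_tuple x t) ^+ 2 = x ^+ 2 + nrm t ^+ 2)%R.
Proof. by rewrite !nrm2 vdot_cons expr2. Qed.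

Lemma leb_set1 (a : R) : leb [set a] = 0.
Proof. exact: lebesgue_measure_set1. Qed.

Lemma ge0_integral_cons_swap d (g : d.+1.-tuple R -> \bar R) :
  measurable_fun setT g -> (forall t, 0 <= g t) ->
  \int[lam d.+1]_t g t = \int[lam d]_t \int[leb]_x g (cons_tuple x t).
Proof.
move=> mg g0; rewrite ge0_integral_pwS//.
apply: (fubini_tonelli (g \o @consp _ R d)); last by move=> ?; exact: g0.
by apply: (measurableT_comp mg); exact: measurable_consp.
Qed.

(** A line parallel to the first axis meets the sphere in at most two points. The dimension is a
    successor because in dimension 0 the sphere of radius 0 is the whole space, of mass 1. *)
Lemma lam_sphere d (c : R) : lam d.+1 [set y | nrm y == c] = 0.
Proof.
have mp : measurable_fun setT (fun y : d.+1.-tuple R => nrm y == c).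
  by apply: measurable_fun_eqr; meas.
rewrite -integral_pred//; rewrite ge0_integral_cons_swap//; last by meas.
apply: integral0_eq => t _.
pose a := Num.sqrt (c ^+ 2 - nrm t ^+ 2)%R.
rewrite integral_pred; last first.
  by apply: (measurableT_comp mp); exact: measurable_cons.
have h0 : leb ([set a] `|` [set (- a)%R]) = 0.
  apply/eqP; rewrite -measure_le0 (le_trans (measureU2 _ _ _))//.
  by rewrite [X in X + _]leb_set1 [X in _ + X]leb_set1 adde0.
apply/eqP; rewrite -measure_le0 -h0; apply: le_measure; rewrite ?inE.
- by apply: measurable_pred; apply: (measurableT_comp mp); exact: measurable_cons.
- exact: measurableU.
move=> x /eqP h; have := nrm_cons2 x t; rewrite h => {}h.
have : (x ^+ 2 == a ^+ 2)%R.
  by rewrite sqr_sqrtr h addrK// sqr_ge0.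
by rewrite eqf_sqr => /orP[/eqP ->|/eqP ->]; [left|right].
Qed.

Lemma lam_sphere_dist d (x : d.+1.-tuple R) (c : R) : lam d.+1 [set y | eucl_dist x y == c] = 0.
Proof.
have mp : measurable_fun setT (fun y : d.+1.-tuple R => eucl_dist x y == c).
  by apply: measurable_fun_eqr; meas.
have := lam_aff x (@ltr01 R) (measurable_pred mp).
rewrite invr1 expr1n mul1e => <-; rewrite -[RHS](lam_sphere d c).
congr (lam d.+1 _); apply/seteqP; split => y /=; rewrite eucl_distE;
  by rewrite (_ : vlin 1 (-1) x _ = vlin (-1) 0 y y) ?nrmN//;
    apply: eq_from_tnth => i; rewrite !tnth_mktuple; ring.
Qed.

(** Ties between side lengths of a triangle 0, x, y with x fixed live on such null spheres, so this
    exchanges strict and weak inequalities. *)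
Lemma lam_eq_off_spheres d (x : d.+1.-tuple R) (a b : R) (p q : d.+1.-tuple R -> bool) :
  measurable_fun setT p -> measurable_fun setT q ->
  (forall y, nrm y != a -> eucl_dist x y != b -> p y = q y) ->
  lam d.+1 [set y | p y] = lam d.+1 [set y | q y].
Proof.
move=> mp mq pq.
pose N : set (d.+1.-tuple R) := [set y | nrm y == a] `|` [set y | eucl_dist x y == b].
have mN1 : measurable [set y : d.+1.-tuple R | nrm y == a].
  by apply: measurable_pred; apply: measurable_fun_eqr; meas.
have mN2 : measurable [set y : d.+1.-tuple R | eucl_dist x y == b].
  by apply: measurable_pred; apply: measurable_fun_eqr; meas.
have mN : measurable N by exact: measurableU.
have N0 : lam d.+1 N = 0.
  apply/eqP; rewrite -measure_le0 (le_trans (measureU2 _ _ _))//.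
  by rewrite [X in X + _]lam_sphere [X in _ + X]lam_sphere_dist adde0.
have sub (r s : d.+1.-tuple R -> bool) : measurable_fun setT r -> measurable_fun setT s ->
    (forall y, nrm y != a -> eucl_dist x y != b -> r y = s y) ->
    lam d.+1 [set y | r y] <= lam d.+1 [set y | s y].
  move=> mr ms rs; apply: (@le_trans _ _ (lam d.+1 ([set y | s y] `|` N))).
    apply: le_measure; rewrite ?inE; [exact: measurable_pred| |].
      by apply: measurableU => //; exact: measurable_pred.
    move=> y /= ry; have [ya|ya] := eqVneq (nrm y) a; first by right; left; apply/eqP.
    have [yb|yb] := eqVneq (eucl_dist x y) b; first by right; right; apply/eqP.
    by left; rewrite -rs.
  rewrite (le_trans (measureU2 _ _ _))//; first exact: measurable_pred.
  by rewrite [X in _ + X]N0 adde0.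
by apply/eqP; rewrite eq_le !sub// => y ya yb; rewrite pq.
Qed.

Lemma lam_ball_ge0 d (c : R) : (0 <= c)%R ->
  lam d [set y | (nrm y <= c)%R] = (c ^+ d * vol R d)%:E.
Proof.
rewrite le_eqVlt => /orP[/eqP <-|c0]; last first.
  rewrite -(lam_ball v0 c0); congr (lam d _); apply/seteqP; split => y /=;
  by rewrite (eucl_distC v0).
(* In dimension 0 the ball of radius 0 has mass 1, which agrees with 0 ^+ 0 = 1; in positive
   dimension it is a null sphere. *)
case: d => [|d].
  rewrite expr0 mul1r -volE; congr (lam 0 _); apply/seteqP; split => y //= _.
    by rewrite /unit_ball /= /eucl_dist big_ord0 sqrtr0.
  by rewrite /nrm /eucl_dist big_ord0 sqrtr0.
rewrite expr0n /= mul0r; transitivity (lam d.+1 [set y : d.+1.-tuple R | nrm y == 0%R]); last exact: lam_sphere.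
congr (lam _ _); apply/seteqP; split => y /=.
  by move=> h; rewrite eq_le h nrm_ge0.
by move=> /eqP ->.
Qed.

End spheres.

Section lens.
Variable R : realType.
Variable d : nat.
Local Notation D := d.+1.
Implicit Types x y : D.-tuple R.

Definition e1 : D.-tuple R := cons_tuple 1 v0.

(** Householder reflection in the hyperplane orthogonal to u. For u = 0 division by zero yields 0
    and the map is the identity, which explains the case distinctions below. *)
Definition house (u y : D.-tuple R) : D.-tuple R :=
  vlin 1 (- (2 * vdot y u / vdot u u)) y u.

Lemma vdot_eq0 (u y : D.-tuple R) : vdot u u = 0 -> vdot y u = 0.
Proof.
move=> u0; have tu i : tnth u i = 0.
  have := coord_le_nrm u i; rewrite nrmE u0 sqrtr0 normr_le0.
  by move/eqP.
by rewrite /vdot big1// => i _; rewrite tu mulr0.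
Qed.

Lemma vdot_house u y : vdot (house u y) u = - vdot y u.
Proof.
rewrite /house vdotDl mul1r; have [u0|u0] := eqVneq (vdot u u) 0.
  by rewrite (vdot_eq0 y u0) u0; ring.
by field.
Qed.

Lemma houseK u : involutive (house u).
Proof.
move=> y; apply: eq_from_tnth => i; rewrite {1}/house tnth_mktuple vdot_house tnth_mktuple.
by ring.
Qed.

Lemma house_add u x y : house u (vlin 1 1 x y) = vlin 1 1 (house u x) (house u y).
Proof.
by apply: eq_from_tnth => i; rewrite !tnth_mktuple vdotDl; ring.
Qed.

Lemma house_sub u x y : vlin 1 (-1) (house u x) (house u y) = house u (vlin 1 (-1) x y).
Proof.
by apply: eq_from_tnth => i; rewrite !tnth_mktuple vdotDl; ring.
Qed.

Lemma nrm_house u y : nrm (house u y) = nrm y.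
Proof.
rewrite !nrmE; congr Num.sqrt; rewrite {2}/house vdotDr vdot_house vdotC [in LHS]/house vdotDr vdotC.
have [u0|u0] := eqVneq (vdot u u) 0; last by rewrite (vdotC u y); field.
by rewrite (vdotC u y) (vdot_eq0 y u0); ring.
Qed.

Lemma house_iso u x y : eucl_dist (house u x) (house u y) = eucl_dist x y.
Proof. by rewrite eucl_distE house_sub nrm_house -eucl_distE. Qed.

Lemma vdot_e1 : vdot e1 e1 = 1.
Proof.
by rewrite /e1 vdot_cons mulr1 /vdot big1 ?addr0// => i _; rewrite tnth_v0 mul0r.
Qed.

(** For u = x - |x| e1 one has <u, u> = 2 <x, u>, so the reflection subtracts exactly u from x. *)
Lemma house_e1 x : house (vlin 1 (- nrm x) x e1) x = vlin (nrm x) 0 e1 e1.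
Proof.
set u := vlin _ _ _ _.
have xu : vdot x u = nrm x ^+ 2 - nrm x * vdot x e1.
  by rewrite /u vdotDr nrm2; ring.
have uu : vdot u u = 2 * vdot x u.
  rewrite xu {1}/u vdotDl -/u xu {1}/u vdotDr vdot_e1 (vdotC e1 x).
  by ring.
have [u0|u0] := eqVneq (vdot u u) 0.
  have tu i : tnth u i = 0.
    have := coord_le_nrm u i; rewrite nrmE u0 sqrtr0 normr_le0.
    by move/eqP.
  apply: eq_from_tnth => i; have := tu i; rewrite /house u0 invr0 !tnth_mktuple => h.
  lra.
apply: eq_from_tnth => i; rewrite /house -uu divff// !tnth_mktuple; ring.
Qed.

Local Open Scope ereal_scope.

Definition lens : R :=
  fine (lam D [set z : D.-tuple R | (nrm z <= 1)%R && (eucl_dist e1 z <= 1)%R]).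

Lemma lensE :
  lam D [set z : D.-tuple R | (nrm z <= 1)%R && (eucl_dist e1 z <= 1)%R] = lens%:E.
Proof.
rewrite fineK// ge0_fin_numE//.
apply: le_lt_trans (lam_ball_lty R D); apply: le_measure; rewrite ?inE.
- by apply: measurable_pred; meas.
- exact: measurable_unit_ball.
- by move=> z /andP[].
Qed.

Lemma measurable_house u : measurable_fun setT (house u).
Proof.
apply: (@measf_mktuple _ _ _ _ (fun y i => 1 * tnth y i + (- (2 * vdot y u / vdot u u)) * tnth u i)%R) => i.
by meas; exact: measf_tnth.
Qed.

(** A reflection carries x to |x| e1, then scaling by |x| reduces to the unit lens. For x = 0 both
    sides vanish, a point being null in positive dimension. *)
Lemma lens_scale x :
  lam D [set y | (nrm y <= nrm x)%R && (eucl_dist x y <= nrm x)%R] = (nrm x ^+ D * lens)%:E.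
Proof.
have [x0|x0] := eqVneq (nrm x) 0%R.
  rewrite x0 expr0n /= mul0r; transitivity (lam d.+1 [set y : d.+1.-tuple R | nrm y == 0%R]); last exact: lam_sphere.
  apply: (@lam_eq_off_spheres _ _ x 0%R 0%R); first by meas.
    by apply: measurable_fun_eqr; meas.
  move=> y y0 _; rewrite (negbTE y0); apply/negP => /andP[h _].
  by move/negP: y0; apply; rewrite eq_le h nrm_ge0.
have xgt : (0 < nrm x)%R by rewrite lt_neqAle eq_sym x0 nrm_ge0.
set c := nrm x in xgt *.
pose A : set (D.-tuple R) :=
  [set y | (nrm y <= c)%R && (eucl_dist (vlin c 0 e1 e1) y <= c)%R].
have mA : measurable A by apply: measurable_pred; meas.
pose u := vlin 1 (- nrm x) x e1.
have := lam_isometry (measurable_house u) (houseK u) (house_add u) (house_iso u) mA.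
rewrite (_ : house u @^-1` A = [set y | (nrm y <= c)%R && (eucl_dist x y <= c)%R]); last first.
  by apply/seteqP; split => y; rewrite /A /= nrm_house /c -house_e1 house_iso.
move=> ->.
have := lam_aff v0 xgt mA.
rewrite (_ : [set y | _] = [set z : D.-tuple R | (nrm z <= 1)%R && (eucl_dist e1 z <= 1)%R]); last first.
  have E y : A (vlin 1 c v0 y) = ((nrm y <= 1)%R && (eucl_dist e1 y <= 1)%R).
    rewrite /A /=.
    have -> : vlin 1 c v0 y = vlin c 0 y y.
      by apply: eq_from_tnth => i; rewrite !tnth_mktuple tnth_v0; ring.
    rewrite (nrm_scale _ (ltW xgt)) !eucl_distE.
    have -> : vlin 1 (-1) (vlin c 0 e1 e1) (vlin c 0 y y) =
              vlin c 0 (vlin 1 (-1) e1 y) (vlin 1 (-1) e1 y).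
      by apply: eq_from_tnth => i; rewrite !tnth_mktuple; ring.
    by rewrite (nrm_scale _ (ltW xgt)) -{2 4}(mulr1 c) !ler_pM2l.
  by apply/seteqP; split => y /=; rewrite E.
rewrite lensE => /(congr1 (fun z => (c ^+ D)%:E * z)).
by rewrite muleA -!EFinM -exprMn mulfV ?gt_eqF// expr1n mul1e => ->.
Qed.

End lens.

(** * Strict monotonicity of w_d *)

Section w_formula.
Variable R : realType.
Local Open Scope ereal_scope.

Lemma int_add3 d1 (T : measurableType d1) (m : {measure set T -> \bar R}) (f g h : T -> \bar R) :
  measurable_fun setT f -> measurable_fun setT g -> measurable_fun setT h ->
  (forall x, 0 <= f x) -> (forall x, 0 <= g x) -> (forall x, 0 <= h x) ->
  \int[m]_x (f x + (g x + h x)) = \int[m]_x f x + (\int[m]_x g x + \int[m]_x h x).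
Proof.
move=> mf mg mh f0 g0 h0; rewrite int_add//; first by rewrite int_add.
  exact: measfED.
by move=> x; rewrite adde_ge0.
Qed.

Lemma indic_pred (T : Type) (p : T -> bool) (x : T) : \1_[set y | p y] x = (p x)%:R :> R.
Proof.
by rewrite indicE; case: (boolP (p x)) => px; [rewrite mem_set|rewrite memNset //=; exact/negP].
Qed.

Definition b2r (b : bool) : \bar R := (b%:R)%:E.

Lemma b2r_ge0 b : 0 <= b2r b.
Proof. by rewrite lee_fin. Qed.
Hint Resolve b2r_ge0 : core.

Definition Vset d : R := fine (\int[lam d]_x \int[lam d]_y
  (((nrm x <= 1)%R && (nrm y <= 1)%R && (eucl_dist x y <= 1)%R)%:R : R)%:E).

Lemma measf_int2 d1 d2 (T1 : measurableType d1) (T2 : measurableType d2)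
    (m : {sigma_finite_measure set T2 -> \bar R}) (g : T1 -> T2 -> \bar R) :
  measurable_fun setT (fun p : T1 * T2 => g p.1 p.2) -> (forall x y, 0 <= g x y) ->
  measurable_fun setT (fun x => \int[m]_y g x y).
Proof.
move=> mg g0.
apply: (@measurable_fun_fubini_tonelli_F _ _ _ _ _ m (fun p => g p.1 p.2)) => //.
Qed.

Lemma w_constE d : @w_const R d = (Vset d / vol R d ^+ 2)%R.
Proof.
rewrite /w_const; congr (fine _ / fine _ ^+ 2)%R.
  have E (x y : d.-tuple R) : (((\1_(unit_ball d) x * \1_(unit_ball d) y *
        \1_[set z | (eucl_dist x z <= 1)%R] y)%R : R)%:E =
      (((nrm x <= 1)%R && (nrm y <= 1)%R && (eucl_dist x y <= 1)%R)%:R : R)%:E).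
    by rewrite /unit_ball !indic_pred -!natrM !mulnb.
  transitivity (lebesgue_int (fun x : d.-tuple R => \int[lam d]_y
      (((nrm x <= 1)%R && (nrm y <= 1)%R && (eucl_dist x y <= 1)%R)%:R : R)%:E)).
    congr lebesgue_int; apply/funext => x.
    rewrite (_ : (fun y => _) = (fun y => (((nrm x <= 1)%R && (nrm y <= 1)%R && (eucl_dist x y <= 1)%R)%:R : R)%:E)).
      by rewrite lebesgue_intE//; meas.
    by apply/funext => y.
  rewrite lebesgue_intE//; last by move=> x; exact: integral_ge0.
  by apply: measf_int2 => //; meas.
rewrite lebesgue_intE//; last first.
  by apply/measurable_EFinP; apply: measurable_indic; exact: measurable_unit_ball.
by rewrite integral_indic ?setIT//; exact: measurable_unit_ball.
Qed.

Variable d : nat.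
Local Notation D := d.+1.

Lemma int_swap (p : D.-tuple R * D.-tuple R -> bool) : measurable_fun setT p ->
  \int[lam D]_x \int[lam D]_y b2r (p (x, y)) = \int[lam D]_y \int[lam D]_x b2r (p (x, y)).
Proof.
by move=> mp; apply: (fubini_tonelli (fun z => b2r (p z))) => //; rewrite /b2r; meas.
Qed.

(** The integral over x of the volume factor |x|^D. Its value, vol / 2, is extracted from
    [vol2_J]. *)
Definition Jint : \bar R := \int[lam D]_x ((nrm x <= 1)%R%:R * nrm x ^+ D)%:E.

Lemma Jint_ge0 : 0 <= Jint.
Proof.
by apply: integral_ge0 => x _; rewrite lee_fin mulr_ge0// exprn_ge0// nrm_ge0.
Qed.

Lemma and_int (q : bool) (p : D.-tuple R -> bool) (c : R) : measurable_fun setT p ->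
  lam D [set y | p y] = c%:E -> \int[lam D]_y b2r (q && p y) = (q%:R * c)%:E.
Proof.
move=> mp pc; rewrite /b2r integral_pred; last by meas.
case: q => /=; first by rewrite mul1r.
by rewrite mul0r (_ : [set x | false] = set0) ?measure0//; apply/seteqP; split.
Qed.

Lemma K_le : \int[lam D]_x \int[lam D]_y b2r ((nrm x <= 1)%R && (nrm y <= nrm x)%R) =
  Jint * (vol R D)%:E.
Proof.
rewrite /Jint -int_scaler//; first last.
- by move=> x; rewrite lee_fin mulr_ge0// exprn_ge0// nrm_ge0.
- by meas.
- by rewrite lee_fin ltW// vol_gt0.
apply: int_eq => x; rewrite -EFinM -mulrA.
by apply: and_int; [meas|rewrite lam_ball_ge0// nrm_ge0].
Qed.

Lemma K_lt : \int[lam D]_x \int[lam D]_y b2r ((nrm x <= 1)%R && (nrm y < nrm x)%R) =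
  Jint * (vol R D)%:E.
Proof.
rewrite -K_le; apply: int_eq => x.
rewrite !(@and_int _ _ (nrm x ^+ D * vol R D)%R)//; try by meas.
  by rewrite lam_ball_ge0// nrm_ge0.
rewrite -lam_ball_ge0 ?nrm_ge0//.
apply: (@lam_eq_off_spheres _ _ x (nrm x) 0%R); try by meas.
by move=> y yx _; rewrite lt_neqAle yx.
Qed.

(** Split pairs of points of the ball according to which norm is larger. Given x, the points y with
    |y| <= |x| have volume |x|^D vol, and the two halves are exchanged by swapping x and y. *)
Lemma vol2_J : ((vol R D) ^+ 2)%:E = Jint * (vol R D)%:E + Jint * (vol R D)%:E.
Proof.
transitivity (\int[lam D]_x \int[lam D]_y b2r ((nrm x <= 1)%R && (nrm y <= 1)%R)).
  transitivity (\int[lam D]_x (((nrm x <= 1)%R%:R : R)%:E * (vol R D)%:E)).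
    rewrite int_scaler//; last by meas.
      by rewrite integral_unit_ball -EFinM expr2.
    by rewrite lee_fin ltW// vol_gt0.
  by apply: int_eq => x; rewrite -EFinM -(@and_int _ (fun y => nrm y <= 1)%R) //; [meas|exact: volE].
rewrite -{1}K_le -K_lt.
rewrite [X in _ = _ + X](int_swap (p := fun z => (nrm z.1 <= 1)%R && (nrm z.2 < nrm z.1)%R)); last by meas.
rewrite -int_add /=.
- apply: int_eq => x; rewrite -int_add /b2r.
  + apply: int_eq => y; rewrite -EFinD -natrD; congr (_%:R%:E).
    case: (ltP (nrm x) (nrm y)) => h; case: (leP (nrm x) 1%R) => hx //=.
    * by case: (leP (nrm y) 1%R).
    * by case: (leP (nrm y) 1%R) => // hy; have := lt_trans (lt_le_trans h hy) hx; rewrite ltxx.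
    * by rewrite (le_trans h hx).
    * by rewrite andbF.
  + by meas.
  + by meas.
  + by [].
  + by [].
- by rewrite /b2r; apply: measf_int2 => //; meas.
- by rewrite /b2r; apply: measf_int2 => //; meas.
- by move=> x; exact: integral_ge0.
- by move=> x; exact: integral_ge0.
Qed.

(** The longest side of the triangle 0, x, y is x, y or x - y for [q1], [q2], [q3]. Ties go to the
    earlier case, so the partition is exact. *)
Definition q1 (x y : D.-tuple R) : bool :=
  [&& (nrm x <= 1)%R, (nrm y <= nrm x)%R & (eucl_dist x y <= nrm x)%R].
Definition q2 (x y : D.-tuple R) : bool :=
  [&& (nrm y <= 1)%R, (nrm x < nrm y)%R & (eucl_dist x y <= nrm y)%R].
Definition q3 (x y : D.-tuple R) : bool :=
  [&& (eucl_dist x y <= 1)%R, (nrm x < eucl_dist x y)%R & (nrm y < eucl_dist x y)%R].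

Lemma q_partition x y :
  ((nrm x <= 1)%R && (nrm y <= 1)%R && (eucl_dist x y <= 1)%R : nat) =
  (q1 x y + (q2 x y + q3 x y))%N.
Proof.
rewrite /q1 /q2 /q3; move: (nrm x) (nrm y) (eucl_dist x y) => a b c.
by case: (leP a 1%R) => h1; case: (leP b 1%R) => h2; case: (leP c 1%R) => h3;
  case: (leP b a) => h4; case: (leP c a) => h5; case: (leP c b) => h6 //=; exfalso; lra.
Qed.

Lemma int_q1 : \int[lam D]_x \int[lam D]_y b2r (q1 x y) = Jint * (lens R d)%:E.
Proof.
rewrite /Jint -int_scaler//; first last.
- by move=> x; rewrite lee_fin mulr_ge0// exprn_ge0// nrm_ge0.
- by meas.
- by rewrite lee_fin /lens fine_ge0.
apply: int_eq => x; rewrite -EFinM -mulrA.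
by apply: and_int; [meas|exact: lens_scale].
Qed.

(** Each of the three cases, after relabelling the vertices, agrees with [q1] except for ties. *)
Lemma int_lens (p : D.-tuple R -> D.-tuple R -> bool) :
  (forall x, measurable_fun setT (p x)) ->
  (forall x y, nrm y != nrm x -> eucl_dist x y != nrm x -> p x y = q1 x y) ->
  \int[lam D]_x \int[lam D]_y b2r (p x y) = Jint * (lens R d)%:E.
Proof.
move=> mp pq; rewrite -int_q1; apply: int_eq => x; rewrite /b2r !integral_pred; first last.
- exact: mp.
- by rewrite /q1; meas.
apply: (@lam_eq_off_spheres _ _ x (nrm x) (nrm x)) => //; last by move=> y; exact: pq.
by rewrite /q1; meas.
Qed.

Lemma int_q2 : \int[lam D]_x \int[lam D]_y b2r (q2 x y) = Jint * (lens R d)%:E.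
Proof.
rewrite (int_swap (p := fun z => q2 z.1 z.2)) /=; last by rewrite /q2; meas.
apply: int_lens => [x|x y hy hd]; first by rewrite /q2; meas.
by rewrite /q2 /q1 (eucl_distC y x) lt_neqAle hy.
Qed.

Lemma vneg_invol : involutive (fun y : D.-tuple R => vlin (-1) 0 y y).
Proof. by move=> y; apply: eq_from_tnth => i; rewrite !tnth_mktuple; ring. Qed.

Lemma int_neg (p : D.-tuple R -> bool) : measurable_fun setT p ->
  \int[lam D]_y b2r (p y) = \int[lam D]_y b2r (p (vlin (-1) 0 y y)).
Proof.
move=> mp; have mn : measurable_fun setT (fun y : D.-tuple R => vlin (-1) 0 y y) by meas.
rewrite /b2r !integral_pred//; last exact: (measurableT_comp mp mn).
apply/esym; apply: (@lam_isometry _ _ (fun y : D.-tuple R => vlin (-1) 0 y y) [set y | p y]) => //.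
- exact: vneg_invol.
- by move=> x y; apply: eq_from_tnth => i; rewrite !tnth_mktuple; ring.
- move=> x y; rewrite !eucl_distE -[RHS]nrmN; congr nrm.
  by apply: eq_from_tnth => i; rewrite !tnth_mktuple; ring.
- exact: measurable_pred.
Qed.

(** Take the vertex y as new origin: replacing x by y + x turns the side from x to y into |x|, and
    |x| into the distance from x to -y. The central symmetry then removes the sign. *)
Lemma int_q3 : \int[lam D]_x \int[lam D]_y b2r (q3 x y) = Jint * (lens R d)%:E.
Proof.
pose p (x y : D.-tuple R) := [&& (nrm x <= 1)%R, (nrm y < nrm x)%R & (eucl_dist x y < nrm x)%R].
rewrite -(@int_lens p); first last.
- by move=> x y hy hd; rewrite /p /q1 !lt_neqAle hy hd.
- by move=> x; rewrite /p; meas.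
rewrite (int_swap (p := fun z => q3 z.1 z.2)) /=; last by rewrite /q3; meas.
transitivity (\int[lam D]_y \int[lam D]_x b2r (p x (vlin (-1) 0 y y))).
  apply: int_eq => y.
  rewrite -[LHS](@ge0_integral_lam_shift _ _ y); [|by rewrite /b2r /q3; meas|by []].
  apply: int_eq => x; congr b2r; rewrite /q3 /p.
  have -> : eucl_dist (vlin 1 1 y x) y = nrm x.
    rewrite eucl_distE; congr nrm.
    by apply: eq_from_tnth => i; rewrite !tnth_mktuple; ring.
  have -> : eucl_dist x (vlin (-1) 0 y y) = nrm (vlin 1 1 y x).
    rewrite eucl_distE; congr nrm.
    by apply: eq_from_tnth => i; rewrite !tnth_mktuple; ring.
  by rewrite nrmN; congr (_ && _); rewrite andbC.
rewrite -(int_swap (p := fun z => p z.1 (vlin (-1) 0 z.2 z.2))) /=; last by rewrite /p; meas.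
by apply: int_eq => x; rewrite -int_neg//; rewrite /p; meas.
Qed.

Lemma w_lens : @w_const R D = (3 / 2 * (lens R d / vol R D))%R.
Proof.
have v0 := vol_gt0 R D.
have l0 : (0 <= lens R d)%R by rewrite /lens fine_ge0.
(* An infinite [Jint] would make the right-hand side of [vol2_J] infinite. *)
rewrite w_constE; have Jfin : Jint \is a fin_num.
  have := vol2_J; case: Jint Jint_ge0 => [j| |] // _.
  by rewrite gt0_mulye ?lte_fin.
have [j Jj] : exists j, Jint = j%:E by exists (fine Jint); rewrite fineK.
have VE : Vset D = (3 * j * lens R d)%R.
  rewrite /Vset; transitivity (fine (Jint * (lens R d)%:E + (Jint * (lens R d)%:E + Jint * (lens R d)%:E))).
    congr fine; rewrite -{1}int_q1 -{1}int_q2 -int_q3.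
    have mq1 : measurable_fun setT (fun z : D.-tuple R * D.-tuple R => q1 z.1 z.2) by rewrite /q1; meas.
    have mq2 : measurable_fun setT (fun z : D.-tuple R * D.-tuple R => q2 z.1 z.2) by rewrite /q2; meas.
    have mq3 : measurable_fun setT (fun z : D.-tuple R * D.-tuple R => q3 z.1 z.2) by rewrite /q3; meas.
    have mi (q : D.-tuple R -> D.-tuple R -> bool) : measurable_fun setT (fun z : D.-tuple R * D.-tuple R => q z.1 z.2) ->
        measurable_fun setT (fun x => \int[lam D]_y b2r (q x y)).
      by move=> mq; apply: measf_int2 => //; rewrite /b2r; meas.
    have i0 (q : D.-tuple R -> D.-tuple R -> bool) x : 0 <= \int[lam D]_y b2r (q x y).
      exact: integral_ge0.
    have mx (q : D.-tuple R -> D.-tuple R -> bool) x : measurable_fun setT (fun z : D.-tuple R * D.-tuple R => q z.1 z.2) ->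
        measurable_fun setT (fun y => b2r (q x y)).
      move=> mq; rewrite /b2r; apply: measfE; apply: measf_natr.
      by apply: (@measurableT_comp _ _ _ _ _ _ (fun z : _ * _ => q z.1 z.2) setT (fun y => (x, y)) mq); meas.
    rewrite -(@int_add3 _ _ (lam D) (fun x => \int[lam D]_y b2r (q1 x y))
       (fun x => \int[lam D]_y b2r (q2 x y)) (fun x => \int[lam D]_y b2r (q3 x y))); [|exact: mi|exact: mi|exact: mi|exact: i0|exact: i0|exact: i0].
    apply: eq_integral => x _.
    rewrite -(@int_add3 _ _ (lam D) (fun y => b2r (q1 x y))
       (fun y => b2r (q2 x y)) (fun y => b2r (q3 x y))); [|exact: mx|exact: mx|exact: mx|by []|by []|by []].
    by apply: eq_integral => y _; rewrite q_partition /b2r -!EFinD -!natrD.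
  by rewrite Jj -EFinM -!EFinD /=; ring.
have := vol2_J; rewrite Jj -EFinM -EFinD => -[] h.
have jE : j = (vol R D / 2)%R.
  by apply: (mulIf (lt0r_neq0 v0)); lra.
by rewrite VE jE; field; rewrite gt_eqF.
Qed.

End w_formula.

(** * Slicing the ball and the lens along an axis *)

Section w_slices.
Variable R : realType.
Implicit Types t : R.

Definition sq t : R := Num.sqrt (1 - t ^+ 2).
(** Volume of the section of the unit ball at height t, relative to [vol d]. The indicator matters
    for d = 0, where [sq t ^+ 0] is 1 even outside [-1, 1]. *)
Definition slice d t : R := (`|t| <= 1)%R%:R * sq t ^+ d.

Lemma sq_ge0 t : 0 <= sq t. Proof. exact: sqrtr_ge0. Qed.

Lemma sq_le t u : u ^+ 2 <= t ^+ 2 -> sq t <= sq u.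
Proof. by move=> h; apply: ler_wsqrtr; rewrite lerD2l lerN2. Qed.

Lemma norm_le1 t : (`|t| <= 1) = (t ^+ 2 <= 1).
Proof. by rewrite -(real_normK (num_real t)) -[X in _ = (_ <= X)](expr1n R 2) ler_pXn2r// ?nnegrE. Qed.

Lemma slice_ge0 d t : 0 <= slice d t.
Proof. by rewrite mulr_ge0// exprn_ge0// sq_ge0. Qed.

Lemma sum_sqr_le1 d t (z : d.-tuple R) :
  (t ^+ 2 + nrm z ^+ 2 <= 1) = (`|t| <= 1) && (nrm z <= sq t).
Proof.
rewrite norm_le1; have [h|h] := leP (t ^+ 2) 1 => /=; last first.
  by apply/negbTE; rewrite -ltNge (lt_le_trans h)// lerDl sqr_ge0.
rewrite -[RHS](@ler_pXn2r _ 2) ?nnegrE ?sq_ge0 ?nrm_ge0// [sq t ^+ 2]sqr_sqrtr ?subr_ge0//.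
by rewrite lerBrDl.
Qed.

Lemma nrm_le1 d (z : d.-tuple R) : (nrm z <= 1) = (nrm z ^+ 2 <= 1).
Proof. by rewrite -[X in _ = (_ <= X)](expr1n R 2) ler_pXn2r// nnegrE ?nrm_ge0. Qed.

Lemma cons_ball d t (z : d.-tuple R) :
  (nrm (cons_tuple t z) <= 1) = (`|t| <= 1) && (nrm z <= sq t).
Proof. by rewrite nrm_le1 nrm_cons2 sum_sqr_le1. Qed.

Lemma cons_ball_e1 d t (z : d.-tuple R) :
  (eucl_dist (e1 R d) (cons_tuple t z) <= 1) = (`|1 - t| <= 1) && (nrm z <= sq (1 - t)).
Proof.
rewrite eucl_distE /e1 vlin_cons nrm_le1 nrm_cons2 -sum_sqr_le1 mulr1 mulN1r.
rewrite (_ : vlin 1 (-1) v0 z = vlin (-1) 0 z z) ?nrmN//.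
by apply: eq_from_tnth => i; rewrite !tnth_mktuple tnth_v0; ring.
Qed.

(** At height t both balls cut out concentric balls, since the centres 0 and e1 lie on the axis. The
    smaller section comes from the farther centre, which is 0 exactly when t >= 1/2, up to the
    tie. *)
Lemma cons_lens d t (z : d.-tuple R) :
  (nrm (cons_tuple t z) <= 1) && (eucl_dist (e1 R d) (cons_tuple t z) <= 1) =
  if 1 / 2 <= t then (`|t| <= 1) && (nrm z <= sq t)
  else (`|1 - t| <= 1) && (nrm z <= sq (1 - t)).
Proof.
rewrite cons_ball cons_ball_e1 -!sum_sqr_le1; case: ifPn => h.
  have h2 : (1 - t) ^+ 2 <= t ^+ 2 by rewrite (_ : (1 - t) ^+ 2 = t ^+ 2 + (1 - 2 * t)) ; [lra|ring].
  by apply/andP/idP => [[]//|h3]; split => //; apply: le_trans h3; rewrite lerD2r.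
have h2 : t ^+ 2 <= (1 - t) ^+ 2.
  rewrite (_ : (1 - t) ^+ 2 = t ^+ 2 + (1 - 2 * t)); last by ring.
  by move: h; rewrite -ltNge => h; lra.
by apply/andP/idP => [[]//|h3]; split => //; apply: le_trans h3; rewrite lerD2r.
Qed.

Local Open Scope ereal_scope.

Lemma and_intg d (q : bool) (p : d.-tuple R -> bool) (c : R) : measurable_fun setT p ->
  lam d [set y | p y] = c%:E -> \int[lam d]_y b2r R (q && p y) = (q%:R * c)%:E.
Proof.
move=> mp pc; rewrite /b2r integral_pred; last by meas.
case: q => /=; first by rewrite mul1r.
by rewrite mul0r (_ : [set x | false] = set0) ?measure0//; apply/seteqP; split.
Qed.

Lemma slice_int d t : \int[lam d]_z b2r R ((`|t| <= 1)%R && (nrm z <= sq t)%R) =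
  (slice d t * vol R d)%:E.
Proof.
rewrite /slice -mulrA; apply: and_intg; first by meas.
by rewrite lam_ball_ge0// sq_ge0.
Qed.

Lemma measurable_slice d : measurable_fun setT (slice d).
Proof. by rewrite /slice /sq; meas. Qed.
Local Hint Resolve measurable_slice : core.

Lemma vol_slices d : (vol R d.+1)%:E = (\int[leb]_t (slice d t)%:E) * (vol R d)%:E.
Proof.
rewrite -integral_unit_ball ge0_integral_pwS//; last by meas.
rewrite -int_scaler//; first last.
- by move=> t; rewrite lee_fin slice_ge0.
- exact: measfE.
- by rewrite lee_fin ltW// vol_gt0.
apply: int_eq => t; rewrite -EFinM -slice_int.
by apply: int_eq => z; rewrite cons_ball.
Qed.

Lemma lens_slices d : (lens R d)%:E =
  (\int[leb]_t (if (1 / 2 <= t)%R then slice d t else slice d (1 - t))%:E) * (vol R d)%:E.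
Proof.
rewrite -lensE -integral_pred; last by meas.
rewrite ge0_integral_pwS//; last by meas.
have mr : measurable_fun setT (fun t : R => slice d (1 - t)%R).
  by apply: (@measurableT_comp _ _ _ _ _ _ (slice d) setT (fun t => (1 - t)%R)) => //; meas.
rewrite -int_scaler//; first last.
- by move=> t; case: ifP => _; rewrite lee_fin slice_ge0.
- by apply: measfE; apply: measurable_fun_ifT => //; meas.
- by rewrite lee_fin ltW// vol_gt0.
apply: eq_integral => t _; rewrite -EFinM (fun_if (fun z => z * vol R d)%R) (fun_if EFin) -!slice_int.
by case: ifPn => h; apply: int_eq => z; rewrite cons_lens ?h// (negbTE h).
Qed.

Lemma leb_reflect (c : R) (h : R -> \bar R) : measurable_fun setT h -> (forall x, 0 <= h x) ->
  \int[leb]_t h (c - t)%R = \int[leb]_t h t.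
Proof.
move=> mh h0.
rewrite (@ge0_integral_preimage _ _ _ leb (fun t => - t)%R 1%R (fun t => h (c + t)%R))//.
- rewrite mul1e -[RHS]mul1e -[X in _ = X * _](_ : (1^-1)%:E = 1); last by rewrite invr1.
  rewrite -(@ge0_integral_leb_aff _ c 1%R h)//.
  by apply: int_eq => t; rewrite mul1r.
- by meas.
- by move=> A mA; rewrite mul1e; exact: lebesgue_measureN.
- by apply: (@measurableT_comp _ _ _ _ _ _ h setT (fun t => (c + t)%R)) => //; meas.
Qed.

Lemma int_point (c : R) (h : R -> R) : \int[leb]_t ((t == c)%R%:R * h t)%:E = 0.
Proof.
(* The value [h c] may be negative, so its modulus and its sign are pulled out separately. *)
transitivity (\int[leb]_t ((`|h c|%:E * b2r R (t == c)) * (Num.sg (h c))%:E)).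
  apply: int_eq => t; rewrite /b2r -!EFinM; congr EFin.
  by have [->|] := eqVneq t c; rewrite ?mul0r ?mulr0 ?mul0r// mul1r mulr1 mulrC -numEsg.
have mp : measurable_fun setT (fun t : R => t == c) by apply: measurable_fun_eqr; meas.
have H : \int[leb]_t b2r R (t == c) = 0.
  rewrite /b2r (integral_pred _ mp).
  have -> : [set x | x == c] = [set c].
    by apply/seteqP; split => x /=; [move/eqP|move=> ->].
  exact: leb_set1.
rewrite integralZr//; first last.
  apply/integrableP; split; first by rewrite /b2r; meas.
  rewrite (eq_integral (fun t => `|h c|%:E * b2r R (t == c))); last first.
    by move=> t _; rewrite gee0_abs// mule_ge0// lee_fin.
  by rewrite int_scale ?lee_fin// ?H ?mule0//; rewrite /b2r; meas.
by rewrite int_scale ?lee_fin// ?H ?mule0 ?mul0e//; rewrite /b2r; meas.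
Qed.
End w_slices.

Section w_monotone.
Variable R : realType.
Implicit Types t : R.
Local Open Scope ereal_scope.
Local Hint Resolve measurable_slice : core.

Definition upper d : \bar R := \int[leb]_t ((1 / 2 <= t)%R%:R * slice d t)%:E.
Definition lower d : \bar R := \int[leb]_t (((0 <= t) && (t < 1 / 2))%R%:R * slice d t)%:E.

Lemma measurable_part d (p : R -> bool) : measurable_fun setT p ->
  measurable_fun setT (fun t => ((p t)%:R * slice d t)%:E).
Proof. by move=> mp; have ms := @measurable_slice R d; meas. Qed.

Lemma part_ge0 d (p : R -> bool) t : 0 <= ((p t)%:R * slice d t)%:E.
Proof. by rewrite lee_fin mulr_ge0// slice_ge0. Qed.

(** The exceptional point [c] lets strict and weak bounds be mixed when an interval is cut. *)
Lemma int_part_split d (p q r : R -> bool) (c : R) :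
  measurable_fun setT p -> measurable_fun setT q -> measurable_fun setT r ->
  (forall t, t != c -> (p t : nat) = (q t + r t)%N) ->
  \int[leb]_t ((p t)%:R * slice d t)%:E =
  \int[leb]_t ((q t)%:R * slice d t)%:E + \int[leb]_t ((r t)%:R * slice d t)%:E.
Proof.
move=> mp mq mr pqr.
have mc : measurable_fun setT (fun t : R => t == c) by apply: measurable_fun_eqr; meas.
(* A null correction at [c]. The factor 2 covers the defect in both directions, since q + r - p <= 2
   and p - q - r <= 1. *)
pose Z (t : R) : \bar R := ((t == c)%:R * (slice d t * 2))%:E.
have Z0 : \int[leb]_t Z t = 0 by exact: int_point.
have mZ : measurable_fun setT Z.
  by have ms := @measurable_slice R d; rewrite /Z; meas.
have Zge t : 0 <= Z t by rewrite lee_fin mulr_ge0// mulr_ge0//; exact: slice_ge0.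
have m1 := measurable_part d mp; have m2 := measurable_part d mq.
have m3 := measurable_part d mr.
have p0 (s : R -> bool) t : (0 <= (s t)%:R * slice d t)%R by rewrite mulr_ge0 ?slice_ge0.
rewrite -int_add//; try exact: part_ge0.
apply/eqP; rewrite eq_le; apply/andP; split.
  rewrite -[leRHS]adde0 -Z0 -int_add//; [|exact: measfED|by move=> t; rewrite adde_ge0 ?part_ge0].
  apply: int_le => //; [by repeat apply: measfED|exact: part_ge0|move=> t].
  rewrite /Z -!EFinD lee_fin; have [tc|tc] := eqVneq t c.
    rewrite mul1r.
    have := p0 q t; have := p0 r t; have := slice_ge0 d t; case: (p t); rewrite ?mul1r ?mul0r; lra.
  by rewrite mul0r addr0 pqr// natrD mulrDl.
rewrite -[leRHS]adde0 -Z0 -int_add//; [|exact: part_ge0].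
apply: int_le => //; [exact: measfED|by apply: measfED|by move=> t; rewrite adde_ge0 ?part_ge0|move=> t].
rewrite /Z -!EFinD lee_fin; have [tc|tc] := eqVneq t c.
  rewrite mul1r; have := slice_ge0 d t.
  by case: (p t); case: (q t); case: (r t); rewrite ?mul1r ?mul0r; lra.
by rewrite mul0r addr0 pqr// natrD mulrDl.
Qed.

Lemma sliceN d t : slice d (- t) = slice d t.
Proof. by rewrite /slice /sq normrN sqrrN. Qed.

(** The slice profile is even, so [-1, 1] folds onto [0, 1], which is cut at 1/2. *)
Lemma vol_upper_lower d :
  (vol R d.+1)%:E = ((upper d + lower d) + (upper d + lower d)) * (vol R d)%:E.
Proof.
rewrite vol_slices; congr (_ * _).
have E : \int[leb]_t ((0 < t)%R%:R * slice d t)%:E = upper d + lower d.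
  by apply: (@int_part_split d _ _ _ 0%R); [meas..|move=> t t0; rewrite (lt_neqAle 0%R t) eq_sym t0 /=];
    case: (leP (1 / 2)%R t) => h1; case: (leP 0%R t) => h2 //=; exfalso; lra.
transitivity (\int[@leb R]_t (((true%:R : R) * slice d t)%R)%:E).
  by apply: eq_integral => t _; rewrite mul1r.
rewrite (@int_part_split d (fun=> true) (fun t => (0 < 0 - t)%R) (fun t => (0 < t)%R) 0%R); try by meas.
  congr (_ + _); last exact: E.
  rewrite -E -(@leb_reflect _ 0%R (fun t => ((0 < t)%R%:R * slice d t)%:E)).
  - by apply: eq_integral => t _; rewrite sub0r sliceN.
  - by apply: measurable_part; meas.
  - by move=> t; exact: (part_ge0 d (fun t => (0 < t)%R)).
by move=> t t0; rewrite sub0r oppr_gt0; case: (ltgtP t 0%R) t0.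
Qed.

(** Beyond t = 1/2 the lens is a cap of the ball about 0; the symmetry t -> 1 - t carries the other
    half onto this cap, up to the height 1/2. *)
Lemma lens_upper d : (lens R d)%:E = (upper d + upper d) * (vol R d)%:E.
Proof.
rewrite lens_slices; congr (_ * _).
have ms := @measurable_slice R d.
pose h t := ((1 / 2 < t)%R%:R * slice d t)%:E.
have mh : measurable_fun setT h by rewrite /h; meas.
have h0 t : 0 <= h t by exact: (part_ge0 d (fun t => (1 / 2 < t)%R)).
have -> : upper d + upper d = upper d + \int[leb]_t h (1 - t)%R.
  rewrite leb_reflect//; congr (_ + _).
  rewrite /upper (@int_part_split d _ (fun t => (1 / 2 < t)%R) (fun=> false) (1 / 2)%R); try by meas.
    rewrite [X in _ + X](_ : _ = 0) ?adde0//.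
    by apply: integral0_eq => t _; rewrite mul0r.
  by move=> t tc; rewrite addn0 lt_neqAle eq_sym tc.
rewrite /upper -int_add//; first last.
- exact: (part_ge0 d (fun t => (1 / 2 <= t)%R)).
- by apply: (@measurableT_comp _ _ _ _ _ _ h setT (fun t => (1 - t)%R)) => //; meas.
- by apply: (measurable_part d (p := fun t => (1 / 2 <= t)%R)); meas.
apply: eq_integral => t _; rewrite /h -EFinD; congr EFin.
have -> : (1 / 2 < 1 - t)%R = ~~ (1 / 2 <= t)%R by rewrite -ltNge; apply/idP/idP; lra.
by case: ifP => _ /=; rewrite ?mul1r ?mul0r ?addr0 ?add0r.
Qed.

Lemma int_itv (a b c : R) (p : R -> bool) : (a < b)%R ->
  (forall t, p t = (a <= t)%R && (t < b)%R) -> (0 <= c)%R ->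
  \int[leb]_t ((p t)%:R * c)%:E = ((b - a) * c)%:E.
Proof.
move=> ab pE c0.
have mp : measurable_fun setT p.
  by rewrite (_ : p = fun t => (a <= t)%R && (t < b)%R); [meas|exact/funext].
transitivity ((\int[leb]_t (((p t)%:R : R)%:E)) * c%:E).
  rewrite -int_scaler//; last by meas.
have E : leb [set x | p x] = (b - a)%:E.
  rewrite (_ : [set x | p x] = `[a, b[%classic); last first.
    by apply/seteqP; split => t /=; rewrite pE in_itv.
  by rewrite /leb /pushforward lebesgue_measure_itv /= lte_fin ab -EFinB.
by rewrite integral_pred// EFinM; congr (_ * _).
Qed.

Lemma slice_le1 d t : (slice d t <= (`|t| <= 1)%R%:R)%R.
Proof.
rewrite /slice; case: (_ <= 1)%R; rewrite ?mul0r// mul1r.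
apply: exprn_ile1; first exact: sq_ge0.
by rewrite -sqrtr1; apply: ler_wsqrtr; rewrite gerBl sqr_ge0.
Qed.

Lemma bool_le1 (b : bool) : (b%:R <= 1 :> R)%R.
Proof. by case: b; rewrite ?ler01. Qed.

Lemma upper_fin d : upper d \is a fin_num.
Proof.
have ms := @measurable_slice R d.
rewrite ge0_fin_numE; last by apply: integral_ge0 => t _; exact: (part_ge0 d (fun t => (1 / 2 <= t)%R)).
(* The slice vanishes beyond 1; the end point 2 keeps t = 1 inside a half-open interval. *)
apply: (@le_lt_trans _ _ (\int[leb]_t (((1 / 2 <= t) && (t < 2))%R%:R * 1)%:E)); last first.
  by rewrite (@int_itv (1 / 2)%R 2%R 1%R) ?ltry//; lra.
apply: int_le; [by meas|by meas|exact: (part_ge0 d (fun t => (1 / 2 <= t)%R))|move=> t].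
rewrite lee_fin; have := slice_le1 d t; have := slice_ge0 d t.
have [h1|h1] := leP (1 / 2)%R t => /=; last by rewrite !mul0r.
have [h2|h2] := ltP t 2%R => /= h3 h4; rewrite ?mul1r ?mulr1.
  exact: (le_trans h4 (bool_le1 _)).
by apply: (le_trans h4); case: (leP `|t|%R 1%R) => // h5; move: (ler_norm t); lra.
Qed.

Lemma lower_fin d : lower d \is a fin_num.
Proof.
have ms := @measurable_slice R d.
rewrite ge0_fin_numE; last by apply: integral_ge0 => t _; exact: (part_ge0 d (fun t => (0 <= t)%R && (t < 1 / 2)%R)).
apply: (@le_lt_trans _ _ (\int[leb]_t (((0 <= t) && (t < 1 / 2))%R%:R * 1)%:E)); last first.
  by rewrite (@int_itv 0%R (1 / 2)%R 1%R) ?ltry//; lra.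
apply: int_le; [by meas|by meas|exact: (part_ge0 d (fun t => (0 <= t)%R && (t < 1 / 2)%R))|move=> t].
rewrite lee_fin; apply: ler_wpM2l => //; exact: le_trans (slice_le1 d t) (bool_le1 _).
Qed.

Definition up d : R := fine (upper d).
Definition lo d : R := fine (lower d).

Lemma upE d : upper d = (up d)%:E. Proof. by rewrite fineK// upper_fin. Qed.
Lemma loE d : lower d = (lo d)%:E. Proof. by rewrite fineK// lower_fin. Qed.

Lemma up_gt0 d : (0 < up d)%R.
Proof.
have ms := @measurable_slice R d.
have s0 : (0 < sq (3 / 4 : R))%R by rewrite sqrtr_gt0; lra.
rewrite -lte_fin -upE.
(* On [1/2, 3/4) the slice is at least [sq (3/4) ^+ d], which is positive because 3/4 < 1. *)
apply: (@lt_le_trans _ _ (\int[leb]_t (((1 / 2 <= t) && (t < 3 / 4))%R%:R * sq (3 / 4 : R) ^+ d)%:E)).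
  rewrite (@int_itv (1 / 2)%R (3 / 4)%R) ?ltW ?exprn_gt0//; last by lra.
  by rewrite lte_fin mulr_gt0 ?exprn_gt0//; lra.
apply: int_le; [by meas|by meas|by move=> t; rewrite lee_fin mulr_ge0// exprn_ge0// ltW|move=> t].
rewrite lee_fin; have [h1|h1] := leP (1 / 2)%R t => /=; last by rewrite !mul0r.
have [h2|h2] := ltP t (3 / 4)%R => /=; last by rewrite mul0r mul1r slice_ge0.
rewrite !mul1r /slice (_ : (`|t| <= 1)%R = true); last by rewrite ger0_norm; lra.
by rewrite mul1r lerXn2r ?nnegrE ?sq_ge0//; apply: sq_le; rewrite ler_pXn2r// ?nnegrE; lra.
Qed.

Lemma lo_ge0 d : (0 <= lo d)%R.
Proof.
rewrite -lee_fin -loE; apply: integral_ge0 => t _.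
exact: (part_ge0 d (fun t => (0 <= t)%R && (t < 1 / 2)%R)).
Qed.

(** One more dimension multiplies the slice by [sq t], which is at most [sq (1/2)] for t in
    [1/2, 1]. *)
Lemma up_S d : (up d.+1 <= sq (1 / 2) * up d)%R.
Proof.
have ms := @measurable_slice R d; have ms1 := @measurable_slice R d.+1.
rewrite -lee_fin EFinM -!upE /upper -int_scale; first last.
- exact: (part_ge0 d (fun t => (1 / 2 <= t)%R)).
- by meas.
- by rewrite lee_fin sq_ge0.
apply: int_le; [by meas|by meas|exact: (part_ge0 d.+1 (fun t => (1 / 2 <= t)%R))|move=> t].
rewrite -EFinM lee_fin; have [h1|h1] := leP (1 / 2)%R t => /=; last by rewrite !mul0r mulr0.
rewrite !mul1r /slice exprS mulrCA; apply: ler_wpM2r; last first.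
  by apply: sq_le; rewrite ler_pXn2r// ?nnegrE; lra.
by rewrite mulr_ge0// exprn_ge0// sq_ge0.
Qed.

Lemma lo_S d : (sq (1 / 2) * lo d < lo d.+1)%R.
Proof.
have ms := @measurable_slice R d; have ms1 := @measurable_slice R d.+1.
have c1 : (sq (1 / 2 : R) < sq (1 / 4 : R))%R.
  by rewrite /sq ltr_sqrt; rewrite !expr2; lra.
have c0 : (0 < sq (1 / 4 : R))%R by rewrite sqrtr_gt0 expr2; lra.
(* Strictness comes from [0, 1/4), where the extra factor [sq t] exceeds [sq (1/2)] by at least
   [sq (1/4) - sq (1/2)] and the slice is at least [sq (1/4) ^+ d]. On the rest of [0, 1/2) only the
   weak inequality is used. *)
pose eta : R := ((1 / 4 - 0) * ((sq (1 / 4) - sq (1 / 2)) * sq (1 / 4) ^+ d))%R.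
have e0 : (0 < eta)%R.
  rewrite /eta; apply: mulr_gt0; first by lra.
  by rewrite mulr_gt0 ?subr_gt0// exprn_gt0.
apply: (@lt_le_trans _ _ (sq (1 / 2) * lo d + eta)%R); first by rewrite ltrDl.
have k0 : (0 <= (sq (1 / 4) - sq (1 / 2)) * sq (1 / 4 : R) ^+ d)%R.
  by rewrite ltW// mulr_gt0 ?subr_gt0// exprn_gt0.
rewrite -lee_fin EFinD EFinM -!loE /eta.
have q0 : (0 < 1 / 4 :> R)%R by lra.
rewrite -(@int_itv 0%R (1 / 4)%R _ (fun t : R => (0 <= t)%R && (t < 1 / 4)%R) q0)//.
rewrite /lower -int_scale; first last.
- exact: (part_ge0 d (fun t => (0 <= t)%R && (t < 1 / 2)%R)).
- by meas.
- by rewrite lee_fin sq_ge0.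
rewrite -int_add; first last.
- by move=> t; rewrite lee_fin mulr_ge0.
- move=> t; apply: mule_ge0; first by rewrite lee_fin sq_ge0.
  exact: (part_ge0 d (fun t => (0 <= t)%R && (t < 1 / 2)%R)).
- by meas.
- by meas.
apply: int_le; [by apply: measfED; meas|by meas| |move=> t].
  move=> t; apply: adde_ge0; last by rewrite lee_fin mulr_ge0.
  apply: mule_ge0; first by rewrite lee_fin sq_ge0.
  exact: (part_ge0 d (fun t => (0 <= t)%R && (t < 1 / 2)%R)).
rewrite -EFinM -EFinD lee_fin.
have [h0|h0] := leP 0%R t; last by rewrite !andFb !mul0r mulr0 addr0.
have [h1|h1] := ltP t (1 / 2)%R; rewrite !andTb; last first.
  have -> : (t < 1 / 4)%R = false by apply/negbTE; rewrite -leNgt; lra.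
  by rewrite !mul0r mulr0 addr0.
rewrite /slice !mul1r (_ : (`|t| <= 1)%R = true); last by rewrite ger0_norm//; lra.
rewrite !mul1r exprS; rewrite ?mul1r in c0 c1 h1 k0 *.
have p0 : (0 <= sq t ^+ d)%R by rewrite exprn_ge0 ?sq_ge0.
have s1 : (sq (2^-1) <= sq t)%R by apply: sq_le; rewrite ler_pXn2r// ?nnegrE; lra.
have [h2|h2] := ltP t (4^-1)%R; last by rewrite mul0r addr0 ler_wpM2r.
have s2 : (sq (4^-1) <= sq t)%R by apply: sq_le; rewrite ler_pXn2r// ?nnegrE; lra.
have s3 : (sq (4^-1) ^+ d <= sq t ^+ d)%R by rewrite lerXn2r ?nnegrE ?sq_ge0.
rewrite mul1r addrC -lerBrDr -mulrBl; apply: ler_pM => //.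
- by rewrite subr_ge0 ltW.
- by rewrite exprn_ge0// ltW.
- by rewrite lerD2r.
Qed.

Lemma w_up_lo d : @w_const R d.+1 = (3 / 2 * (up d / (up d + lo d)))%R.
Proof.
rewrite w_lens; have := vol_upper_lower d; have := lens_upper d.
rewrite upE loE -!EFinD -!EFinM => -[->] [->].
have v0 := vol_gt0 R d; have u0 := up_gt0 d; have l0 := lo_ge0 d.
by field; rewrite !gt_eqF//; lra.
Qed.

Lemma w_const_decr d : (@w_const R d.+2 < @w_const R d.+1)%R.
Proof.
rewrite !w_up_lo.
have u0 := up_gt0 d; have l0 := lo_ge0 d; have u1 := up_gt0 d.+1; have l1 := lo_ge0 d.+1.
have := up_S d; have := lo_S d; set c := sq _ => h1 h2.
rewrite ltr_pM2l; last by lra.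
rewrite ltr_pdivrMr; last by lra.
rewrite mulrAC ltr_pdivlMr; last by lra.
rewrite !mulrDr mulrC ltrD2l.
(* After cross-multiplication and cancellation the claim compares [up d.+1 * lo d] with
   [up d * lo d.+1], and c up lo separates them strictly because up > 0. *)
apply: (@le_lt_trans _ _ (c * up d * lo d)%R); first by rewrite ler_wpM2r.
by rewrite mulrAC mulrC ltr_pM2l.
Qed.

End w_monotone.

Lemma w_const_lt (R : realType) (s t : nat) : (1 <= s)%N -> (s < t)%N ->
  @w_const R t < @w_const R s.
Proof.
case: s => // s _; elim: t => // t IH; rewrite ltnS leq_eqVlt => /orP[/eqP <-|st].
  exact: w_const_decr.
by case: t st IH => // t st IH; apply: lt_trans (w_const_decr R t) (IH st).
Qed.

(** * Continuity of translations in L1 *)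

Section ecvg0.
Variable R : realType.
Local Open Scope ereal_scope.

Lemma ecvg0P (u : nat -> \bar R) : (forall n, 0 <= u n) ->
  u @ \oo --> 0 <-> (forall e : R, (0 < e)%R -> \forall n \near \oo, u n <= e%:E).
Proof.
move=> u0; split.
  move=> /fine_cvgP[ufin /cvgrPdist_le uc] e e0.
  near=> n; have un : u n \is a fin_num by near: n.
  rewrite -(fineK un) lee_fin; have : (`|0 - fine (u n)| <= e)%R by near: n; exact: uc.
  by rewrite sub0r normrN ger0_norm ?fine_ge0.
move=> h; apply/fine_cvgP; split.
  near=> n; rewrite ge0_fin_numE//; apply: (@le_lt_trans _ _ 1%:E); last exact: ltry.
  by near: n; exact: h.
apply/cvgrPdist_le => e e0; near=> n => /=.
rewrite sub0r normrN ger0_norm ?fine_ge0//.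
have un : u n <= e%:E by near: n; exact: h.
rewrite -lee_fin fineK// ge0_fin_numE//; exact: le_lt_trans un (ltry _).
Unshelve. all: by end_near. Qed.

Lemma ecvg0_le (u v : nat -> \bar R) : (forall n, 0 <= u n) ->
  (\forall n \near \oo, u n <= v n) -> v @ \oo --> 0 -> u @ \oo --> 0.
Proof.
move=> u0 uv v0; apply: (@squeeze_cvge _ _ _ _ (cst 0) _ v) => //; last exact: cvg_cst.
by near=> n; rewrite u0 /=; near: n.
Unshelve. all: by end_near. Qed.

Lemma ecvg0D (u v : nat -> \bar R) : (forall n, 0 <= u n) -> (forall n, 0 <= v n) ->
  u @ \oo --> 0 -> v @ \oo --> 0 -> (fun n => u n + v n) @ \oo --> 0.
Proof.
move=> u0 v0 /(ecvg0P u0) hu /(ecvg0P v0) hv.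
apply/ecvg0P => [n|e e0]; first exact: adde_ge0.
near=> n; rewrite (splitr e) EFinD leeD//; near: n; [apply: hu|apply: hv]; exact: divr_gt0.
Unshelve. all: by end_near. Qed.

(** Dominated convergence with domination only for large n; the pointwise limit is asked only off a
    null set and where the dominating function is finite, which is almost everywhere. *)
Lemma int_cvg0 d (T : measurableType d) (m : {measure set T -> \bar R})
    (F : nat -> T -> \bar R) (G : T -> \bar R) (N : set T) :
  (forall n, measurable_fun setT (F n)) -> (forall n x, 0 <= F n x) ->
  measurable_fun setT G -> \int[m]_x G x < +oo ->
  measurable N -> m N = 0 ->
  (\forall n \near \oo, forall x, F n x <= G x) ->
  (forall x, ~ N x -> G x < +oo -> F ^~ x @ \oo --> 0) ->
  (fun n => \int[m]_x F n x) @ \oo --> 0.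
Proof.
move=> mF F0 mG Goo mN N0 [n0 _ FG] Fc.
have G0 x : 0 <= G x by apply: (le_trans (F0 n0 x)); apply: FG => /=.
have iG : m.-integrable setT G.
  apply/integrableP; split => //.
  by rewrite (eq_integral G)// => x _; rewrite gee0_abs.
rewrite -(cvg_shiftn n0).
have ae1 : {ae m, forall x, setT x -> (fun n => F (n + n0)%N x) @ \oo --> cst 0 x}.
  have [A [mA A0 Asub]] := integrable_ae measurableT iG.
  exists (N `|` A); split; [exact: measurableU|by rewrite null_set_setU|].
  move=> x /= h; apply: contrapT => /not_orP[xN xA]; apply: h => _.
  rewrite /= (cvg_shiftn n0 (fun n => F n x)); apply: Fc => //.
  have : G x \is a fin_num by apply: contrapT => h; apply: xA; apply: Asub => /= /(_ I).
  by rewrite ge0_fin_numE.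
have ae2 : {ae m, forall x n, setT x -> `|F (n + n0)%N x| <= G x}.
  by apply/aeW => x n _; rewrite gee0_abs//; apply: FG => /=; exact: leq_addl.
have [_ _] := @dominated_convergence _ _ _ m setT measurableT
  (fun n => F (n + n0)%N) (cst 0) G (fun n => mF _) (measurable_cst _) ae1 iG ae2.
by rewrite integral0.
Qed.
End ecvg0.

Section shift_line.
Variable R : realType.
Local Open Scope ereal_scope.

Lemma approx_continuous (f : R -> R) (M e : R) : measurable_fun setT f ->
  \int[leb]_x `|f x|%:E < +oo -> (0 < e)%R ->
  exists2 g : R -> R, continuous g &
    \int[leb]_x (b2r R (`|x| <= M)%R * `|f x - g x|%:E) <= e%:E.
Proof.
move=> mf foo e0; pose E : set R := [set x | (`|x| <= M)%R].
have mE : measurable E by apply: measurable_pred; meas.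
have EE : E = `[(- M)%R, M]%classic.
  by apply/seteqP; split => x /=; rewrite /E /= in_itv /= ler_norml.
have Eoo : lebesgue_measure E < +oo.
  by rewrite EE lebesgue_measure_itv /= ; case: ifP => _; rewrite -?EFinB ltry.
have iF : lebesgue_measure.-integrable E (EFin \o f).
  apply: (@integrableS _ _ _ lebesgue_measure setT); rewrite //=.
  apply/integrableP; split; first exact: measfE.
  rewrite -(@ge0_integral_leb _ (fun x => `|f x|%:E))//.
  by meas.
have [g_ [cg ig lim]] := approximation_continuous_integrable mE Eoo iF.
have u0 n : 0 <= \int[lebesgue_measure]_(z in E) `|(f z - g_ n z)%:E| by exact: integral_ge0.
have [n0 _ H] := (ecvg0P u0).1 lim e e0.
exists (g_ n0); first exact: cg.
apply: le_trans (H n0 (leqnn _)).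
have mg : measurable_fun setT (g_ n0) by apply: continuous_measurable_fun; exact: cg.
rewrite ge0_integral_leb; first last.
- by move=> x; rewrite mule_ge0// lee_fin.
- by rewrite /b2r; meas.
rewrite [leRHS]integral_mkcond le_eqVlt; apply/orP; left; apply/eqP.
apply: eq_integral => x _; rewrite /patch; case: ifPn => xE.
  by move: xE; rewrite inE /E /b2r /= => ->; rewrite mul1e.
move: xE; rewrite notin_setE /E /= => /negP/negbTE xE.
by rewrite /b2r xE mul0e.
Qed.

(** On [-M, M] the function is bounded by some C, so for shifts of size at most 1 the integrand is
    at most 2 C on [-M-1, M+1] and 0 elsewhere. Pointwise convergence can fail only at M and -M,
    where the cut-off jumps. *)
Lemma shift_cvg_cut (g : R -> R) (M : R) (u : nat -> R) : (0 <= M)%R -> continuous g ->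
  u @ \oo --> (0 : R)%R ->
  (fun n => \int[leb]_x `| (`|x + u n| <= M)%R%:R * g (x + u n) - (`|x| <= M)%R%:R * g x|%:E)
     @ \oo --> 0.
Proof.
move=> M0 cg u0.
have mg : measurable_fun setT g by apply: continuous_measurable_fun; exact: cg.
have [C C0 gC] : exists2 C : R, (0 <= C)%R & forall x, (`|x| <= M)%R -> (`|g x| <= C)%R.
  have cng : {within `[(- M)%R, M], continuous (fun x => `|g x|%R)}.
    apply: continuous_subspaceT => x; apply: continuous_comp; first exact: cg.
    exact: norm_continuous.
  have [|c _ hc] := EVT_max _ cng; first by lra.
  exists `|g c|%R => // x xM; apply: hc; by rewrite in_itv /= -ler_norml.
have mug n : measurable_fun setT (fun x : R => g (x + u n)%R).
  by apply: (@measurableT_comp _ _ _ _ _ _ g setT (fun x : R => (x + u n)%R)) => //; meas.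
have u1 : \forall n \near \oo, (`|u n| <= 1)%R.
  by have /cvgrPdist_le /(_ 1%R ltr01) := u0; apply: filterS => n; rewrite sub0r normrN.
have hb (b : bool) y : (b -> (`|g y| <= C)%R) -> (`|b%:R * g y| <= C)%R.
  by case: b => h; rewrite ?mul0r ?normr0// mul1r h.
pose N : set R := [set M] `|` [set (- M)%R].
apply: (@int_cvg0 _ _ _ leb _ (fun x => ((`|x| <= M + 1)%R%:R * (2 * C))%:E) N).
- by move=> n; meas.
- by [].
- by meas.
- have -> : \int[leb]_x ((`|x| <= M + 1)%R%:R * (2 * C))%:E =
      (\int[leb]_x ((`|x| <= M + 1)%R%:R : R)%:E) * (2 * C)%:E.
    rewrite -int_scaler//; last by meas.
    by rewrite lee_fin mulr_ge0.
  rewrite integral_pred; last by meas.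
  have -> : [set x : R | (`|x| <= M + 1)%R] = `[(- (M + 1))%R, (M + 1)%R]%classic.
    by apply/seteqP; split => x /=; rewrite in_itv /= ler_norml.
  have H : leb `[(- (M + 1))%R, (M + 1)%R]%classic = (M + 1 - - (M + 1))%:E.
    rewrite /leb /pushforward lebesgue_measure_itv /= lte_fin -EFinB.
    by rewrite ifT//; lra.
  by rewrite (_ : _ * _ = (M + 1 - - (M + 1))%:E * (2 * C)%:E) ?ltry//; congr (_ * _).
- by apply: measurableU.
- apply/eqP; rewrite -measure_le0 (le_trans (measureU2 _ _ _))//.
  by rewrite [X in X + _]leb_set1 [X in _ + X]leb_set1 adde0.
- apply: filterS u1 => n un1 x; rewrite lee_fin.
  have [h|h] := leP `|x|%R (M + 1)%R; last first.
    have -> : (`|x| <= M)%R = false by apply/negbTE; rewrite -ltNge; lra.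
    have -> : (`|x + u n| <= M)%R = false.
      apply/negbTE; rewrite -ltNge; have := ler_normB (x + u n)%R (u n); rewrite addrK; lra.
    by rewrite !mul0r subr0 normr0.
  rewrite mul1r; apply: (le_trans (ler_normB _ _)); rewrite mulrDl mul1r lerD//;
    by apply: hb => hx; exact: gC.
move=> x xN _; apply/ecvg0P => // e e0.
have [xM|xM|xM] := ltgtP `|x|%R M; last first.
- exfalso; apply: xN; rewrite /N /=; case: (ler0P x) => x0 in xM.
    by right; rewrite -xM opprK.
  by left.
- have /cvgrPdist_lt /(_ (`|x| - M)%R) := u0; rewrite subr_gt0 => /(_ xM).
  apply: filterS => n; rewrite sub0r normrN => un.
  have -> : (`|x + u n| <= M)%R = false.
    apply/negbTE; rewrite -ltNge; have := ler_normB (x + u n)%R (u n); rewrite addrK; lra.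
  by rewrite mul0r sub0r mul0r oppr0 normr0 lee_fin ltW.
- have gx : (fun n => g (x + u n)%R) @ \oo --> g x.
    have H : (fun n => x + u n)%R @ \oo --> x by rewrite -[X in _ --> X]addr0; apply: cvgD => //; exact: cvg_cst.
    by apply: (@cvg_comp _ _ _ (fun n => (x + u n)%R) g _ _ _ H); exact: cg.
  have /cvgrPdist_le /(_ e e0) g1 := gx.
  have /cvgrPdist_lt /(_ (M - `|x|)%R) := u0; rewrite subr_gt0 => /(_ xM) u2.
  near=> n.
  have un : (`|0 - u n| < M - `|x|)%R by near: n.
  have -> : (`|x + u n| <= M)%R = true.
    by rewrite sub0r normrN in un; apply: le_trans (ler_normD _ _) _; lra.
  rewrite !mul1r lee_fin distrC; near: n; exact: g1.
Unshelve. all: by end_near. Qed.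

End shift_line.

Section shift_space.
Variable R : realType.
Local Open Scope ereal_scope.

Lemma ge0_integral_leb_shift (c : R) (h : R -> \bar R) : measurable_fun setT h ->
  (forall x, 0 <= h x) -> \int[leb]_x h (x + c)%R = \int[leb]_x h x.
Proof.
move=> mh h0; rewrite -[RHS]mul1e -[X in _ = X * _](_ : (1^-1)%:E = 1); last by rewrite invr1.
rewrite -(@ge0_integral_leb_aff _ c 1%R h)//.
by apply: eq_integral => t _; rewrite mul1r addrC.
Qed.

Lemma ge0_integral_lam_shiftr d (r : R) (z : d.-tuple R) (h : d.-tuple R -> \bar R) :
  measurable_fun setT h -> (forall x, 0 <= h x) ->
  \int[lam d]_x h (vlin 1 r x z) = \int[lam d]_x h x.
Proof.
move=> mh h0; rewrite -[RHS](@ge0_integral_lam_shift _ _ (vlin r 0 z z))//.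
apply: eq_integral => x _; congr h; apply: eq_from_tnth => i; rewrite !tnth_mktuple; ring.
Qed.

Lemma normr_sub_ge0 (a b : R) : 0 <= `|a - b|%:E.
Proof. by rewrite lee_fin. Qed.

Lemma leb_shift_cvg (f : R -> R) (u : nat -> R) : measurable_fun setT f ->
  \int[leb]_x `|f x|%:E < +oo -> u @ \oo --> (0 : R)%R ->
  (fun n => \int[leb]_x `|f (x + u n) - f x|%:E) @ \oo --> 0.
Proof.
move=> mf foo u0; apply/ecvg0P => [n|e e0]; first exact: integral_ge0.
(* The cut-off continuous function [h] is within 2e/5 of f in mean: one fifth on [-M, M], one for
   the tails. This is paid twice, once after the shift, and moving [h] costs the last fifth. *)
have e5 : (0 < e / 5)%R by apply: divr_gt0.
have tail : (fun k : nat => \int[leb]_x (b2r R (k%:R < `|x|)%R * `|f x|%:E)) @ \oo --> 0.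
  apply: (@int_cvg0 _ _ _ leb _ (fun x => `|f x|%:E) set0) => //.
  - by move=> n; rewrite /b2r; meas.
  - by move=> n x; rewrite mule_ge0// lee_fin.
  - by meas.
  - apply: nearW => n x; rewrite /b2r -EFinM lee_fin.
    by case: (_ < _)%R; rewrite ?mul1r ?mul0r.
  move=> x _ _; apply/ecvg0P => [n|e' e'0]; first by rewrite mule_ge0// lee_fin.
  exists (Num.truncn `|x|%R).+1 => // n /= xn.
  rewrite /b2r (_ : (_ < _)%R = false) ?mul0e ?lee_fin ?ltW//.
  apply/negbTE; rewrite -leNgt; apply: ltW; apply: (@lt_le_trans _ _ (Num.truncn `|x|%R).+1%:R).
    exact: Num.Theory.truncnS_gt.
  by rewrite ler_nat.
have [|k _ /(_ k (leqnn _)) tk] := (ecvg0P _).1 tail _ e5.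
  by move=> n; apply: integral_ge0 => x _; rewrite mule_ge0// lee_fin.
pose M : R := k%:R%R; rewrite -/M in tk.
have M0 : (0 <= M)%R by [].
have [g cg gf] := @approx_continuous R f M _ mf foo e5.
have mg : measurable_fun setT g by apply: continuous_measurable_fun; exact: cg.
pose h (x : R) : R := ((`|x| <= M)%R%:R * g x)%R.
have mh : measurable_fun setT h by rewrite /h; meas.
pose D (x : R) : \bar R := `|f x - h x|%:E.
have mD : measurable_fun setT D by rewrite /D; meas.
have D0 x : 0 <= D x by rewrite lee_fin.
have ID : \int[leb]_x D x <= (e / 5)%:E + (e / 5)%:E.
  apply: le_trans (leeD gf tk); rewrite -int_add; first last.
  - by move=> x; rewrite mule_ge0// lee_fin.
  - by move=> x; rewrite mule_ge0// lee_fin.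
  - by rewrite /b2r; meas.
  - by rewrite /b2r; meas.
  apply: int_le => //; first by apply: measfED; rewrite /b2r; meas.
  move=> x; rewrite /D /h /b2r -!EFinM -EFinD lee_fin [(`|x| <= M)%R]leNgt.
  by case: (M < `|x|)%R; rewrite ?mul1r ?mul0r ?addr0 ?add0r ?subr0.
have hc := @shift_cvg_cut R g M u M0 cg u0.
have {}hc := (ecvg0P (fun n => integral_ge0 _ (fun x _ => normr_sub_ge0 _ _))).1 hc _ e5.
apply: filterS hc => n hn.
pose Q x : \bar R := `|h (x + u n) - h x|%:E.
have ms (l : R -> R) : measurable_fun setT l -> measurable_fun setT (fun x : R => l (x + u n)%R).
  by move=> mk; apply: (@measurableT_comp _ _ _ _ _ _ l setT (fun x : R => (x + u n)%R)) => //; meas.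
have msf := ms _ mf; have msh := ms _ mh.
have mQ : measurable_fun setT Q by rewrite /Q; meas.
have mDs : measurable_fun setT (fun x : R => D (x + u n)%R) by rewrite /D; meas.
apply: (@le_trans _ _ (\int[leb]_x (D (x + u n)%R + (Q x + D x)))).
  apply: int_le => //; [by meas|by apply: measfED => //; exact: measfED|move=> x].
  rewrite /D /Q -!EFinD lee_fin.
  rewrite (_ : f (x + u n) - f x = (f (x + u n) - h (x + u n)) + ((h (x + u n) - h x) - (f x - h x)))%R; last by ring.
  rewrite (le_trans (ler_normD _ _))// lerD2l (le_trans (ler_normB _ _))//.
rewrite (@int_add3 R _ _ leb (fun x => D (x + u n)%R) Q D)//; last by move=> x; rewrite lee_fin.
rewrite (@ge0_integral_leb_shift (u n) D)//.
apply: (@le_trans _ _ (((e / 5)%:E + (e / 5)%:E) + ((e / 5)%:E + ((e / 5)%:E + (e / 5)%:E)))).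
  by apply: leeD => //; apply: leeD => //.
by rewrite -!EFinD lee_fin; lra.
Qed.

Lemma twice_lty d (T : measurableType d) (m : {measure set T -> \bar R}) (I : T -> \bar R) :
  measurable_fun setT I -> (forall x, 0 <= I x) -> \int[m]_x I x < +oo ->
  \int[m]_x (2%:E * I x) < +oo.
Proof.
by move=> mI I0 Ioo; rewrite int_scale// lte_mul_pinfty.
Qed.

Lemma mule2_lty (a : \bar R) : 0 <= a -> 2%:E * a < +oo -> a < +oo.
Proof. by case: a => [a| |] //=; rewrite ?ltry// gt0_muley// lte_fin. Qed.

Lemma sub_le_abs (a b : R) : `|a - b|%:E <= `|a|%:E + `|b|%:E.
Proof. by rewrite -EFinD lee_fin ler_normB. Qed.

(** Induction on the dimension: move the first coordinate and the tail in turn. Each move is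
    dominated by twice the mean of |f| on the section, and the induction hypothesis is invoked only
    on sections where that mean is finite. *)
Lemma lam_shift_cvg d (f : d.-tuple R -> R) (r : nat -> R) (z : d.-tuple R) :
  measurable_fun setT f -> \int[lam d]_x `|f x|%:E < +oo -> r @ \oo --> (0 : R)%R ->
  (fun n => \int[lam d]_x `|f (vlin 1 (r n) x z) - f x|%:E) @ \oo --> 0.
Proof.
move=> + + r0; elim: d f z => [|d IH] f z mf foo.
  rewrite (_ : (fun n => _) = (fun=> 0)); first exact: cvg_cst.
  apply/funext => n; apply: integral0_eq => x _.
  rewrite (_ : vlin _ _ _ _ = x) ?subrr ?normr0//.
  by apply: eq_from_tnth => -[].
rewrite (cons_tuple_eta z); move: (thead z) (behead_tuple z) => z0 z'.
pose fc (p : R * d.-tuple R) : R := f (cons_tuple p.1 p.2).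
have mfc : measurable_fun setT fc by apply: (measurableT_comp mf); exact: measurable_cons.
have mfcc d1 (T1 : measurableType d1) (a : T1 -> R) (b : T1 -> d.-tuple R) :
    measurable_fun setT a -> measurable_fun setT b -> measurable_fun setT (fun p => fc (a p, b p)).
  move=> ma mb; apply: (@measurableT_comp _ _ _ _ _ _ fc setT (fun p => (a p, b p))) => //.
  exact: measurable_fun_pair.
pose A n (x : R) := \int[lam d]_t `|fc (x, vlin 1 (r n) t z') - fc (x, t)|%:E.
pose B n (t : d.-tuple R) := \int[leb]_x `|fc ((x + r n * z0)%R, t) - fc (x, t)|%:E.
have fooE : \int[leb]_x \int[lam d]_t `|fc (x, t)|%:E < +oo.
  by rewrite -(@ge0_integral_pwS _ _ R leb d (fun t => `|f t|%:E))//; meas.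
have foo2 : \int[lam d]_t \int[leb]_x `|fc (x, t)|%:E < +oo.
  by rewrite -(fubini_tonelli (fun p => `|fc p|%:E))//; meas.
have mI1 : measurable_fun setT (fun x : R => \int[lam d]_t `|fc (x, t)|%:E).
  apply: measf_int2 => //; meas.
have mI2 : measurable_fun setT (fun t => \int[leb]_x `|fc (x, t)|%:E).
  apply: measf_int2 => //; meas.
have mA n : measurable_fun setT (A n).
  by apply: measf_int2 => //; meas.
have mB n : measurable_fun setT (B n).
  by apply: measf_int2 => //; meas.
have A0 n x : 0 <= A n x by exact: integral_ge0.
have B0 n t : 0 <= B n t by exact: integral_ge0.
have I10 x : 0 <= \int[lam d]_t `|fc (x, t)|%:E by exact: integral_ge0.
have I20 t : 0 <= \int[leb]_x `|fc (x, t)|%:E by exact: integral_ge0.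
have cA : (fun n => \int[leb]_x A n x) @ \oo --> 0.
  apply: (@int_cvg0 _ _ _ leb _ (fun x => 2%:E * \int[lam d]_t `|fc (x, t)|%:E) set0) => //.
  - by apply: measfEM => //; meas.
  - exact: twice_lty.
  - apply: nearW => n x.
    have m1 : measurable_fun setT (fun t => fc (x, t)) by apply: mfcc; meas.
    have m2 : measurable_fun setT (fun t => fc (x, vlin 1 (r n) t z')) by apply: mfcc; meas.
    apply: (@le_trans _ _ (\int[lam d]_t (`|fc (x, vlin 1 (r n) t z')|%:E + `|fc (x, t)|%:E))).
      apply: int_le => //; [by meas|by apply: measfED; meas|by move=> t; exact: sub_le_abs].
    rewrite int_add//; [|by meas|by meas].
    rewrite (@ge0_integral_lam_shiftr d (r n) z' (fun t => `|fc (x, t)|%:E))//; last by meas.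
    by rewrite [leRHS]mule_natl mule2n.
  - move=> x _ /mule2_lty -/(_ (I10 x)) Ix.
    by apply: (IH (fun t => fc (x, t))) => //; apply: mfcc; meas.
have cB : (fun n => \int[lam d]_t B n t) @ \oo --> 0.
  apply: (@int_cvg0 _ _ _ (lam d) _ (fun t => 2%:E * \int[leb]_x `|fc (x, t)|%:E) set0) => //.
  - by apply: measfEM => //; meas.
  - exact: twice_lty.
  - apply: nearW => n t.
    have m1 : measurable_fun setT (fun x => fc (x, t)) by apply: mfcc; meas.
    have m2 : measurable_fun setT (fun x : R => fc ((x + r n * z0)%R, t)) by apply: mfcc; meas.
    apply: (@le_trans _ _ (\int[leb]_x (`|fc ((x + r n * z0)%R, t)|%:E + `|fc (x, t)|%:E))).
      apply: int_le => //; [by meas|by apply: measfED; meas|by move=> x; exact: sub_le_abs].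
    rewrite int_add//; [|by meas|by meas].
    rewrite (@ge0_integral_leb_shift (r n * z0)%R (fun x => `|fc (x, t)|%:E))//; last by meas.
    by rewrite [leRHS]mule_natl mule2n.
  - move=> t _ /mule2_lty -/(_ (I20 t)) It.
    apply: (@leb_shift_cvg (fun x => fc (x, t)) (fun n => r n * z0)%R) => //.
      by apply: mfcc; meas.
    by rewrite -[X in _ --> X](mul0r z0); apply: cvgM => //; exact: cvg_cst.
have iB0 n : 0 <= \int[lam d]_t B n t by exact: integral_ge0.
have iA0 n : 0 <= \int[leb]_x A n x by exact: integral_ge0.
apply: (ecvg0_le _ _ (ecvg0D iB0 iA0 cB cA)).
- by move=> n; exact: integral_ge0.
- apply: nearW => n /=.
  have mv : measurable_fun setT (fun p : R * d.-tuple R =>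
      fc ((p.1 + r n * z0)%R, vlin 1 (r n) p.2 z')) by meas.
  have mv2 : measurable_fun setT (fun x => f (vlin 1 (r n) x (cons_tuple z0 z'))).
    by apply: (@measurableT_comp _ _ _ _ _ _ f setT (fun x => vlin 1 (r n) x (cons_tuple z0 z'))) => //; meas.
  rewrite /lam ge0_integral_pwS//; last by meas.
  pose P (p : R * d.-tuple R) : \bar R := `|fc ((p.1 + r n * z0)%R, p.2) - fc p|%:E.
  have P0 p : 0 <= P p by rewrite lee_fin.
  have mP : measurable_fun setT P by rewrite /P; meas.
  (* By translation invariance the increment in the first coordinate may be taken at the shifted
     tail, so that the two increments telescope. *)
  have -> : \int[lam d]_t B n t = \int[leb]_x \int[lam d]_t P (x, vlin 1 (r n) t z').
    rewrite -(@fubini_tonelli _ _ _ _ _ leb (lam d) P)//.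
    apply: eq_integral => x _; rewrite (@ge0_integral_lam_shiftr d (r n) z' (fun t => P (x, t)))//.
    by meas.
  have mPv : measurable_fun setT (fun p : R * d.-tuple R => P (p.1, vlin 1 (r n) p.2 z')) by meas.
  rewrite -(@int_add _ _ _ leb (fun x => \int[lam d]_t P (x, vlin 1 (r n) t z')) (A n))//; first last.
  - by move=> x; exact: integral_ge0.
  - by apply: measf_int2.
  rewrite (_ : \int[leb]_x _ = \int[leb]_x \int[lam d]_t
      `|fc ((x + r n * z0)%R, vlin 1 (r n) t z') - fc (x, t)|%:E); last first.
    by apply: eq_integral => x _; apply: eq_integral => t _; rewrite vlin_cons mul1r.
  apply: int_le => //.
  - by apply: measf_int2 => //; meas.
  - by apply: measfED => //; exact: measf_int2.
  - by move=> x; exact: integral_ge0.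
  move=> x; rewrite -int_add//; [|by meas|by meas].
  apply: int_le => //; [by meas|by apply: measfED; meas|].
  move=> t; rewrite -EFinD lee_fin.
  by rewrite (le_trans _ (ler_normD _ _))// addrA subrK.
Qed.

(* Averaging the previous lemma over [z] in the unit ball, by dominated convergence. *)
Lemma ball_shift_cvg d (f : d.-tuple R -> R) (r : nat -> R) :
  measurable_fun setT f -> \int[lam d]_x `|f x|%:E < +oo -> r @ \oo --> (0 : R)%R ->
  (fun n => \int[lam d]_x \int[lam d]_z
     ((nrm z <= 1)%R%:R * `|f (vlin 1 (r n) x z) - f x|)%:E) @ \oo --> 0.
Proof.
move=> mf foo r0.
have mvf n : measurable_fun setT (fun p : d.-tuple R * d.-tuple R => f (vlin 1 (r n) p.1 p.2)).
  by apply: (@measurableT_comp _ _ _ _ _ _ f setT (fun p : _ * _ => vlin 1 (r n) p.1 p.2)) => //; meas.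
have mvf1 n z : measurable_fun setT (fun x => f (vlin 1 (r n) x z)).
  by apply: (@measurableT_comp _ _ _ _ _ _ f setT (fun x => vlin 1 (r n) x z)) => //; meas.
pose I := \int[lam d]_x `|f x|%:E.
have I0 : 0 <= I by exact: integral_ge0.
have S0 n z : 0 <= \int[lam d]_x `|f (vlin 1 (r n) x z) - f x|%:E by exact: integral_ge0.
have mS n : measurable_fun setT (fun z => \int[lam d]_x `|f (vlin 1 (r n) x z) - f x|%:E).
  apply: (@measf_int2 R _ _ _ _ (lam d) (fun z x => `|f (vlin 1 (r n) x z) - f x|%:E)) => //.
  have m2 : measurable_fun setT (fun p : d.-tuple R * d.-tuple R => f (vlin 1 (r n) p.2 p.1)).
    by apply: (@measurableT_comp _ _ _ _ _ _ f setT (fun p : _ * _ => vlin 1 (r n) p.2 p.1)) => //; meas.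
  by meas.
rewrite (_ : (fun n => _) = (fun n => \int[lam d]_z (((nrm z <= 1)%R%:R : R)%:E *
    \int[lam d]_x `|f (vlin 1 (r n) x z) - f x|%:E))); last first.
  apply/funext => n.
  rewrite (fubini_tonelli (fun p : d.-tuple R * d.-tuple R =>
    ((nrm p.2 <= 1)%R%:R * `|f (vlin 1 (r n) p.1 p.2) - f p.1|)%:E)) /=.
  - apply: eq_integral => z _; have m1 := mvf1 n z; rewrite -int_scale//; by meas.
  - by have m1 := mvf n; meas.
  - by move=> p; rewrite lee_fin mulr_ge0.
apply: (@int_cvg0 _ _ _ (lam d) _ (fun z => ((nrm z <= 1)%R%:R : R)%:E * (2%:E * I)) set0) => //.
- by move=> n; apply: measfEM => //; meas.
- by move=> n z; rewrite mule_ge0// lee_fin.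
- by meas.
- rewrite int_scaler//; [|by rewrite mule_ge0|by meas].
  by rewrite integral_unit_ball lte_mul_pinfty ?lee_fin ?ltW ?vol_gt0// lte_mul_pinfty.
- apply: nearW => n z; apply: lee_pmul => //.
  have m1 := mvf1 n z.
  apply: (@le_trans _ _ (\int[lam d]_x (`|f (vlin 1 (r n) x z)|%:E + `|f x|%:E))).
    apply: int_le => //; [by meas|by apply: measfED; meas|by move=> x; exact: sub_le_abs].
  rewrite int_add//; [|by meas|by meas].
  rewrite (@ge0_integral_lam_shiftr d (r n) z (fun x => `|f x|%:E))//; last by meas.
  by rewrite [leRHS]mule_natl mule2n.
- move=> z _ _; apply: (ecvg0_le _ _ (@lam_shift_cvg d f r z mf foo r0)) => //.
    by move=> n; rewrite mule_ge0// lee_fin.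
  by apply: nearW => n; case: (nrm z <= 1)%R; rewrite ?mul1e ?mul0e.
Qed.

End shift_space.

(** * Second moments of sums over pairs *)

Section bounded_expectation.
Variable R : realType.

(** All statistics met here are bounded, so their expectations are finite and the moment
    computations can be done in R with linear rules. *)
Definition bmf d (T : measurableType d) (f : T -> R) :=
  measurable_fun setT f /\ exists C : R, forall x, `|f x| <= C.

Lemma bmf_cst d (T : measurableType d) (c : R) : bmf (fun _ : T => c).
Proof. by split => //; exists `|c|. Qed.

Lemma bmfD d (T : measurableType d) (f g : T -> R) : bmf f -> bmf g -> bmf (fun x => f x + g x).
Proof.
move=> [mf [C hC]] [mg [D hD]]; split; first exact: measfD.
by exists (C + D) => x; rewrite (le_trans (ler_normD _ _))// lerD.
Qed.

Lemma bmfM d (T : measurableType d) (f g : T -> R) : bmf f -> bmf g -> bmf (fun x => f x * g x).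
Proof.
move=> [mf [C hC]] [mg [D hD]]; split; first exact: measfM.
by exists (C * D) => x; rewrite normrM ler_pM.
Qed.

Lemma bmfZ d (T : measurableType d) (c : R) (f : T -> R) : bmf f -> bmf (fun x => c * f x).
Proof. by move=> bf; apply: bmfM => //; exact: bmf_cst. Qed.

Lemma bmfN d (T : measurableType d) (f : T -> R) : bmf f -> bmf (fun x => - f x).
Proof.
move=> [mf [C hC]]; split; first exact: measfN.
by exists C => x; rewrite normrN.
Qed.

Lemma bmfB d (T : measurableType d) (f g : T -> R) : bmf f -> bmf g -> bmf (fun x => f x - g x).
Proof. by move=> bf bg; apply: bmfD => //; exact: bmfN. Qed.

Lemma bmfX2 d (T : measurableType d) (f : T -> R) : bmf f -> bmf (fun x => f x ^+ 2).
Proof. by move=> bf; exact: bmfM. Qed.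

Lemma bmf_bool d (T : measurableType d) (p : T -> bool) : measurable_fun setT p ->
  bmf (fun x => (p x)%:R).
Proof.
move=> mp; split; first exact: measf_natr.
by exists 1 => x; case: (p x); rewrite ?normr1 ?normr0.
Qed.

Lemma bmf_comp d d' (T : measurableType d) (T' : measurableType d') (f : T' -> R) (g : T -> T') :
  bmf f -> measurable_fun setT g -> bmf (fun x => f (g x)).
Proof.
move=> [mf [C hC]] mg; split; last by exists C => x; exact: hC.
exact: (measurableT_comp mf mg).
Qed.

Definition Ex d (T : measurableType d) (m : set T -> \bar R) (f : T -> R) : R :=
  fine (\int[m]_x (f x)%:E).

Section one_space.
Context d (T : measurableType d) (m : {measure set T -> \bar R}).
Hypothesis m1 : m setT = 1%E.
Implicit Types f g : T -> R.

Lemma bmf_integrable f : bmf f -> m.-integrable setT (EFin \o f).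
Proof.
move=> [mf [C hC]]; apply: measurable_bounded_integrable => //.
  by rewrite /= m1 ltry.
exists C; split; first exact: num_real.
by move=> y Cy x _ /=; rewrite (le_trans (hC x))// ltW.
Qed.

Lemma ExE f : bmf f -> (\int[m]_x (f x)%:E = (Ex m f)%:E)%E.
Proof.
by move=> bf; rewrite fineK//; apply: (integrable_fin_num measurableT (bmf_integrable bf)).
Qed.

Lemma ExD f g : bmf f -> bmf g -> Ex m (fun x => f x + g x) = Ex m f + Ex m g.
Proof.
move=> bf bg; apply: EFin_inj; rewrite -ExE; last exact: bmfD.
rewrite EFinD -!ExE//.
by rewrite -(integralD measurableT (bmf_integrable bf) (bmf_integrable bg)).
Qed.

Lemma ExZ c f : bmf f -> Ex m (fun x => c * f x) = c * Ex m f.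
Proof.
move=> bf; apply: EFin_inj; rewrite -ExE; last exact: bmfZ.
rewrite EFinM -!ExE//.
by rewrite -(integralZl measurableT (bmf_integrable bf)).
Qed.

Lemma Ex_cst c : Ex m (fun=> c) = c.
Proof. by rewrite /Ex (integral_cst m measurableT c%:E) /= m1 mule1. Qed.

Lemma ExN f : bmf f -> Ex m (fun x => - f x) = - Ex m f.
Proof.
move=> bf; rewrite -mulN1r -ExZ//; congr (Ex m _).
by apply/funext => x; rewrite mulN1r.
Qed.

Lemma ExB f g : bmf f -> bmf g -> Ex m (fun x => f x - g x) = Ex m f - Ex m g.
Proof. by move=> bf bg; rewrite ExD ?ExN//; exact: bmfN. Qed.

Lemma Ex_le f g : bmf f -> bmf g -> (forall x, f x <= g x) -> Ex m f <= Ex m g.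
Proof.
move=> bf bg fg; rewrite -lee_fin -!ExE//.
by apply: (le_integral measurableT (bmf_integrable bf) (bmf_integrable bg)) => x _; rewrite lee_fin.
Qed.

Lemma Ex_ge0 f : (forall x, 0 <= f x) -> 0 <= Ex m f.
Proof. by move=> f0; apply: fine_ge0; apply: integral_ge0 => x _; rewrite lee_fin. Qed.

Lemma Ex_norm_le f g : bmf f -> bmf g -> (forall x, `|f x| <= g x) -> `|Ex m f| <= Ex m g.
Proof.
move=> bf bg fg; rewrite ler_norml -ExN//; apply/andP; split; apply: Ex_le => //.
- exact: bmfN.
- by move=> x; have := fg x; rewrite ler_norml => /andP[].
- by move=> x; have := fg x; rewrite ler_norml => /andP[].
Qed.

Lemma Ex_ext f g : (forall x, f x = g x) -> Ex m f = Ex m g.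
Proof. by move=> fg; congr (Ex m _); exact/funext. Qed.

Lemma Ex_bound f C : bmf f -> (forall x, `|f x| <= C) -> `|Ex m f| <= C.
Proof.
move=> bf fC; rewrite -[leRHS]Ex_cst; apply: Ex_norm_le => //; exact: bmf_cst.
Qed.

Lemma markov_Ex f (p : T -> bool) (c : R) : bmf f -> measurable_fun setT p -> 0 < c ->
  (forall x, 0 <= f x) -> (forall x, p x -> c <= f x) ->
  (m [set x | p x] <= (Ex m f / c)%:E)%E.
Proof.
move=> bf mp c0 f0 pf.
rewrite -integral_pred// (ExE (bmf_bool mp)) lee_fin ler_pdivlMr// mulrC -ExZ; last exact: bmf_bool.
apply: Ex_le => //; first exact/bmfZ/bmf_bool.
by move=> x; case: (boolP (p x)) => px; rewrite ?mulr1 ?mulr0// pf.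
Qed.

End one_space.

Section two_spaces.
Context d1 d2 (T1 : measurableType d1) (T2 : measurableType d2).
Variables (m1 : {sigma_finite_measure set T1 -> \bar R}) (m2 : {sigma_finite_measure set T2 -> \bar R}).
Hypotheses (m11 : m1 setT = 1%E) (m21 : m2 setT = 1%E).

Lemma bmf_section1 (F : T1 * T2 -> R) x : bmf F -> bmf (fun y => F (x, y)).
Proof. by move=> bF; apply: bmf_comp => //; meas. Qed.

Lemma bmf_section2 (F : T1 * T2 -> R) y : bmf F -> bmf (fun x => F (x, y)).
Proof. by move=> bF; apply: bmf_comp => //; meas. Qed.

Lemma bmf_Ex (F : T1 * T2 -> R) : bmf F -> bmf (fun x => Ex m2 (fun y => F (x, y))).
Proof.
move=> bF; have [mF [C hC]] := bF.
split; last by exists C => x; apply: Ex_bound => //; exact: bmf_section1.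
(* Adding the bound C makes the integrand nonnegative, as [measf_int2] requires; the mass being 1, C
   is subtracted afterwards. *)
have E x : Ex m2 (fun y => F (x, y)) = fine (\int[m2]_y (F (x, y) + C)%:E) - C.
  have -> : (\int[m2]_y (F (x, y) + C)%:E = (Ex m2 (fun y => (F (x, y) + C)%R))%:E)%E.
    by rewrite -ExE//; apply: bmfD; [exact: bmf_section1|exact: bmf_cst].
  rewrite /= ExD//; [|exact: bmf_section1|exact: bmf_cst].
  by rewrite Ex_cst// addrK.
rewrite (_ : (fun x => _) = (fun x => fine (\int[m2]_y (F (x, y) + C)%:E) - C)); last exact/funext.
apply: measfB => //; apply: (measurableT_comp (fine_measurable measurableT)).
apply: (@measf_int2 R _ _ _ _ m2 (fun x y => (F (x, y) + C)%:E)) => //.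
  rewrite (_ : (fun p => _) = (fun p => (F p + C)%:E)); last by apply/funext => -[].
  by meas.
by move=> x y; rewrite lee_fin -lerBlDr sub0r; have := hC (x, y); rewrite ler_norml => /andP[].
Qed.

(** Tonelli applied to F + C >= 0; both masses are 1, so the same constant appears on both sides. *)
Lemma Ex_swap (F : T1 * T2 -> R) : bmf F ->
  Ex m1 (fun x => Ex m2 (fun y => F (x, y))) = Ex m2 (fun y => Ex m1 (fun x => F (x, y))).
Proof.
move=> bF; have [mF [C hC]] := bF.
have bFC : bmf (fun p => F p + C) by apply: bmfD => //; exact: bmf_cst.
have bsw : bmf (fun q : T2 * T1 => F (q.2, q.1)).
  by apply: (bmf_comp (g := fun q => (q.2, q.1)) bF); meas.
have bswE : bmf (fun y => Ex m1 (fun x => F (x, y))).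
  have [mG [C' hC']] := bsw.
  split; last by exists C => y; apply: Ex_bound => //; exact: bmf_section2.
  have E y : Ex m1 (fun x => F (x, y)) = fine (\int[m1]_x (F (x, y) + C)%:E) - C.
    have -> : (\int[m1]_x (F (x, y) + C)%:E = (Ex m1 (fun x => (F (x, y) + C)%R))%:E)%E.
      by rewrite -ExE//; apply: bmfD; [exact: bmf_section2|exact: bmf_cst].
    rewrite /= ExD//; [|exact: bmf_section2|exact: bmf_cst].
    by rewrite Ex_cst// addrK.
  rewrite (_ : (fun x => _) = (fun y => fine (\int[m1]_x (F (x, y) + C)%:E) - C)); last exact/funext.
  apply: measfB => //; apply: (measurableT_comp (fine_measurable measurableT)).
  apply: (@measf_int2 R _ _ _ _ m1 (fun y x => (F (x, y) + C)%:E)) => //.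
    by meas.
  by move=> y x; rewrite lee_fin -lerBlDr sub0r; have := hC (x, y); rewrite ler_norml => /andP[].
suff : Ex m1 (fun x => Ex m2 (fun y => F (x, y))) + C = Ex m2 (fun y => Ex m1 (fun x => F (x, y))) + C.
  by move/addIr.
have s1 x := bmf_section1 x bF; have s2 y := bmf_section2 y bF.
rewrite -{1}(Ex_cst m11 C) -(Ex_cst m21 C) -!ExD//; try exact: bmf_cst; last exact: bmf_Ex.
apply: EFin_inj; rewrite -!ExE//; try by apply: bmfD; [|exact: bmf_cst] => //; exact: bmf_Ex.
transitivity (\int[m1]_x \int[m2]_y (F (x, y) + C)%:E)%E.
  apply: eq_integral => x _; rewrite ExE//; last by apply: bmfD => //; exact: bmf_cst.
  by rewrite ExD// ?Ex_cst//; exact: bmf_cst.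
rewrite (fubini_tonelli (fun p => (F p + C)%:E)).
- apply: eq_integral => y _; rewrite ExE//; last by apply: bmfD => //; exact: bmf_cst.
  by rewrite ExD// ?Ex_cst//; exact: bmf_cst.
- by meas.
- by move=> p; rewrite lee_fin -lerBlDr sub0r; have := hC p; rewrite ler_norml => /andP[].
Qed.

End two_spaces.

Section power.
Context d (T : measurableType d) (mu : {sigma_finite_measure set T -> \bar R}).
Hypothesis mu1 : mu setT = 1%E.

Lemma pw_setT n : pw mu n setT = 1%E.
Proof.
have := @pw_rect _ _ _ mu n (fun=> setT) (fun=> measurableT).
rewrite (_ : rect n _ = setT); last by apply/seteqP; split.
by move=> ->; rewrite big1.
Qed.

Lemma bmf_consp n (F : n.+1.-tuple T -> R) : bmf F ->
  bmf (fun p : T * n.-tuple T => F (cons_tuple p.1 p.2)).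
Proof. by move=> bF; apply: (bmf_comp bF); exact: measurable_cons. Qed.

Lemma Ex_pwS n (F : n.+1.-tuple T -> R) : bmf F ->
  Ex (pw mu n.+1) F = Ex mu (fun x => Ex (pw mu n) (fun t => F (cons_tuple x t))).
Proof.
move=> bF; have [mF [C hC]] := bF.
have bc := bmf_consp bF.
have bcx x : bmf (fun t : n.-tuple T => F (cons_tuple x t)).
  exact: (bmf_section1 (F := fun p => F (cons_tuple p.1 p.2)) x bc).
apply: (@addIr _ C).
rewrite -{1}(Ex_cst (pw_setT n.+1) C) -{2}(Ex_cst mu1 C) -!ExD//; try exact: bmf_cst; try exact: pw_setT; last first.
  exact: (bmf_Ex (pw_setT n) bc).
apply: EFin_inj; rewrite -!ExE//; try exact: pw_setT; last 2 first.
- by apply: bmfD; [exact: (bmf_Ex (pw_setT n) bc)|exact: bmf_cst].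
- by apply: bmfD => //; exact: bmf_cst.
rewrite (@ge0_integral_pwS _ _ _ mu n (fun t => (F t + C)%:E)).
- apply: eq_integral => x _; rewrite ExE//; [|exact: pw_setT|by apply: bmfD => //; exact: bmf_cst].
  by rewrite ExD//; [rewrite Ex_cst//; exact: pw_setT|exact: pw_setT|exact: bmf_cst].
- by meas.
- by move=> p; rewrite lee_fin -lerBlDr sub0r; have := hC p; rewrite ler_norml => /andP[].
Qed.

End power.
End bounded_expectation.

(** Sum over pairs of positions i < j, recursive in the first entry: a new point adds one row. *)
Fixpoint psum (R : realType) (T : Type) (a : T -> T -> R) (s : seq T) : R :=
  if s is x :: s' then \sum_(y <- s') a x y + psum a s' else 0.

Section moments.
Variable R : realType.
Context d (T : measurableType d) (mu : {sigma_finite_measure set T -> \bar R}).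
Hypothesis mu1 : mu setT = 1%E.

Lemma bmf_sum d' (T' : measurableType d') (I : Type) (r : seq I) (F : I -> T' -> R) :
  (forall i, bmf (F i)) -> bmf (fun x => \sum_(i <- r) F i x).
Proof.
move=> bF; elim: r => [|i r IH].
  rewrite (_ : (fun x => _) = (fun=> 0)); first exact: bmf_cst.
  by apply/funext => x; rewrite big_nil.
rewrite (_ : (fun x => _) = (fun x => F i x + \sum_(j <- r) F j x)); first exact: bmfD.
by apply/funext => x; rewrite big_cons.
Qed.

Lemma Ex_sum d' (T' : measurableType d') (m : {measure set T' -> \bar R}) (I : Type) (r : seq I)
    (F : I -> T' -> R) : m setT = 1%E ->
  (forall i, bmf (F i)) -> Ex m (fun x => \sum_(i <- r) F i x) = \sum_(i <- r) Ex m (F i).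
Proof.
move=> m1 bF; elim: r => [|i r IH].
  rewrite big_nil -[RHS](Ex_cst m1); apply: Ex_ext => x; by rewrite big_nil.
rewrite big_cons -IH -ExD//; last exact: bmf_sum.
by apply: Ex_ext => x; rewrite big_cons.
Qed.

Lemma bmf_tsum n (g : T -> R) : bmf g -> bmf (fun t : n.-tuple T => \sum_(x <- t) g x).
Proof.
move=> bg; rewrite (_ : (fun t => _) = (fun t : n.-tuple T => \sum_(i < n) g (tnth t i))).
  by apply: bmf_sum => i; apply: (bmf_comp bg); exact: measurable_tnth.
by apply/funext => t; rewrite big_tuple.
Qed.

Lemma Ex_tsum n (g : T -> R) : bmf g ->
  Ex (pw mu n) (fun t : n.-tuple T => \sum_(x <- t) g x) = n%:R * Ex mu g.
Proof.
move=> bg; elim: n => [|n IH].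
  rewrite mul0r -[RHS](Ex_cst (pw_setT mu1 0)); apply: Ex_ext => t.
  by rewrite (tuple0 t) big_nil.
rewrite Ex_pwS//; last exact: bmf_tsum.
transitivity (Ex mu (fun x => g x + n%:R * Ex mu g)).
  apply: Ex_ext => x; rewrite -IH -[X in X + _](Ex_cst (pw_setT mu1 n)) -ExD; first last.
  - exact: bmf_tsum.
  - exact: bmf_cst.
  - exact: pw_setT.
  by apply: Ex_ext => t; rewrite /= big_cons.
by rewrite ExD ?Ex_cst//; [rewrite -natr1; ring|exact: bmf_cst].
Qed.

Lemma Ex_tsum2 n (g : T -> R) : bmf g ->
  Ex (pw mu n) (fun t : n.-tuple T => (\sum_(x <- t) g x) ^+ 2) =
  n%:R * Ex mu (fun x => g x ^+ 2) + (n%:R ^+ 2 - n%:R) * (Ex mu g) ^+ 2.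
Proof.
move=> bg; elim: n => [|n IH].
  rewrite mul0r expr0n subrr mul0r addr0 -[RHS](Ex_cst (pw_setT mu1 0)); apply: Ex_ext => t.
  by rewrite (tuple0 t) big_nil expr0n.
rewrite Ex_pwS//; last exact/bmfX2/bmf_tsum.
have bG := @bmf_tsum n g bg; have p1 := pw_setT mu1 n.
have bc c := @bmf_cst R _ (n.-tuple T) c.
set V := Ex mu (fun x => g x ^+ 2) in IH *; set e := Ex mu g in IH *.
transitivity (Ex mu (fun x => g x ^+ 2 + (2 * n%:R * e * g x +
    (n%:R * V + (n%:R ^+ 2 - n%:R) * e ^+ 2)))).
  apply: Ex_ext => x; rewrite -IH.
  transitivity (Ex (pw mu n) (fun t : n.-tuple T => g x ^+ 2 + ((2 * g x) * (\sum_(y <- t) g y) +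
      (\sum_(y <- t) g y) ^+ 2))).
    by apply: Ex_ext => t; rewrite /= big_cons; ring.
  rewrite ExD//; last by apply: bmfD; [exact: bmfZ|exact: bmfX2].
  rewrite ExD//; [|exact: bmfZ|exact: bmfX2].
  by rewrite Ex_cst// ExZ// Ex_tsum// -/e; ring.
rewrite ExD//; [|exact: bmfX2|by apply: bmfD; [exact: bmfZ|exact: bmf_cst]].
rewrite ExD//; [|exact: bmfZ|exact: bmf_cst].
by rewrite ExZ// Ex_cst// -/e -/V -natr1; ring.
Qed.

Section psum.
Variable a : T -> T -> R.
Hypothesis ba : bmf (fun p : T * T => a p.1 p.2).

Lemma bmf_row n : bmf (fun p : T * n.-tuple T => \sum_(y <- p.2) a p.1 y).
Proof.
rewrite (_ : (fun p => _) = (fun p : T * n.-tuple T => \sum_(i < n) a p.1 (tnth p.2 i))).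
  apply: bmf_sum => i.
  apply: (bmf_comp (g := fun p : T * n.-tuple T => (p.1, tnth p.2 i)) ba).
  by meas; apply: (measurableT_comp (measurable_tnth i)); meas.
by apply/funext => p; rewrite big_tuple.
Qed.

Lemma bmf_psum n : bmf (fun t : n.-tuple T => psum a t).
Proof.
elim: n => [|n IH].
  rewrite (_ : (fun t => _) = (fun=> 0)); first exact: bmf_cst.
  by apply/funext => t; rewrite (tuple0 t).
have bG : bmf (fun p : T * n.-tuple T => \sum_(y <- p.2) a p.1 y + psum a p.2).
  by apply: bmfD; [exact: bmf_row|apply: (bmf_comp IH); meas].
rewrite (_ : (fun t => _) = (fun t : n.+1.-tuple T =>
    (fun p : T * n.-tuple T => \sum_(y <- p.2) a p.1 y + psum a p.2) (thead t, behead_tuple t))).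
  apply: (bmf_comp (g := fun t : n.+1.-tuple T => (thead t, behead_tuple t)) bG).
  by apply: measurable_fun_pair; [exact: measurable_tnth|exact: measurable_behead].
by apply/funext => t; rewrite [in LHS](tuple_eta t).
Qed.

Variable u : T -> R.
Hypotheses (bu : bmf u) (u0 : forall x, 0 <= u x) (u1 : forall x, u x <= 1).
Hypothesis au : forall x y, `|a x y| <= u x * u y.
Hypothesis a0 : Ex mu (fun x => Ex mu (fun y => a x y)) = 0.

Let p := Ex mu u.

Let p0 : 0 <= p. Proof. exact: Ex_ge0. Qed.

Let bax x : bmf (fun y => a x y).
Proof. exact: (bmf_section1 (F := fun q => a q.1 q.2) x ba). Qed.

Let bay y : bmf (fun x => a x y).
Proof. exact: (bmf_section2 (F := fun q => a q.1 q.2) y ba). Qed.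

Let a2 x y : a x y ^+ 2 <= u x * u y.
Proof.
rewrite -real_normK ?num_real// expr2; apply: (@le_trans _ _ (`|a x y| * 1)).
  by rewrite ler_wpM2l// (le_trans (au x y))// mulr_ile1.
by rewrite mulr1.
Qed.

Let sq_le_of_norm (z c v : R) : `|z| <= c * v -> 0 <= c -> 0 <= v -> v <= 1 -> z ^+ 2 <= c ^+ 2 * v.
Proof.
move=> zc c0 v0 v1; rewrite -real_normK ?num_real//.
apply: (@le_trans _ _ ((c * v) ^+ 2)); first by rewrite ler_pXn2r// nnegrE mulr_ge0.
rewrite exprMn ler_wpM2l ?sqr_ge0// expr2 -[leRHS]mulr1 ler_wpM2l//.
Qed.

(** Keeping the factor [u x] on the right is what later supplies an extra power of p, when the new
    point x is averaged. *)
Lemma Ex_row2 n x : Ex (pw mu n) (fun t : n.-tuple T => (\sum_(y <- t) a x y) ^+ 2) <=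
  (n%:R * p + n%:R ^+ 2 * p ^+ 2) * u x.
Proof.
rewrite Ex_tsum2//.
have h1 : Ex mu (fun y => a x y ^+ 2) <= p * u x.
  rewrite mulrC -ExZ//; apply: Ex_le => //; [exact: bmfX2|exact: bmfZ].
have h2 : (Ex mu (fun y => a x y)) ^+ 2 <= p ^+ 2 * u x.
  apply: sq_le_of_norm => //; rewrite mulrC -ExZ//; apply: Ex_norm_le => //; exact: bmfZ.
have n0 : 0 <= n%:R :> R by [].
have n1 : (n%:R ^+ 2 - n%:R : R) <= n%:R ^+ 2 by rewrite gerBl.
rewrite [leRHS]mulrDl -(mulrA _ p) -(mulrA _ (p ^+ 2)); apply: lerD; first exact: ler_wpM2l.
apply: (@le_trans _ _ (n%:R ^+ 2 * (Ex mu (fun y => a x y)) ^+ 2)).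
  by apply: ler_wpM2r => //; exact: sqr_ge0.
by apply: ler_wpM2l => //; exact: sqr_ge0.
Qed.

(** The summand is the projection of the kernel on one point. It is centred by [a0], which leaves
    only the diagonal term, and bounded by p u(y), so its square has mean at most p^3. *)
Lemma Ex_hsum2 n : Ex (pw mu n) (fun t : n.-tuple T => (\sum_(y <- t) Ex mu (fun x => a x y)) ^+ 2)
  <= n%:R * p ^+ 3.
Proof.
have bh : bmf (fun y => Ex mu (fun x => a x y)).
  apply: (bmf_Ex (F := fun q => a q.2 q.1) mu1).
  by apply: (bmf_comp (g := fun q : T * T => (q.2, q.1)) ba); meas.
rewrite Ex_tsum2//.
have -> : Ex mu (fun y => Ex mu (fun x => a x y)) = 0.
  by rewrite -(Ex_swap (F := fun q => a q.1 q.2) mu1 mu1 ba).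
rewrite expr0n mulr0 addr0 ler_wpM2l// exprSr -ExZ//.
apply: Ex_le => //; [exact: bmfX2|exact: bmfZ|move=> y].
apply: sq_le_of_norm => //; rewrite mulrC -ExZ//.
by apply: Ex_norm_le => //; [exact: bmfZ|move=> x; rewrite mulrC].
Qed.

(* The cross term [2 L S] is averaged over the new point first, which replaces
   [L] by the projected sum [H], of second moment [n p^3] only. *)
Lemma Ex_psum2 n : Ex (pw mu n) (fun t : n.-tuple T => psum a t ^+ 2) <=
  n%:R ^+ 2 * p ^+ 2 + n%:R ^+ 3 * p ^+ 3.
Proof.
elim: n => [|n IH].
  rewrite !expr0n /= !mul0r addr0 -[leRHS](Ex_cst (pw_setT mu1 0)).
  apply: (Ex_le (pw_setT mu1 0)); [exact/bmfX2/bmf_psum|exact: bmf_cst|move=> t].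
  by rewrite (tuple0 t) /= expr0n.
have q1 := pw_setT mu1 n.
have bS := bmf_psum n; have bL := bmf_row n.
have bLx x : bmf (fun t : n.-tuple T => \sum_(y <- t) a x y) by exact: bmf_tsum.
have bh : bmf (fun y => Ex mu (fun x => a x y)).
  apply: (bmf_Ex (F := fun q => a q.2 q.1) mu1).
  by apply: (bmf_comp (g := fun q : T * T => (q.2, q.1)) ba); meas.
pose H (t : n.-tuple T) := \sum_(y <- t) Ex mu (fun x => a x y).
have bH : bmf H by exact: bmf_tsum.
have bLS : bmf (fun q : T * n.-tuple T => (\sum_(y <- q.2) a q.1 y) * psum a q.2).
  by apply: bmfM => //; apply: (bmf_comp bS); meas.
have bL2 : bmf (fun x => Ex (pw mu n) (fun t : n.-tuple T => (\sum_(y <- t) a x y) ^+ 2)).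
  exact: (bmf_Ex (F := fun q : T * n.-tuple T => (\sum_(y <- q.2) a q.1 y) ^+ 2) q1 (bmfX2 bL)).
have bLSx : bmf (fun x => Ex (pw mu n) (fun t : n.-tuple T => (\sum_(y <- t) a x y) * psum a t)).
  exact: (bmf_Ex q1 bLS).
have -> : Ex (pw mu n.+1) (fun t : n.+1.-tuple T => psum a t ^+ 2) =
    Ex mu (fun x => Ex (pw mu n) (fun t : n.-tuple T => (\sum_(y <- t) a x y) ^+ 2)) +
    (2 * Ex (pw mu n) (fun t => H t * psum a t) +
     Ex (pw mu n) (fun t : n.-tuple T => psum a t ^+ 2)).
  rewrite Ex_pwS//; last exact/bmfX2/bmf_psum.
  transitivity (Ex mu (fun x => Ex (pw mu n) (fun t : n.-tuple T => (\sum_(y <- t) a x y) ^+ 2) +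
     (2 * Ex (pw mu n) (fun t : n.-tuple T => (\sum_(y <- t) a x y) * psum a t) +
     Ex (pw mu n) (fun t : n.-tuple T => psum a t ^+ 2)))).
    apply: Ex_ext => x; rewrite -ExZ//; last exact: bmfM.
    rewrite -ExD//; [|by apply: bmfZ; exact: bmfM|exact: bmfX2].
    rewrite -ExD//; [|exact: bmfX2|by apply: bmfD; [apply: bmfZ; exact: bmfM|exact: bmfX2]].
    by apply: Ex_ext => t /=; ring.
  rewrite ExD//; last by apply: bmfD; [exact: bmfZ|exact: bmf_cst].
  rewrite ExD//; [|exact: bmfZ|exact: bmf_cst].
  rewrite Ex_cst// ExZ//; congr (_ + (2 * _ + _)).
  rewrite (Ex_swap (F := fun q : T * n.-tuple T => (\sum_(y <- q.2) a q.1 y) * psum a q.2) mu1 q1 bLS) /=.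
  apply: Ex_ext => t; rewrite /H -(Ex_sum t mu1)//.
  rewrite mulrC -ExZ//; last exact: bmf_sum.
  by apply: Ex_ext => x; rewrite mulrC.
have h1 : Ex mu (fun x => Ex (pw mu n) (fun t : n.-tuple T => (\sum_(y <- t) a x y) ^+ 2)) <=
    (n%:R * p + n%:R ^+ 2 * p ^+ 2) * p.
  rewrite -ExZ//; apply: Ex_le => //; [exact: bmfZ|move=> x; exact: Ex_row2].
(* The empty sample is treated apart because the weight 1/n used next needs n > 0. *)
case: n => [|n] in IH q1 bS bL bLx H bH bLS bL2 bLSx h1 *.
  have -> : Ex (pw mu 0) (fun t => H t * psum a t) = 0.
    rewrite -[RHS](Ex_cst q1); apply: Ex_ext => t.
    by rewrite (tuple0 t) /= mulr0.
  move: h1 IH; rewrite !expr0n /= !mul0r !mulr0 add0r => h1 IH.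
  rewrite !expr1n !mul1r mul0r in h1 *.
  have p2 : 0 <= p ^+ 2 by exact: exprn_ge0.
  have p3 : 0 <= p ^+ 3 by exact: exprn_ge0.
  by rewrite add0r (le_trans (lerD h1 IH))// addr0 addr_ge0.
have N0 : 0 < n.+1%:R :> R by [].
(* With N = n + 1, the inequality 2 H S <= N H^2 + S^2 / N: this weight multiplies the induction
   bound by 1 + 1/N only, which a bound of cubic growth absorbs. *)
have h2 : 2 * Ex (pw mu n.+1) (fun t => H t * psum a t) <=
    n.+1%:R * (n.+1%:R * p ^+ 3) + n.+1%:R^-1 * Ex (pw mu n.+1) (fun t : n.+1.-tuple T => psum a t ^+ 2).
  apply: (@le_trans _ _ (n.+1%:R * Ex (pw mu n.+1) (fun t => H t ^+ 2) +
      n.+1%:R^-1 * Ex (pw mu n.+1) (fun t : n.+1.-tuple T => psum a t ^+ 2))); last first.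
    by rewrite lerD2r; apply: ler_wpM2l => //; exact: Ex_hsum2.
  rewrite -!ExZ//; [|exact: bmfX2|exact: bmfX2|exact: bmfM].
  rewrite -ExD//; [|by apply: bmfZ; exact: bmfX2|by apply: bmfZ; exact: bmfX2].
  apply: Ex_le => //; [by apply: bmfZ; exact: bmfM| |move=> t].
    by apply: bmfD; apply: bmfZ; exact: bmfX2.
  rewrite -subr_ge0; set h := H t; set s := psum a t.
  rewrite (_ : _ - _ = n.+1%:R^-1 * (n.+1%:R * h - s) ^+ 2).
    by rewrite mulr_ge0 ?invr_ge0 ?sqr_ge0.
  by field; rewrite gt_eqF.
move: (Ex mu _) (Ex (pw mu n.+1) (fun t => H t * _)) (Ex (pw mu n.+1) (fun t : n.+1.-tuple T => psum a t ^+ 2)) h1 h2 IH => A B S h1 h2 IH.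
rewrite -[n.+2%:R]natr1; move: (n.+1%:R : R) N0 h1 h2 IH => N N0 h1 h2 IH.
have h3 : N^-1 * S <= N * p ^+ 2 + N ^+ 2 * p ^+ 3.
  rewrite ler_pdivrMl//; apply: (le_trans IH); rewrite le_eqVlt; apply/orP; left; apply/eqP; ring.
have p2 : 0 <= p ^+ 2 by exact: exprn_ge0.
have p3 : 0 <= p ^+ 3 by exact: exprn_ge0.
have Np : 0 <= N * p ^+ 3 by rewrite mulr_ge0// ltW.
(* The first three groups are the row, the cross term and the old sum; the last one is the
   nonnegative slack. *)
have -> : (N + 1) ^+ 2 * p ^+ 2 + (N + 1) ^+ 3 * p ^+ 3 =
  (N * p + N ^+ 2 * p ^+ 2) * p + (N * (N * p ^+ 3) + (N * p ^+ 2 + N ^+ 2 * p ^+ 3)) +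
  (N ^+ 2 * p ^+ 2 + N ^+ 3 * p ^+ 3) + (p ^+ 2 + 3 * (N * p ^+ 3) + p ^+ 3) by ring.
lra.
Qed.

End psum.
End moments.

(** * The statistic around a fixed vertex *)

Section graph_counts.
Variables (R : realType) (T : Type) (u : T -> bool) (e : T -> T -> bool).

(** The statistic as a function of the list of the other vertices, with abstract predicates: [u] for
    being a neighbour of the fixed vertex, [e] for adjacency. *)
Definition degS (s : seq T) : nat := \sum_(x <- s) u x.
Definition triS (s : seq T) : R := psum (fun x y => [&& u x, u y & e x y]%:R) s.
Definition WS (s : seq T) : R :=
  if (2 <= degS s)%N then triS s / 'C(degS s, 2)%:R else 0.

End graph_counts.

Section conditional_bound.
Variable R : realType.
Context d (T : measurableType d) (mu : {sigma_finite_measure set T -> \bar R}).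
Hypothesis mu1 : mu setT = 1%E.
Variables (u : T -> bool) (e : T -> T -> bool).
Hypotheses (mu_ : measurable_fun setT u).
Hypothesis me : measurable_fun setT (fun p : T * T => e p.1 p.2).

Lemma binR n : 'C(n, 2)%:R = (n%:R ^+ 2 - n%:R) / 2 :> R.
Proof.
elim: n => [|n IH]; first by rewrite bin0n expr0n subrr mul0r.
by rewrite binS natrD bin1 IH -natr1; field.
Qed.

Lemma degSR s : (degS u s)%:R = \sum_(x <- s) (u x)%:R :> R.
Proof. by rewrite /degS natr_sum. Qed.

Lemma psum_sub (a b : T -> T -> R) (c : R) s :
  psum (fun x y => a x y - c * b x y) s = psum a s - c * psum b s.
Proof.
elim: s => [|x s IH] /=; first by rewrite mulr0 subr0.
by rewrite IH sumrB -mulr_sumr; ring.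
Qed.

(** A further neighbour forms one pair with each earlier one. It follows that [triS] minus q times
    the binomial is itself a pair sum. *)
Lemma psum_deg s : psum (fun x y => (u x)%:R * (u y)%:R) s = 'C(degS u s, 2)%:R :> R.
Proof.
elim: s => [|x s IH] /=; first by rewrite /degS big_nil.
have -> : degS u (x :: s) = (u x + degS u s)%N by rewrite /degS big_cons.
rewrite IH !binR -mulr_sumr -degSR natrD.
by case: (u x) => /=; field.
Qed.

Let bu : bmf (fun x => (u x)%:R : R).
Proof. exact: bmf_bool. Qed.

Let bue : bmf (fun p : T * T => [&& u p.1, u p.2 & e p.1 p.2]%:R : R).
Proof. by apply: bmf_bool; meas. Qed.

Lemma bmf_triS n : bmf (fun t : n.-tuple T => triS R u e t).
Proof. exact: (bmf_psum (a := fun x y => [&& u x, u y & e x y]%:R) bue). Qed.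

Lemma bmf_degS n : bmf (fun t : n.-tuple T => (degS u t)%:R : R).
Proof.
rewrite (_ : (fun t => _) = (fun t : n.-tuple T => \sum_(x <- t) (u x)%:R)).
  exact: bmf_tsum.
by apply/funext => t; rewrite degSR.
Qed.

Lemma measurable_WS n : measurable_fun setT (fun t : n.-tuple T => WS R u e t).
Proof.
have [mt _] := bmf_triS n; have [md _] := bmf_degS n.
rewrite (_ : (fun t => _) = (fun t : n.-tuple T =>
   (2 <= (degS u t)%:R :> R)%R%:R * (triS R u e t * 'C(degS u t, 2)%:R^-1))); last first.
  by apply/funext => t; rewrite /WS ler_nat; case: ifP => _; rewrite ?mul1r ?mul0r.
have mi : measurable_fun setT (fun t : n.-tuple T => 'C(degS u t, 2)%:R^-1 : R).
  pose g (k : nat) : R := 'C(k, 2)%:R^-1.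
  (* The degree is integer valued, so any set of degrees has a countable union of level sets as
     preimage, and every function of the degree is measurable. *)
  have mN : measurable_fun setT (fun t : n.-tuple T => degS u t).
    move=> _ Y _; rewrite setTI.
    rewrite (_ : _ @^-1` Y = \bigcup_(k in Y) [set t : n.-tuple T | ((degS u t)%:R == k%:R :> R)]).
      apply: bigcup_measurable => k _; apply: measurable_pred.
      by apply: measurable_fun_eqr => //; meas.
    apply/seteqP; split => t /=; first by move=> Yt; exists (degS u t) => //=; rewrite eqxx.
    by move=> [k Yk /=]; rewrite eqr_nat => /eqP ->.
  by apply: (@measurableT_comp _ _ _ _ _ _ g setT (fun t : n.-tuple T => degS u t)).
by meas.
Qed.

Let p := Ex mu (fun x => (u x)%:R : R).

(** Chebyshev twice: 4 / K pays for a degree below half its mean, 2048 / (eps^2 K) for the centred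
    pair sum. Outside the first event 4 <= K forces a degree of at least 2, so the default value of
    [WS] does not occur. *)
Lemma inner_bound n (eps w K q : R) : 0 < eps -> 4 <= K -> K <= n%:R * p ->
  0 <= q -> q <= 1 -> Ex mu (fun x => Ex mu (fun y => [&& u x, u y & e x y]%:R)) = q * p ^+ 2 ->
  `|q - w| <= eps / 2 ->
  (pw mu n [set t : n.-tuple T | (eps <= `|WS R u e t - w|)%R] <= ((4 + 2048 / eps ^+ 2) / K)%:E)%E.
Proof.
move=> eps0 K4 Km q0 q1 qp qw.
set m := n%:R * p in Km.
have m4 : 4 <= m by exact: le_trans Km.
have m0 : 0 < m by lra.
have p0 : 0 <= p by apply: Ex_ge0 => x; case: (u x).
have pT := pw_setT mu1 n.
(* Recentred kernel: q is the conditional probability that two neighbours are adjacent, so the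
   double mean of [a] vanishes. *)
pose a x y : R := [&& u x, u y & e x y]%:R - q * ((u x)%:R * (u y)%:R).
have buu : bmf (fun z : T * T => (u z.1)%:R * (u z.2)%:R : R).
  by apply: bmfM; apply: bmf_bool; meas.
have ba : bmf (fun z : T * T => a z.1 z.2).
  by apply: bmfB => //; exact: bmfZ.
have au x y : `|a x y| <= (u x)%:R * (u y)%:R.
  rewrite /a; case: (u x) => /=; last by rewrite mul0r mulr0 subr0 normr0.
  case: (u y) => /=; last by rewrite mulr0 mulr0 subr0 normr0.
  rewrite !mulr1; case: (e x y) => /=; rewrite ?mulr1n ?mulr0n ler_norml; apply/andP; split; lra.
have a0 : Ex mu (fun x => Ex mu (fun y => a x y)) = 0.
  transitivity (Ex mu (fun x => Ex mu (fun y => [&& u x, u y & e x y]%:R) - (q * p) * (u x)%:R)).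
    apply: Ex_ext => x; rewrite /a ExB//.
    - congr (_ - _); rewrite ExZ//; last by apply: bmfZ.
      by rewrite ExZ// -/p; ring.
    - exact: (bmf_section1 (F := fun z : T * T => [&& u z.1, u z.2 & e z.1 z.2]%:R) x bue).
    - by apply: bmfZ; apply: bmfZ.
  rewrite ExB//; first by rewrite qp ExZ// -/p; ring.
    exact: (bmf_Ex (F := fun z : T * T => [&& u z.1, u z.2 & e z.1 z.2]%:R) mu1 bue).
  exact: bmfZ.
have u01 x : 0 <= (u x)%:R :> R by [].
have u11 x : (u x)%:R <= 1 :> R by case: (u x); rewrite ?ler01.
have ES := @Ex_psum2 R _ _ mu mu1 a ba _ bu u01 u11 au a0 n.
rewrite -/p in ES.
have SE (t : seq T) : psum a t = triS R u e t - q * 'C(degS u t, 2)%:R.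
  by rewrite /a psum_sub psum_deg.
have bS := bmf_psum ba n.
have bN := bmf_degS n.
have bNm : bmf (fun t : n.-tuple T => ((degS u t)%:R - m) ^+ 2 : R).
  by apply: bmfX2; apply: bmfB => //; exact: bmf_cst.
have EN : Ex (pw mu n) (fun t : n.-tuple T => ((degS u t)%:R - m) ^+ 2) <= m.
  have bg : bmf (fun x => (u x)%:R - p : R) by apply: bmfB => //; exact: bmf_cst.
  have -> : Ex (pw mu n) (fun t : n.-tuple T => ((degS u t)%:R - m) ^+ 2) =
      Ex (pw mu n) (fun t : n.-tuple T => (\sum_(x <- t) ((u x)%:R - p)) ^+ 2).
    apply: Ex_ext => t; rewrite sumrB -degSR; congr ((_ - _) ^+ 2).
    by rewrite big_tuple sumr_const card_ord -[RHS]mulr_natl.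
  rewrite Ex_tsum2// ExB//; last exact: bmf_cst.
  rewrite Ex_cst// -/p subrr expr0n mulr0 addr0 /m; apply: ler_wpM2l => //.
  have -> : Ex mu (fun x => ((u x)%:R - p) ^+ 2) = p - p ^+ 2.
    transitivity (Ex mu (fun x => (1 - 2 * p) * (u x)%:R + p ^+ 2)).
      by apply: Ex_ext => x; case: (u x) => /=; ring.
    by rewrite ExD//; [rewrite ExZ// Ex_cst// -/p; ring|exact: bmfZ|exact: bmf_cst].
  by rewrite gerBl sqr_ge0.
pose P1 (t : n.-tuple T) := m ^+ 2 / 4 <= ((degS u t)%:R - m) ^+ 2.
(* If the degree is at least m/2, the binomial is at least m^2/16. An error eps of the ratio, of
   which at most eps/2 is the bias q - w, then forces |psum a| >= eps m^2 / 32; this is the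
   square. *)
pose P2 (t : n.-tuple T) := eps ^+ 2 * m ^+ 4 / 1024 <= psum a t ^+ 2.
have mP1 : measurable_fun setT P1 by have [mm _] := bNm; rewrite /P1; meas.
have mP2 : measurable_fun setT P2 by have [mm _] := bS; rewrite /P2; meas.
have bad (t : n.-tuple T) : eps <= `|WS R u e t - w| -> P1 t || P2 t.
  move=> h; have [hN|hN] := ltP ((degS u t)%:R : R) (m / 2).
    apply/orP; left; rewrite /P1; set N := (degS u t)%:R in hN *.
    rewrite -subr_ge0 (_ : _ - _ = (m / 2 - N) * (3 / 2 * m - N)); last by field.
    by apply: mulr_ge0; lra.
  apply/orP; right; have N2 : (2 <= degS u t)%N by rewrite -(ler_nat R); lra.
  move: h; rewrite /WS N2 /P2 SE; set N := degS u t in hN N2 *.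
  set C : R := 'C(N, 2)%:R => h.
  have CE : C = ((N%:R : R) ^+ 2 - N%:R) / 2 by exact: binR.
  have N2R : 2 <= N%:R :> R by rewrite (ler_nat R 2).
  have C1 : m ^+ 2 / 16 <= C.
    apply: (@le_trans _ _ ((N%:R : R) ^+ 2 / 4)).
      rewrite -subr_ge0 (_ : _ - _ = (N%:R - m / 2) * (N%:R + m / 2) / 4); last by field.
      by rewrite divr_ge0// mulr_ge0//; lra.
    rewrite CE -subr_ge0 (_ : _ - _ = N%:R * (N%:R - 2) / 4); last by field.
    by rewrite divr_ge0// mulr_ge0//; lra.
  have C0 : 0 < C by apply: lt_le_trans C1; rewrite divr_gt0// exprn_gt0.
  have h2 : eps / 2 * C <= `|triS R u e t - q * C|.
    have -> : triS R u e t - q * C = (triS R u e t / C - w - (q - w)) * C by field; rewrite gt_eqF.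
    rewrite normrM (gtr0_norm C0) (ler_wpM2r (ltW C0))//.
    by have := ler_normD (triS R u e t / C - w - (q - w)) (q - w); rewrite subrK; lra.
  have h3 : eps * m ^+ 2 / 32 <= `|triS R u e t - q * C|.
    apply: le_trans h2; rewrite -subr_ge0 (_ : _ - _ = eps / 2 * (C - m ^+ 2 / 16)); last by field.
    by rewrite mulr_ge0// ?subr_ge0// divr_ge0// ltW.
  rewrite -[leRHS]real_normK ?num_real//.
  have -> : eps ^+ 2 * m ^+ 4 / 1024 = (eps * m ^+ 2 / 32) ^+ 2 by field.
  have e3 : 0 <= eps * m ^+ 2 / 32 by apply: divr_ge0 => //; apply: mulr_ge0; [exact: ltW|exact: sqr_ge0].
  by rewrite ler_pXn2r// nnegrE.
have mbad : measurable [set t : n.-tuple T | eps <= `|WS R u e t - w|].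
  apply: measurable_pred; apply: measf_ler; first exact: measurable_cst.
  apply: measf_norm; apply: measfB; last exact: measurable_cst.
  exact: measurable_WS.
apply: (@le_trans _ _ (pw mu n ([set t | P1 t] `|` [set t | P2 t]))).
  apply: le_measure; rewrite ?inE//; first by apply: measurableU; exact: measurable_pred.
  by move=> t /= /bad /orP.
apply: (le_trans (measureU2 _ (measurable_pred mP1) (measurable_pred mP2))).
have m40 : 0 < m ^+ 2 / 4 by rewrite divr_gt0// exprn_gt0.
have c0 : 0 < 1024 :> R by rewrite ltr0n.
have em0 : 0 < eps ^+ 2 * m ^+ 4 / 1024.
  by apply: divr_gt0; [apply: mulr_gt0; exact: exprn_gt0|exact: c0].
have k1 := markov_Ex pT bNm mP1 m40 (fun t => sqr_ge0 _) (fun t h => h).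
have k2 := markov_Ex pT (bmfX2 bS) mP2 em0 (fun t => sqr_ge0 _) (fun t h => h).
apply: (le_trans (leeD k1 k2)); rewrite -EFinD lee_fin mulrDl.
have K0 : 0 < K by apply: lt_le_trans K4.
have mK : m^-1 <= K^-1 by rewrite lef_pV2// posrE.
apply: lerD.
  apply: (@le_trans _ _ (m / (m ^+ 2 / 4))).
    by apply: ler_wpM2r => //; rewrite invr_ge0 ltW.
  have -> : m / (m ^+ 2 / 4) = 4 * m^-1 by field; rewrite gt_eqF.
  by rewrite ler_wpM2l.
apply: (@le_trans _ _ ((m ^+ 2 + m ^+ 3) / (eps ^+ 2 * m ^+ 4 / 1024))).
  apply: ler_wpM2r; first by rewrite invr_ge0 ltW.
  by apply: (le_trans ES); rewrite /m !exprMn.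
have -> : (m ^+ 2 + m ^+ 3) / (eps ^+ 2 * m ^+ 4 / 1024) = 1024 / eps ^+ 2 * (m^-1 ^+ 2 + m^-1).
  by field; rewrite !gt_eqF.
have -> : 2048 / eps ^+ 2 / K = 1024 / eps ^+ 2 * (K^-1 + K^-1) by field; rewrite !gt_eqF.
apply: ler_wpM2l; first by apply: divr_ge0; [exact: ltW|exact: sqr_ge0].
have mi0 : 0 <= m^-1 by rewrite invr_ge0 ltW.
have mi1 : m^-1 <= 1.
  by rewrite invr_le1 ?unitfE ?gt_eqF// (le_trans _ m4)// (ler_nat R 1 4).
apply: lerD => //; apply: le_trans mK.
by rewrite expr2 -[leRHS]mulr1; apply: ler_wpM2l.
Qed.

End conditional_bound.

(** * Rescaling around a position of small oscillation *)

Lemma ratio_close (R : realFieldType) (c v eta w a k : R) :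
  0 < c -> 0 < v -> 0 < eta -> eta <= 1 / 2 -> 0 <= w -> w <= 1 ->
  a <= (1 + eta) * c * v -> (1 - eta) * c * v <= a ->
  k <= c ^+ 2 * (w * v ^+ 2) + 3 * eta * c ^+ 2 * v ^+ 2 ->
  c ^+ 2 * (w * v ^+ 2) <= k + 3 * eta * c ^+ 2 * v ^+ 2 ->
  `|k - w * a ^+ 2| <= 24 * eta * a ^+ 2.
Proof.
move=> c0 v0 e0 e1 w0 w1 al ag kl kg.
have s0 : 0 < c * v by exact: mulr_gt0.
rewrite -!mulrA in al ag.
have -> : 24 * eta * a ^+ 2 = 24 * (eta * a ^+ 2) by ring.
have {}kl : k - w * (c * v) ^+ 2 <= 3 * (eta * (c * v) ^+ 2).
  by rewrite lerBlDl; apply: (le_trans kl); rewrite le_eqVlt; apply/orP; left; apply/eqP; ring.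
have {}kg : w * (c * v) ^+ 2 - k <= 3 * (eta * (c * v) ^+ 2).
  rewrite lerBlDl; apply: le_trans (le_trans kg _); rewrite le_eqVlt; apply/orP; left; apply/eqP; ring.
move: (c * v) s0 al ag kl kg => s s0 al ag kl kg.
have a0 : 0 < a by apply: lt_le_trans ag; apply: mulr_gt0 => //; lra.
have a2s : a ^+ 2 - s ^+ 2 <= 3 * (eta * s ^+ 2).
  apply: (@le_trans _ _ (((1 + eta) * s) ^+ 2 - s ^+ 2)).
    by rewrite lerD2r ler_pXn2r// nnegrE ltW// mulr_gt0//; lra.
  rewrite -subr_ge0 (_ : _ - _ = eta * (1 - eta) * s ^+ 2); last by ring.
  by rewrite !mulr_ge0 ?sqr_ge0//; lra.
have sa2 : s ^+ 2 - a ^+ 2 <= 3 * (eta * s ^+ 2).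
  apply: (@le_trans _ _ (s ^+ 2 - ((1 - eta) * s) ^+ 2)).
    by rewrite lerD2l lerN2 ler_pXn2r// nnegrE ltW// mulr_gt0//; lra.
  rewrite -subr_ge0 (_ : _ - _ = eta * (1 + eta) * s ^+ 2); last by ring.
  by rewrite !mulr_ge0 ?sqr_ge0//; lra.
have s4 : s ^+ 2 <= 4 * a ^+ 2.
  have -> : 4 * a ^+ 2 = (2 * a) ^+ 2 by ring.
  have h : (1 / 2) * s <= (1 - eta) * s by apply: ler_wpM2r; lra.
  by rewrite ler_pXn2r// ?nnegrE; lra.
have D4 : eta * s ^+ 2 <= 4 * (eta * a ^+ 2).
  have -> : 4 * (eta * a ^+ 2) = eta * (4 * a ^+ 2) by ring.
  by apply: ler_wpM2l => //; exact: ltW.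
have D0 : 0 <= eta * s ^+ 2 by rewrite mulr_ge0 ?sqr_ge0// ltW.
have wle (z : R) : z <= 3 * (eta * s ^+ 2) -> w * z <= 3 * (eta * s ^+ 2).
  move=> hz; have [z0|z0] := leP 0 z.
    by apply: le_trans hz; rewrite -[leRHS]mul1r; apply: ler_wpM2r.
  by apply: (@le_trans _ _ 0); [apply: mulr_ge0_le0 => //; exact: ltW|lra].
have h1 := wle _ a2s; have h2 := wle _ sa2.
rewrite !mulrBr in h1 h2.
(* With s = c v, both |k - w s^2| and w |s^2 - a^2| are at most 3 eta s^2, and s <= 2 a gives s^2 <=
   4 a^2: the constant is (3 + 3) * 4 = 24. *)
by rewrite ler_norml; apply/andP; split; lra.
Qed.

Section good_points.
Variables (R : realType) (d : nat) (f : d.-tuple R -> R).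
Hypotheses (f0 : forall x, 0 <= f x) (mf : measurable_fun setT f).
Variable mu : {sigma_finite_measure set (d.-tuple R) -> \bar R}.
Hypothesis mu1 : mu setT = 1%E.
Hypothesis muE : forall A, measurable A -> (mu A = \int[lam d]_x (f x * \1_A x)%:E)%E.

Local Open Scope ereal_scope.

Lemma Ex_mu_bool (p : d.-tuple R -> bool) : measurable_fun setT p ->
  (Ex mu (fun y => (p y)%:R))%:E = \int[lam d]_y (f y * (p y)%:R)%:E.
Proof.
move=> mp; rewrite -ExE//; last exact: bmf_bool.
rewrite integral_pred//; apply: (etrans (muE (measurable_pred mp))).
by apply: eq_integral => y _; rewrite indic_pred.
Qed.

(** The density is inserted one variable at a time, with an exchange of integrals in between because
    [muE] rewrites the outer measure only once the inner integral is out of the way. *)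
Lemma Ex_mu_bool2 (b : d.-tuple R -> d.-tuple R -> bool) :
  measurable_fun setT (fun p : d.-tuple R * d.-tuple R => b p.1 p.2) ->
  (Ex mu (fun y => Ex mu (fun z => (b y z)%:R)))%:E =
  \int[lam d]_z \int[lam d]_y (f y * f z * (b y z)%:R)%:E.
Proof.
move=> mb.
have bb : bmf (fun p : d.-tuple R * d.-tuple R => (b p.1 p.2)%:R : R) by exact: bmf_bool.
have mb1 y : measurable_fun setT (fun z => b y z).
  by apply: (@measurableT_comp _ _ _ _ _ _ (fun p : d.-tuple R * d.-tuple R => b p.1 p.2) setT (fun z => (y, z))) => //; meas.
have mb2 z : measurable_fun setT (fun y => b y z).
  by apply: (@measurableT_comp _ _ _ _ _ _ (fun p : d.-tuple R * d.-tuple R => b p.1 p.2) setT (fun y => (y, z))) => //; meas.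
rewrite -ExE//; last exact: (bmf_Ex (F := fun p : d.-tuple R * d.-tuple R => (b p.1 p.2)%:R) mu1 bb).
transitivity (\int[mu]_y \int[lam d]_z (f z * (b y z)%:R)%:E).
  by apply: eq_integral => y _; rewrite Ex_mu_bool.
rewrite (fubini_tonelli (fun p : d.-tuple R * d.-tuple R => (f p.2 * (b p.1 p.2)%:R)%:E)) /=.
- apply: eq_integral => z _.
  transitivity ((f z)%:E * \int[mu]_y ((b y z)%:R : R)%:E).
    by rewrite -int_scale ?lee_fin//; apply: measfE; exact: measf_natr.
  rewrite ExE ?Ex_mu_bool//; last exact: bmf_bool.
  rewrite -int_scale ?lee_fin//.
  + by apply: eq_integral => y _; rewrite -EFinM mulrA [(f z * _)%R]mulrC.
  + by apply: measfE; apply: measfM => //; exact: measf_natr.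
  + by move=> y; rewrite lee_fin mulr_ge0.
- by apply: measfE; apply: measfM; [meas|exact: measf_natr].
- by move=> p; rewrite lee_fin mulr_ge0.
Qed.

Variables (x : d.-tuple R) (r eta : R).
Hypotheses (r0 : (0 < r)%R) (eta0 : (0 < eta)%R) (eta1 : (eta <= 1 / 2)%R) (fx0 : (0 < f x)%R).

Let F (y : d.-tuple R) : R := f (vlin 1 r x y).
Let B (y : d.-tuple R) : R := (nrm y <= 1)%R%:R.
Let c := f x.
Let v := vol R d.

Hypothesis hx : \int[lam d]_z (B z * `|F z - c|)%:E <= (eta * c * v)%:E.

Let mF : measurable_fun setT F.
Proof. by rewrite /F; apply: (@measurableT_comp _ _ _ _ _ _ f setT (vlin 1 r x)) => //; meas. Qed.

Let mB : measurable_fun setT B.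
Proof. by rewrite /B; meas. Qed.

Let F0 y : (0 <= F y)%R. Proof. exact: f0. Qed.
Let B0 y : (0 <= B y)%R. Proof. by rewrite /B. Qed.
Let v0 : (0 < v)%R. Proof. exact: vol_gt0. Qed.

Let H := \int[lam d]_z (B z * `|F z - c|)%:E.
Let A := \int[lam d]_z (B z * F z)%:E.

Let mH : measurable_fun setT (fun z => (B z * `|F z - c|)%:E).
Proof. by meas. Qed.
Let mA : measurable_fun setT (fun z => (B z * F z)%:E).
Proof. by meas. Qed.

Let intB (k : R) : (0 <= k)%R -> \int[lam d]_z (B z * k)%:E = (k * v)%:E.
Proof.
move=> k0; rewrite mulrC EFinM -integral_unit_ball -int_scaler ?lee_fin//.
by meas.
Qed.

Let A_le : A <= ((1 + eta) * c * v)%:E.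
Proof.
apply: (@le_trans _ _ (\int[lam d]_z ((B z * c)%:E + (B z * `|F z - c|)%:E))).
  apply: int_le => //; first by apply: measfED => //; meas.
    by move=> z; rewrite lee_fin mulr_ge0.
  move=> z; rewrite -EFinD lee_fin -mulrDr ler_wpM2l// -lerBlDl.
  exact: ler_norm.
have c0 : (0 <= c)%R by exact: ltW.
rewrite int_add//; [|by meas|by move=> z; rewrite lee_fin mulr_ge0..].
rewrite intB// (le_trans (leeD (le_refl _) hx))// -EFinD lee_fin.
by rewrite !mulrDl mul1r.
Qed.

Let A_ge : ((1 - eta) * c * v)%:E <= A.
Proof.
have c0 : (0 <= c)%R by exact: ltW.
have : (c * v)%:E <= A + H.
  rewrite -intB// -int_add//; [|by move=> z; rewrite lee_fin mulr_ge0..].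
  apply: int_le => //; [by meas|by apply: measfED|by move=> z; rewrite lee_fin mulr_ge0|].
  move=> z; rewrite -EFinD lee_fin -mulrDr ler_wpM2l// -lerBlDl.
  by rewrite distrC; exact: ler_norm.
move=> /le_trans/(_ (leeD (le_refl A) hx)).
have A0 : 0 <= A by apply: integral_ge0 => z _; rewrite lee_fin mulr_ge0.
by case: A A_le A0 => [a| |] //= _ _; rewrite -EFinD !lee_fin; lra.
Qed.

Let b (y z : d.-tuple R) : R := ((nrm y <= 1) && (nrm z <= 1) && (eucl_dist y z <= 1))%R%:R.
Let b_le y z : (b y z <= B y * B z)%R.
Proof. by rewrite /b /B -natrM mulnb ler_nat; case: (nrm y <= 1)%R; case: (nrm z <= 1)%R; case: (eucl_dist y z <= 1)%R. Qed.
Let b0 y z : (0 <= b y z)%R. Proof. by rewrite /b. Qed.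

Let Q := \int[lam d]_z \int[lam d]_y (F y * F z * b y z)%:E.
Let V := \int[lam d]_z \int[lam d]_y (b y z)%:E.

(** Bounds |F y F z - c^2| on pairs of points of the ball, from F y F z - c^2 = (F y - c) F z + c (F
    z - c). Its double integral factors as A H + c v H. *)
Let errfun (y z : d.-tuple R) : R :=
  (B y * B z * (`|F y - c| * F z + c * `|F z - c|))%R.

Let errfun_ge0 y z : (0 <= errfun y z)%R.
Proof. by rewrite /errfun !(mulr_ge0, addr_ge0)// ltW. Qed.

(** The constant 3 bounds (1 + eta) + 1, from A <= (1 + eta) c v and H <= eta c v. *)
Let err_le : \int[lam d]_z \int[lam d]_y (errfun y z)%:E <= (3 * eta * c ^+ 2 * v ^+ 2)%:E.
Proof.
have c0 : (0 <= c)%R by exact: ltW.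
have A0 : 0 <= A by apply: integral_ge0 => z _; rewrite lee_fin mulr_ge0.
have H0 : 0 <= H by apply: integral_ge0 => z _; rewrite lee_fin mulr_ge0.
have k0 : (0 <= c * v)%R by rewrite mulr_ge0// ltW.
have -> : \int[lam d]_z \int[lam d]_y (errfun y z)%:E = A * H + (c * v)%:E * H.
  transitivity (\int[lam d]_z ((B z * F z)%:E * H + (c * v)%:E * (B z * `|F z - c|)%:E)).
    apply: eq_integral => z _.
    transitivity (\int[lam d]_y ((B z * F z)%:E * (B y * `|F y - c|)%:E +
        (B y * (c * (B z * `|F z - c|)))%:E)).
      apply: eq_integral => y _; rewrite -EFinM -EFinD /errfun; congr EFin; ring.
    have e0 : (0 <= c * (B z * `|F z - c|))%R by rewrite !mulr_ge0.
    rewrite int_add//; first last.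
    - by move=> y; rewrite lee_fin mulr_ge0.
    - by move=> y; rewrite mule_ge0// lee_fin mulr_ge0.
    - by meas.
    - by meas.
    rewrite int_scale//; [|by rewrite lee_fin mulr_ge0|by move=> y; rewrite lee_fin mulr_ge0].
    by rewrite intB//; congr (_ + _); rewrite -EFinM; congr EFin; ring.
  rewrite int_add//; first last.
  - by move=> z; rewrite mule_ge0// lee_fin mulr_ge0.
  - by move=> z; rewrite mule_ge0// lee_fin mulr_ge0.
  - by meas.
  - by meas.
  rewrite int_scaler//; last by move=> z; rewrite lee_fin mulr_ge0.
  by rewrite int_scale ?lee_fin// => z; rewrite lee_fin mulr_ge0.
apply: (@le_trans _ _ (((1 + eta) * c * v)%:E * (eta * c * v)%:E + (c * v)%:E * (eta * c * v)%:E)).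
  by apply: leeD; apply: lee_pmul => //; rewrite ?lee_fin.
rewrite -!EFinM -EFinD lee_fin -subr_ge0.
rewrite (_ : _ - _ = eta * (1 - eta) * (c ^+ 2 * v ^+ 2))%R; last by ring.
apply: mulr_ge0; last by rewrite mulr_ge0 ?sqr_ge0.
apply: mulr_ge0; [exact: ltW|rewrite subr_ge0].
by apply: (le_trans eta1); rewrite ler_pdivrMr// mul1r (ler_nat R 1 2).
Qed.

Let mF1 : measurable_fun setT (fun p : d.-tuple R * d.-tuple R => F p.1).
Proof. by apply: (@measurableT_comp _ _ _ _ _ _ F setT fst) => //; meas. Qed.
Let mF2 : measurable_fun setT (fun p : d.-tuple R * d.-tuple R => F p.2).
Proof. by apply: (@measurableT_comp _ _ _ _ _ _ F setT snd) => //; meas. Qed.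

Let mb_ : measurable_fun setT (fun p : d.-tuple R * d.-tuple R => b p.2 p.1).
Proof. by rewrite /b; meas. Qed.
Let mby z : measurable_fun setT (fun y => b y z).
Proof. by rewrite /b; meas. Qed.
Let merr : measurable_fun setT (fun p : d.-tuple R * d.-tuple R => errfun p.2 p.1).
Proof. by rewrite /errfun /B; meas. Qed.
Let merry z : measurable_fun setT (fun y => errfun y z).
Proof. by rewrite /errfun; meas. Qed.

Let mFFb : measurable_fun setT (fun p : d.-tuple R * d.-tuple R => F p.2 * F p.1 * b p.2 p.1)%R.
Proof. by apply: measfM => //; apply: measfM. Qed.

Let Q_le : Q <= (c ^+ 2)%:E * V + (3 * eta * c ^+ 2 * v ^+ 2)%:E.
Proof.
have c0 : (0 <= c)%R by exact: ltW.
apply: (@le_trans _ _ ((c ^+ 2)%:E * V + \int[lam d]_z \int[lam d]_y (errfun y z)%:E)); last exact: leeD.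
have mV : measurable_fun setT (fun z => \int[lam d]_y (b y z)%:E).
  by apply: measf_int2 => //; [exact: measfE|move=> *; rewrite lee_fin].
have mE : measurable_fun setT (fun z => \int[lam d]_y (errfun y z)%:E).
  by apply: measf_int2 => //; [exact: measfE|move=> *; rewrite lee_fin].
have V0 z : 0 <= \int[lam d]_y (b y z)%:E by apply: integral_ge0 => y _; rewrite lee_fin.
have E0 z : 0 <= \int[lam d]_y (errfun y z)%:E by apply: integral_ge0 => y _; rewrite lee_fin.
rewrite /V -int_scale ?lee_fin ?sqr_ge0//.
rewrite -int_add//; [|by meas|by move=> z; rewrite mule_ge0// lee_fin sqr_ge0].
apply: int_le => //.
- by apply: measf_int2 => //; [exact: measfE|move=> *; rewrite lee_fin !mulr_ge0].
- by apply: measfED => //; meas.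
- by move=> z; apply: integral_ge0 => y _; rewrite lee_fin !mulr_ge0.
move=> z; rewrite -int_scale ?lee_fin ?sqr_ge0//; [|exact: measfE|by move=> y; rewrite lee_fin].
have cb0 y : 0 <= (c ^+ 2)%:E * (b y z)%:E by rewrite mule_ge0 ?lee_fin ?sqr_ge0.
have er0 y : 0 <= (errfun y z)%:E by rewrite lee_fin.
have mcb : measurable_fun setT (fun y => (c ^+ 2)%:E * (b y z)%:E).
  by apply: measfEM => //; exact: measfE.
rewrite -int_add//; last exact: measfE.
apply: int_le => //.
- by meas.
- by apply: measfED; [apply: measfEM => //; exact: measfE|exact: measfE].
- by move=> y; rewrite lee_fin !mulr_ge0.
move=> y; rewrite -EFinM -EFinD lee_fin.
have h1 := ler_norm (F y - c); have h2 := ler_norm (F z - c).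
have step : (F y * F z <= c ^+ 2 + (`|F y - c| * F z + c * `|F z - c|))%R.
  rewrite (_ : F y * F z = c ^+ 2 + ((F y - c) * F z + c * (F z - c)))%R; last by ring.
  by rewrite lerD2l lerD// ?ler_wpM2r// ler_wpM2l.
apply: (le_trans (ler_wpM2r (b0 y z) step)); rewrite mulrDl lerD2l /errfun mulrC.
by apply: ler_wpM2r => //; rewrite addr_ge0// mulr_ge0.
Qed.

Let Q_ge : (c ^+ 2)%:E * V <= Q + (3 * eta * c ^+ 2 * v ^+ 2)%:E.
Proof.
have c0 : (0 <= c)%R by exact: ltW.
apply: (@le_trans _ _ (Q + \int[lam d]_z \int[lam d]_y (errfun y z)%:E)); last exact: leeD.
have mV : measurable_fun setT (fun z => \int[lam d]_y (b y z)%:E).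
  by apply: measf_int2 => //; [exact: measfE|move=> *; rewrite lee_fin].
have mQ : measurable_fun setT (fun z => \int[lam d]_y (F y * F z * b y z)%:E).
  by apply: measf_int2 => //; [exact: measfE|move=> *; rewrite lee_fin !mulr_ge0].
have mE : measurable_fun setT (fun z => \int[lam d]_y (errfun y z)%:E).
  by apply: measf_int2 => //; [exact: measfE|move=> *; rewrite lee_fin].
have V0 z : 0 <= \int[lam d]_y (b y z)%:E by apply: integral_ge0 => y _; rewrite lee_fin.
have E0 z : 0 <= \int[lam d]_y (errfun y z)%:E by apply: integral_ge0 => y _; rewrite lee_fin.
have Q0 z : 0 <= \int[lam d]_y (F y * F z * b y z)%:E.
  by apply: integral_ge0 => y _; rewrite lee_fin !mulr_ge0.
rewrite /V -int_scale ?lee_fin ?sqr_ge0//.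
rewrite -int_add//.
apply: int_le => //.
- by meas.
- by apply: measfED.
- by move=> z; rewrite mule_ge0// lee_fin sqr_ge0.
move=> z; rewrite -int_scale ?lee_fin ?sqr_ge0//; [|exact: measfE|by move=> y; rewrite lee_fin].
have q0 y : 0 <= (F y * F z * b y z)%:E by rewrite lee_fin !mulr_ge0.
have er0 y : 0 <= (errfun y z)%:E by rewrite lee_fin.
have mQy : measurable_fun setT (fun y => (F y * F z * b y z)%:E).
  by apply: measfE; apply: measfM => //; apply: measfM.
have mEy : measurable_fun setT (fun y => (errfun y z)%:E) by exact: measfE.
rewrite -int_add//.
apply: int_le => //.
- by apply: measfEM => //; exact: measfE.
- by apply: measfED; [meas|exact: measfE].
- by move=> y; rewrite mule_ge0 ?lee_fin ?sqr_ge0.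
move=> y; rewrite -EFinM -EFinD lee_fin.
have h1 := ler_norm (- (F y - c)); have h2 := ler_norm (- (F z - c)).
rewrite !normrN in h1 h2.
have step : (c ^+ 2 <= F y * F z + (`|F y - c| * F z + c * `|F z - c|))%R.
  rewrite (_ : c ^+ 2 = F y * F z + (- (F y - c) * F z + c * - (F z - c)))%R; last by ring.
  by rewrite lerD2l lerD// ?ler_wpM2r// ler_wpM2l.
apply: (le_trans (ler_wpM2r (b0 y z) step)); rewrite mulrDl lerD2l /errfun mulrC.
by apply: ler_wpM2r => //; rewrite addr_ge0// mulr_ge0.
Qed.

Let u (y : d.-tuple R) := (eucl_dist x y <= r)%R.
Let e (y z : d.-tuple R) := (eucl_dist y z <= r)%R.

Let uE y : u (vlin 1 r x y) = (nrm y <= 1)%R.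
Proof.
rewrite /u eucl_distE (_ : vlin 1 (-1) _ _ = vlin (-1) 0 (vlin r 0 y y) (vlin r 0 y y)).
  by rewrite nrmN (nrm_scale _ (ltW r0)) -{2}(mulr1 r) ler_pM2l.
by apply: eq_from_tnth => i; rewrite !tnth_mktuple; ring.
Qed.

Let eE y z : e (vlin 1 r x y) (vlin 1 r x z) = (eucl_dist y z <= 1)%R.
Proof.
rewrite /e !eucl_distE (_ : vlin 1 (-1) _ _ = vlin r 0 (vlin 1 (-1) y z) (vlin 1 (-1) y z)).
  by rewrite (nrm_scale _ (ltW r0)) -{2}(mulr1 r) ler_pM2l.
by apply: eq_from_tnth => i; rewrite !tnth_mktuple; ring.
Qed.

Let rd0 : (0 < r ^+ d)%R. Proof. exact: exprn_gt0. Qed.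

Let unscale (g : d.-tuple R -> \bar R) : measurable_fun setT g -> (forall y, 0 <= g y) ->
  \int[lam d]_y g y = (r ^+ d)%:E * \int[lam d]_y g (vlin 1 r x y).
Proof.
move=> mg g0; rewrite (ge0_integral_lam_aff x r0)// muleA -EFinM -exprMn.
by rewrite mulfV ?gt_eqF// expr1n mul1e.
Qed.

Let mu_u : measurable_fun setT u. Proof. by rewrite /u; meas. Qed.

Let p := Ex mu (fun y => (u y)%:R).

(** Substituting x + r y for the integration variable turns the ball of radius r around x into the
    unit ball. *)
Lemma p_scaled : p%:E = (r ^+ d)%:E * A.
Proof.
rewrite Ex_mu_bool// unscale; [|by meas|by move=> y; rewrite lee_fin mulr_ge0].
by congr (_ * _); apply: eq_integral => y _; rewrite uE mulrC.
Qed.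

Let q_ := Ex mu (fun y => Ex mu (fun z => [&& u y, u z & e y z]%:R)).

Let mb3 : measurable_fun setT (fun w : d.-tuple R * d.-tuple R => [&& u w.1, u w.2 & e w.1 w.2]).
Proof. by rewrite /u /e; meas. Qed.

Lemma q_scaled : q_%:E = ((r ^+ d) ^+ 2)%:E * Q.
Proof.
rewrite Ex_mu_bool2// unscale.
- rewrite expr2 EFinM -muleA; congr (_ * _).
  have -> : (r ^+ d)%:E * Q = \int[lam d]_z ((r ^+ d)%:E * \int[lam d]_y (F y * F z * b y z)%:E).
    rewrite /Q -int_scale ?lee_fin//; first exact: ltW.
      by apply: measf_int2 => //; [exact: measfE|move=> *; rewrite lee_fin !mulr_ge0].
    by move=> z; apply: integral_ge0 => y _; rewrite lee_fin !mulr_ge0.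
  apply: eq_integral => z _; rewrite unscale.
  + congr (_ * _); apply: eq_integral => y _; rewrite !uE eE /b andbA.
    by [].
  + by rewrite /u /e; meas.
  + by move=> y; rewrite lee_fin !mulr_ge0.
- apply: measf_int2 => //; last by move=> *; rewrite lee_fin !mulr_ge0.
  by rewrite /u /e; meas.
- by move=> z; apply: integral_ge0 => y _; rewrite lee_fin !mulr_ge0.
Qed.

Let V_le : V <= (v * v)%:E.
Proof.
apply: (@le_trans _ _ (\int[lam d]_z \int[lam d]_y (B y * B z)%:E)).
  apply: int_le => //.
  - by apply: measf_int2 => //; [exact: measfE|move=> *; rewrite lee_fin].
  - by apply: measf_int2 => //; [rewrite /B; meas|move=> *; rewrite lee_fin mulr_ge0].
  - by move=> z; apply: integral_ge0 => y _; rewrite lee_fin.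
  move=> z; apply: int_le => //; [exact: measfE|by meas|by move=> y; rewrite lee_fin|by move=> y; rewrite lee_fin].
rewrite (eq_integral (fun z => (B z * v)%:E)) => [|z _]; last by rewrite intB.
by rewrite intB// ltW.
Qed.

Let V_ge0 : 0 <= V.
Proof. by apply: integral_ge0 => z _; apply: integral_ge0 => y _; rewrite lee_fin. Qed.

Lemma Vset_swap : V = (Vset R d)%:E.
Proof.
have Vfin : V \is a fin_num by rewrite ge0_fin_numE// (le_lt_trans V_le)// ltry.
have E : V = \int[lam d]_y \int[lam d]_z (b y z)%:E.
  have m0 : measurable_fun setT (fun w : d.-tuple R * d.-tuple R => (b w.2 w.1)%:E) by exact: measfE.
  have n0 (w : d.-tuple R * d.-tuple R) : 0 <= (b w.2 w.1)%:E by rewrite lee_fin.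
  exact: (fubini_tonelli _ m0 n0).
transitivity (fine V)%:E; first exact: (esym (fineK Vfin)).
exact: (congr1 (fun t => (fine t)%:E) E).
Qed.

(** The powers of r cancel in the ratio of the edge probability to p^2, which becomes Q / A^2. Up to
    the oscillation, Q is c^2 V and A is c v, and V / v^2 = w_d. *)
Lemma good_point : [/\ (c * v * r ^+ d / 2 <= p)%R &
  exists q : R, [/\ (0 <= q)%R, (q <= 1)%R, q_ = (q * p ^+ 2)%R &
    (`|q - @w_const R d| <= 24 * eta)%R]].
Proof.
have c0 : (0 < c)%R by [].
have A0 : 0 <= A by apply: integral_ge0 => z _; rewrite lee_fin mulr_ge0.
have [a aE] : exists a, A = a%:E.
  exists (fine A); rewrite fineK// ge0_fin_numE//; exact: le_lt_trans A_le (ltry _).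
have Q0 : 0 <= Q by apply: integral_ge0 => z _; apply: integral_ge0 => y _; rewrite lee_fin !mulr_ge0.
have Ql := Q_le; have Qg := Q_ge; rewrite Vset_swap -EFinM -EFinD in Ql Qg.
have [k kE] : exists k, Q = k%:E.
  exists (fine Q); rewrite fineK// ge0_fin_numE//; exact: le_lt_trans Ql (ltry _).
have Al := A_le; have Ag := A_ge; rewrite aE !lee_fin in Al Ag.
rewrite kE -EFinD !lee_fin in Ql Qg.
have pE : p = (r ^+ d * a)%R by apply: EFin_inj; rewrite p_scaled aE -EFinM.
have qE : q_ = ((r ^+ d) ^+ 2 * k)%R by apply: EFin_inj; rewrite q_scaled kE -EFinM.
have cv0 : (0 < c * v)%R by rewrite mulr_gt0.
have a2 : (c * v / 2 <= a)%R.
  apply: le_trans Ag; rewrite -subr_ge0.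
  rewrite (_ : _ - _ = (1 / 2 - eta) * (c * v))%R; last by field.
  by apply: mulr_ge0; [rewrite subr_ge0|exact: ltW].
have a_gt0 : (0 < a)%R by apply: lt_le_trans a2; rewrite divr_gt0.
have p_gt0 : (0 < p)%R by rewrite pE mulr_gt0.
split.
  rewrite pE (_ : c * v * r ^+ d / 2 = r ^+ d * (c * v / 2))%R; last by field.
  by apply: ler_wpM2l => //; exact: ltW.
have bq : bmf (fun w : d.-tuple R * d.-tuple R => [&& u w.1, u w.2 & e w.1 w.2]%:R : R) by exact: bmf_bool.
have buu : bmf (fun y => (u y)%:R : R) by exact: bmf_bool.
have q_le : (q_ <= p ^+ 2)%R.
  rewrite expr2 /q_ -[X in (_ <= X)%R]ExZ//; apply: Ex_le => //.
  - exact: (bmf_Ex (F := fun w : d.-tuple R * d.-tuple R => [&& u w.1, u w.2 & e w.1 w.2]%:R) mu1 bq).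
  - exact: bmfZ.
  move=> y; rewrite mulrC -ExZ//; apply: Ex_le => //.
  - exact: (bmf_section1 (F := fun w : d.-tuple R * d.-tuple R => [&& u w.1, u w.2 & e w.1 w.2]%:R) y bq).
  - exact: bmfZ.
  by move=> z; rewrite -natrM mulnb ler_nat andbA; case: (u y && u z) => //=; case: (e y z).
have q_ge : (0 <= q_)%R by apply: Ex_ge0 => y; apply: Ex_ge0 => z.
exists (q_ / p ^+ 2)%R; split.
- by rewrite divr_ge0// sqr_ge0.
- by rewrite ler_pdivrMr ?exprn_gt0// mul1r.
- by rewrite divfK// gt_eqF// exprn_gt0.
have -> : (q_ / p ^+ 2 = k / a ^+ 2)%R.
  by rewrite qE pE; field; rewrite !gt_eqF.
set w := @w_const R d.
have VE : Vset R d = (w * v ^+ 2)%R by rewrite /w w_constE divfK// gt_eqF// exprn_gt0.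
have Vg := V_ge0; have Vl := V_le; rewrite Vset_swap !lee_fin in Vg Vl.
rewrite VE in Ql Qg Vg Vl.
have w0 : (0 <= w)%R by move: Vg; rewrite pmulr_lge0// exprn_gt0.
have w1 : (w <= 1)%R.
  by move: Vl; rewrite -expr2 -{2}(mul1r (v ^+ 2)%R) ler_pM2r// exprn_gt0.
have a20 : (0 < a ^+ 2)%R by exact: exprn_gt0.
have -> : (k / a ^+ 2 - w = (k - w * a ^+ 2) / a ^+ 2)%R by field; rewrite gt_eqF.
rewrite normrM normfV (gtr0_norm a20) ler_pdivrMr//.
exact: (ratio_close c0 v0 eta0 eta1 w0 w1 Al Ag Ql Qg).
Qed.

End good_points.

Definition tupX (T V : Type) (X : nat -> T -> V) n (w : T) : n.-tuple V := [tuple X i w | i < n].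

(** * Convergence in probability *)

Section joint_law.
Context dT (T : measurableType dT) (R : realType) (P : probability T R).
Local Open Scope ereal_scope.

Lemma exists_law d1 (V : measurableType d1) (Y : T -> V) : measurable_fun setT Y ->
  exists mu : {sigma_finite_measure set V -> \bar R}, forall A, mu A = P (Y @^-1` A).
Proof.
move=> mY.
pose X : {mfun T >-> V} := HB.pack Y (isMeasurableFun.Build _ _ _ _ Y mY).
by exists (distribution P X).
Qed.

Variables (d : nat) (X : nat -> T -> d.-tuple R).
Variable mu : {sigma_finite_measure set (d.-tuple R) -> \bar R}.
Hypothesis mX : forall i, measurable_fun setT (X i).
Hypothesis lawX : forall i A, measurable A -> P (X i @^-1` A) = mu A.
Hypothesis indX : mutually_independent P X.

Lemma measurable_tupX n : measurable_fun setT (tupX X n).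
Proof.
apply/measurable_fun_tnthP => i; rewrite (_ : _ \o _ = X i)//.
by apply/funext => w /=; rewrite tnth_mktuple.
Qed.

(** Boxes are stable under intersection and generate the sigma-algebra; on a box, independence and
    [pw_rect] give the same product. *)
Lemma joint_law n A : measurable A -> P (tupX X n @^-1` A) = pw mu n A.
Proof.
move=> mA.
pose G : set (set (n.-tuple (d.-tuple R))) := [set B | exists2 C : nat -> set (d.-tuple R),
  (forall i, measurable (C i)) & B = rect n C].
have mt := @measurable_tupX n.
have pE B : pushm P mt B = P (tupX X n @^-1` B) by [].
rewrite -pE; move: A mA.
apply: (@measure_unique _ _ _ G (fun=> setT)).
- apply/seteqP; split => [B mB|].
    apply: mB; split; first exact: smallest_sigma_algebra.
    elim/big_ind: _ => //; first by move=> F1 F2 h1 h2; rewrite subUset; split.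
    move=> i _ C [D mD <-]; apply: sub_sigma_algebra; rewrite setTI.
    (* A coordinate cylinder is the box whose other sides are full, so the boxes generate. *)
    exists (fun j => if j == i :> nat then D else setT) => [j|]; first by case: ifP.
    apply/seteqP; split => t /= => [h j|/(_ i)]; last by rewrite eqxx.
    by case: ifP => // /eqP/val_inj ->.
  apply: smallest_sub; first exact: sigma_algebra_measurable.
  by move=> B [C mC ->]; exact: measurable_rect.
- move=> _ _ [C mC ->] [D mD ->]; exists (fun i => C i `&` D i); first by move=> i; exact: measurableI.
  by apply/seteqP; split => t /= => [[h1 h2] i|h]; [split|split=> i; case: (h i)].
- move=> _; exists (fun=> setT) => //.
  by apply/seteqP; split.
- by rewrite bigcup_const//; exists 0%N.
- move=> _ [C mC ->]; apply: (etrans _ (esym (pw_rect mu n mC))).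
  transitivity (\prod_(i < n) P (X i @^-1` C i)); last by apply: eq_bigr => i _; exact: lawX.
  rewrite pE -(big_mkord xpredT (fun i => P (X i @^-1` C i))).
  rewrite -(indX (I := index_iota 0 n)) ?iota_uniq//; congr (P _).
  rewrite big_mkord; apply/seteqP; split => w /=.
    by move=> h; elim/big_ind: _ => // i _; have := h i; rewrite tnth_mktuple.
  move=> h i; rewrite tnth_mktuple; move: h; rewrite (bigD1 i)//=; by case.
- move=> _; rewrite /pushm /= /pushforward preimage_setT.
  by rewrite (le_lt_trans (probability_le1 P _))// ltry.
Qed.
End joint_law.

(** * The statistic as a measurable function of the sample *)

Section graph_statistic.
Variables (R : realType) (d : nat).
Let V := d.-tuple R.

Lemma WS_map (T1 T2 : Type) (g : T1 -> T2) (u : T2 -> bool) (e : T2 -> T2 -> bool) s :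
  WS R u e (map g s) = WS R (fun x => u (g x)) (fun x y => e (g x) (g y)) s.
Proof.
rewrite /WS.
have -> : degS u (map g s) = degS (fun x => u (g x)) s by rewrite /degS big_map.
have -> // : triS R u e (map g s) = triS R (fun x => u (g x)) (fun x y => e (g x) (g y)) s.
by rewrite /triS; elim: s => //= x s ->; rewrite big_map.
Qed.

Definition WP (r : R) m (s : m.+1.-tuple V) : R :=
  WS R (fun y => eucl_dist (thead s) y <= r) (fun y z => eucl_dist y z <= r) (behead s).

(** In [WP] the neighbour predicate depends on the head of the sample, whereas [measurable_WS] takes
    fixed predicates. Replacing each point y by the pair (head, y) makes both predicates fixed, on
    pairs. *)
Lemma measurable_WP r m : measurable_fun setT (@WP r m).
Proof.
pose g (s : m.+1.-tuple V) : m.-tuple (V * V) :=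
  [tuple (tnth s ord0, tnth s (lift ord0 i)) | i < m].
have mg : measurable_fun setT g.
  apply/measurable_fun_tnthP => i.
  rewrite (_ : _ \o g = fun s => (tnth s ord0, tnth s (lift ord0 i))); last first.
    by apply/funext => s /=; rewrite tnth_mktuple.
  by apply: measurable_fun_pair; exact: measurable_tnth.
pose W (t : m.-tuple (V * V)) : R :=
  WS R (fun z => eucl_dist z.1 z.2 <= r) (fun y z => eucl_dist y.2 z.2 <= r) t.
have mW : measurable_fun setT W by apply: measurable_WS; meas.
rewrite (_ : @WP r m = W \o g); first exact: measurableT_comp.
apply/funext => s /=; rewrite /W /g /WP.
rewrite [in RHS]/= (@WS_map 'I_m).
have -> : behead s = map (fun i => tnth s (lift ord0 i)) (enum 'I_m).
  case/tupleP: s => x t; rewrite /= -[LHS]map_tnth_enum.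
  by apply: eq_map => i; rewrite tnthS.
by rewrite WS_map.
Qed.

Lemma psum_iota (a : V -> V -> R) (Y : nat -> V) b m :
  psum a (map Y (iota b m)) = \sum_(b <= j < b + m) \sum_(j.+1 <= k < b + m) a (Y j) (Y k).
Proof.
elim: m b => [|m IH] b; first by rewrite addn0 big_geq.
rewrite /= IH addSnnS big_ltn ?addnS ?ltnS ?leq_addr//; congr (_ + _).
by rewrite big_map /index_iota -addSn addKn.
Qed.

(** Vertex 0 is not adjacent to itself, so index 0 drops out of both sums and only the tail of the
    sample remains. *)
Lemma W4E (T : Type) (X : nat -> T -> V) m r w : W4 X m.+1 r w = WP r (tupX X m.+1 w).
Proof.
have sE : tupX X m.+1 w = [seq X i w | i <- iota 0 m.+1] :> seq V.
  by rewrite -(val_enum_ord m.+1) -map_comp.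
have hE : thead (tupX X m.+1 w) = X 0%N w by rewrite /thead tnth_mktuple.
rewrite /WP sE hE [behead _]/=.
set u := fun y => _; set e := fun y z => _.
have dE : deg0 X m.+1 r w = degS u [seq X i w | i <- iota 1 m].
  rewrite /deg0 big_ltn// /rgg_adj eqxx add0n /degS big_map /index_iota subn1.
  rewrite big_seq [RHS]big_seq; apply: eq_bigr => i; rewrite mem_iota => /andP[i1 _].
  by rewrite eq_sym -lt0n i1.
have tE : (tri0 X m.+1 r w)%:R = triS R u e [seq X i w | i <- iota 1 m].
  rewrite /tri0 /triS psum_iota natr_sum big_ltn//.
  rewrite big1 ?add0r => [|k _]; last by rewrite /rgg_adj eqxx.
  rewrite add1n big_nat [RHS]big_nat; apply: eq_bigr => j /andP[j1 _].
  rewrite natr_sum big_nat [RHS]big_nat; apply: eq_bigr => k /andP[jk _].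
  have k1 : (0 < k)%N by exact: leq_ltn_trans jk.
  by rewrite /rgg_adj !(eq_sym 0%N) -!lt0n j1 k1 ltn_eqF.
by rewrite /W4 /WS dE tE.
Qed.

End graph_statistic.

(** * Mass of the bad positions *)

Section bad_vertices.
Variables (R : realType) (d : nat) (f : d.-tuple R -> R).
Hypotheses (f0 : forall x, 0 <= f x) (mf : measurable_fun setT f).
Hypothesis f1 : (\int[lam d]_x (f x)%:E = 1)%E.
Variable mu : {sigma_finite_measure set (d.-tuple R) -> \bar R}.
Hypothesis mu1 : mu setT = 1%E.
Hypothesis muE : forall A, measurable A -> (mu A = \int[lam d]_x (f x * \1_A x)%:E)%E.

Let v := vol R d.
Let w := @w_const R d.

Definition osc (r : R) (x : d.-tuple R) : \bar R :=
  (\int[lam d]_z ((nrm z <= 1)%R%:R * `|f (vlin 1 r x z) - f x|)%:E)%E.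

Lemma osc_ge0 r x : (0 <= osc r x)%E.
Proof. by apply: integral_ge0 => z _; rewrite lee_fin mulr_ge0. Qed.

Lemma measurable_osc r : measurable_fun setT (osc r).
Proof.
apply: measf_int2 => [|x z]; last by rewrite lee_fin mulr_ge0.
have m1 : measurable_fun setT (fun p : d.-tuple R * d.-tuple R => f (vlin 1 r p.1 p.2)).
  by apply: (@measurableT_comp _ _ _ _ _ _ f setT (fun p : _ * _ => vlin 1 r p.1 p.2)) => //; meas.
have m2 : measurable_fun setT (fun p : d.-tuple R * d.-tuple R => f p.1).
  by apply: (@measurableT_comp _ _ _ _ _ _ f setT fst) => //; meas.
by meas.
Qed.

(** The threshold c does not depend on x. It will be eta kappa vol, which is at most eta f(x) vol,
    the bound that [good_point] needs, as soon as kappa <= f(x). *)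
Definition good (kappa c r : R) (x : d.-tuple R) : bool :=
  (kappa <= f x)%R && (osc r x <= c%:E)%E.

Lemma measurable_good kappa c r : measurable_fun setT (good kappa c r).
Proof.
apply: measf_and; first by meas.
apply: (measurable_fun_bool true).
by apply: measurable_lee => //; exact: measurable_osc.
Qed.

(** Integrate over the position of vertex 0: at a bad position the conditional probability is
    bounded by 1, at a good one [good_point] supplies the hypotheses of [inner_bound]. *)
Lemma WP_bound (eps kappa eta r K : R) m : 0 < eps -> 0 < kappa -> 0 < eta -> eta <= 1 / 2 ->
  24 * eta <= eps / 2 -> 0 < r -> 4 <= K -> K <= m%:R * (kappa * v * r ^+ d / 2) ->
  (pw mu m.+1 [set s | (eps <= `|WP r s - w|)%R] <=
   mu [set x | ~~ good kappa (eta * kappa * v) r x] + ((4 + 2048 / eps ^+ 2) / K)%:E)%E.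
Proof.
move=> eps0 k0 e0 e1 e2 r0 K4 Kn.
have v0 : 0 < v by exact: vol_gt0.
set C := (4 + 2048 / eps ^+ 2) / K.
have C0 : 0 <= C.
  have K0 : 0 < K by apply: lt_le_trans K4; rewrite ltr0n.
  by apply: divr_ge0; [apply: addr_ge0; [exact: ler0n|apply: divr_ge0; [exact: ler0n|exact: sqr_ge0]]|exact: ltW].
pose b (s : m.+1.-tuple (d.-tuple R)) := eps <= `|WP r s - w|.
have mb : measurable_fun setT b.
  by have mW := @measurable_WP R d r m; rewrite /b; meas.
have mg := measurable_good kappa (eta * kappa * v) r.
have mng := measurable_pred (measf_neg mg).
have -> : (pw mu m.+1 [set s | (eps <= `|WP r s - w|)%R] =
   \int[mu]_x \int[pw mu m]_t ((b (cons_tuple x t))%:R)%:E)%E.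
  rewrite -[LHS](integral_pred (pw mu m.+1) mb) ge0_integral_pwS//.
  by apply: measfE; exact: measf_natr.
have -> : (mu [set x | ~~ good kappa (eta * kappa * v) r x] + C%:E =
   \int[mu]_x ((~~ good kappa (eta * kappa * v) r x)%:R%:E + C%:E))%E.
  rewrite ge0_integralD//=; last by apply: measfE; exact: measf_natr (measf_neg mg).
  congr (_ + _)%E; first by rewrite integral_pred//; exact: measf_neg.
  by rewrite integral_cst//; exact: (esym (etrans (congr1 (fun z => C%:E * z)%E mu1) (mule1 _))).
have mbc x : measurable_fun setT (fun t => b (cons_tuple x t)).
  by apply: (measurableT_comp mb); exact: measurable_cons.
apply: int_le.
- apply: measf_int2 => //; apply: measfE; apply: measf_natr.
  by apply: (measurableT_comp mb); exact: measurable_consp.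
- by apply: measfED; [apply: measfE; exact: measf_natr (measf_neg mg)|exact: measurable_cst].
- by move=> x; apply: integral_ge0 => t _; rewrite lee_fin.
move=> x; rewrite integral_pred//.
case: (boolP (good kappa (eta * kappa * v) r x)) => [/andP[kf ho]|_] /=; last first.
  apply: (@le_trans _ _ (pw mu m setT)).
    by apply: le_measure; rewrite ?inE//; exact: measurable_pred.
  by rewrite (pw_setT mu1) -EFinD lee_fin lerDl.
rewrite add0e.
have fx0 : 0 < f x by exact: lt_le_trans kf.
have hx : (osc r x <= (eta * f x * vol R d)%:E)%E.
  apply: (le_trans ho); rewrite lee_fin; apply: ler_wpM2r; first exact: ltW.
  by apply: ler_wpM2l => //; exact: ltW.
have [pg [q [q0 q1 qE qw]]] := good_point f0 mf mu1 muE r0 e0 e1 fx0 hx.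
have bE : [set t : m.-tuple (d.-tuple R) | b (cons_tuple x t)] =
   [set t : m.-tuple (d.-tuple R) | eps <= `|WS R (fun y => eucl_dist x y <= r)
      (fun y z => eucl_dist y z <= r) t - w|].
  by apply/seteqP; split => t; rewrite /= /b /WP theadE.
rewrite bE; apply: (inner_bound mu1 _ _ eps0 K4 _ q0 q1 qE).
- by meas.
- by meas.
- apply: (le_trans Kn); apply: ler_wpM2l => //; apply: le_trans pg.
  apply: ler_wpM2r; first by rewrite invr_ge0.
  apply: ler_wpM2r; first by rewrite exprn_ge0// ltW.
  by apply: ler_wpM2r => //; exact: ltW.
- exact: le_trans qw e2.
Qed.

(** At a bad position f is below kappa, or above M, or else the oscillation exceeds c and f <= M <=
    (M / c) osc. *)
Lemma bad_mass (kappa M c r : R) : 0 < c -> 0 <= M ->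
  (mu [set x | ~~ good kappa c r x] <=
   \int[lam d]_x (f x * (f x < kappa)%R%:R)%:E + \int[lam d]_x (f x * (M < f x)%R%:R)%:E +
   (M / c)%:E * \int[lam d]_x osc r x)%E.
Proof.
move=> c0 M0.
have mg := measurable_good kappa c r.
have mo := measurable_osc r.
have Mc0 : 0 <= M / c by apply: divr_ge0 => //; exact: ltW.
rewrite (muE (measurable_pred (measf_neg mg))).
rewrite -int_scale//; last exact: osc_ge0.
have h1 x : (0 <= (f x * (f x < kappa)%R%:R)%:E)%E by rewrite lee_fin mulr_ge0.
have h2 x : (0 <= (f x * (M < f x)%R%:R)%:E)%E by rewrite lee_fin mulr_ge0.
have h3 x : (0 <= (M / c)%:E * osc r x)%E by rewrite mule_ge0// osc_ge0.
have m1 : measurable_fun setT (fun x => (f x * (f x < kappa)%R%:R)%:E) by meas.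
have m2 : measurable_fun setT (fun x => (f x * (M < f x)%R%:R)%:E) by meas.
have m3 : measurable_fun setT (fun x => (M / c)%:E * osc r x)%E by meas.
rewrite -int_add// -int_add//; [|by meas|by move=> x; rewrite adde_ge0].
apply: int_le.
- apply: measfE; apply: measfM => //; apply: measurable_indic.
  exact: measurable_pred (measf_neg mg).
- by apply: measfED => //; apply: measfED.
- by move=> x; rewrite lee_fin mulr_ge0.
move=> x; rewrite indic_pred /good negb_and -ltNge -ltNge.
have [lk|_] := ltP (f x) kappa.
  by rewrite /= mulr1 -addeA leeDl// adde_ge0.
rewrite /= mulr0 add0e.
have [co|_] := ltP c%:E (osc r x); last by rewrite mulr0 adde_ge0.
have [lM|lM] := ltP M (f x); first by rewrite /= mulr1 leeDl.
rewrite mulr1 mulr0 add0e; apply: (@le_trans _ _ M%:E) => //.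
have -> : M%:E = ((M / c)%:E * c%:E)%E by rewrite -EFinM divfK// gt_eqF.
by apply: lee_wpmul2l => //; exact: ltW.
Qed.

(** Pointwise the integrand is eventually 0: where f vanishes because of the factor f, elsewhere
    because f(x) exceeds 1/(k+1) for large k. *)
Lemma low_density_mass : (fun k => \int[lam d]_x (f x * (f x < k.+1%:R^-1)%R%:R)%:E)%E @ \oo --> 0%E.
Proof.
apply: (@int_cvg0 _ _ _ _ _ (fun x => (f x)%:E) set0) => //.
- by move=> n; meas.
- by move=> n x; rewrite lee_fin mulr_ge0.
- by meas.
- by rewrite f1 ltry.
- near=> n => x; rewrite lee_fin -[leRHS]mulr1 ler_wpM2l//; by case: (_ < _).
move=> x _ _; apply/ecvg0P => [n|e e0]; first by rewrite lee_fin mulr_ge0.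
have [->|fx] := eqVneq (f x) 0; first by near=> n; rewrite mul0r lee_fin ltW.
have fx0 : 0 < f x by rewrite lt_neqAle eq_sym fx f0.
near=> n.
have h : n.+1%:R^-1 < f x by near: n; exact: near_infty_natSinv_lt (PosNum fx0).
by rewrite ltNge (ltW h) mulr0 lee_fin ltW.
Unshelve. all: by end_near. Qed.

Lemma high_density_mass : (fun k => \int[lam d]_x (f x * (k%:R < f x)%R%:R)%:E)%E @ \oo --> 0%E.
Proof.
apply: (@int_cvg0 _ _ _ _ _ (fun x => (f x)%:E) set0) => //.
- by move=> n; meas.
- by move=> n x; rewrite lee_fin mulr_ge0.
- by meas.
- by rewrite f1 ltry.
- near=> n => x; rewrite lee_fin -[leRHS]mulr1 ler_wpM2l//; by case: (_ < _).
move=> x _ _; apply/ecvg0P => [n|e e0]; first by rewrite lee_fin mulr_ge0.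
near=> n.
have h : f x <= n%:R by near: n; exact: nbhs_infty_ger.
by rewrite ltNge h mulr0 lee_fin ltW.
Unshelve. all: by end_near. Qed.

End bad_vertices.

Section convergence_in_probability.
Variables (R : realType) (d : nat) (f : d.-tuple R -> R).
Hypotheses (f0 : forall x, 0 <= f x) (mf : measurable_fun setT f).
Hypothesis f1 : (\int[lam d]_x (f x)%:E = 1)%E.
Variable mu : {sigma_finite_measure set (d.-tuple R) -> \bar R}.
Hypothesis mu1 : mu setT = 1%E.
Hypothesis muE : forall A, measurable A -> (mu A = \int[lam d]_x (f x * \1_A x)%:E)%E.

(** The index [n.-1.+1] supplies the head point that [WP] requires; it equals n for n > 0, and the
    other vertices number n - 1. *)
Lemma WP_near (r : nat -> R) (eps e : R) : (forall n, 0 < r n) -> r @ \oo --> 0 ->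
  (fun n => n%:R * r n ^+ d) @ \oo --> +oo -> 0 < eps -> 0 < e ->
  \forall n \near \oo,
    (pw mu n.-1.+1 [set s | (eps <= `|WP (r n) s - @w_const R d|)%R] <= e%:E)%E.
Proof.
move=> r0 rc rn eps0 e0.
pose v := vol R d; have v0 : 0 < v by exact: vol_gt0.
(* At most 1/2 for [good_point], and 48 = 2 * 24 so that the error 24 eta is at most eps / 2. *)
pose eta : R := Num.min (1 / 2) (eps / 48).
have p2 : 0 < 2 :> R by rewrite ltr0n.
have p4 : 0 < 4 :> R by rewrite ltr0n.
have p48 : 0 < 48 :> R by rewrite ltr0n.
have p2048 : 0 < 2048 :> R by rewrite ltr0n.
have eta0 : 0 < eta by rewrite lt_min !divr_gt0.
have eta1 : eta <= 1 / 2 by rewrite ge_min lexx.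
have eta2 : 24 * eta <= eps / 2.
  apply: (@le_trans _ _ (24 * (eps / 48))); last by rewrite le_eqVlt; apply/orP; left; apply/eqP; field.
  by apply: ler_wpM2l; [exact: ler0n|rewrite ge_min lexx orbT].
(* One quarter each for low density, high density, oscillation and the conditional bound C / K. *)
have e4 : 0 < e / 4 by exact: divr_gt0.
have low0 k : (0 <= \int[lam d]_x (f x * (f x < k.+1%:R^-1)%R%:R)%:E)%E.
  by apply: integral_ge0 => x _; rewrite lee_fin mulr_ge0.
have high0 k : (0 <= \int[lam d]_x (f x * (k%:R < f x)%R%:R)%:E)%E.
  by apply: integral_ge0 => x _; rewrite lee_fin mulr_ge0.
have osc0 n : (0 <= \int[lam d]_x osc f (r n) x)%E.
  by apply: integral_ge0 => x _; exact: osc_ge0.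
have [k1 _ /(_ k1 (leqnn _)) hk1] := (ecvg0P low0).1 (low_density_mass f0 mf f1) _ e4.
have [k2 _ /(_ k2 (leqnn _)) hk2] := (ecvg0P high0).1 (high_density_mass f0 mf f1) _ e4.
pose kappa : R := k1.+1%:R^-1; pose M : R := k2%:R.
have kappa0 : 0 < kappa by rewrite invr_gt0 ltr0n.
pose c := eta * kappa * v; have c0 : 0 < c by rewrite !mulr_gt0.
pose C := 4 + 2048 / eps ^+ 2.
have C0 : 0 < C by apply: addr_gt0; [exact: p4|apply: divr_gt0; [exact: p2048|exact: exprn_gt0]].
(* At least 4, as [inner_bound] requires, and large enough for C / K <= e / 4. *)
pose K := 4 + C * 4 / e.
have K4 : 4 <= K by rewrite lerDl; apply: divr_ge0; [apply: mulr_ge0|]; exact: ltW.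
have CK : C / K <= e / 4.
  have K0 : 0 < K by exact: lt_le_trans K4.
  rewrite ler_pdivrMr// (_ : e / 4 * K = e + C); first by rewrite lerDr ltW.
  by rewrite /K; move: (C) => C'; field; rewrite gt_eqF.
have Mc0 : 0 <= M / c by apply: divr_ge0; [exact: ler0n|exact: ltW].
have Mc1 : 0 < M / c + 1 by apply: ltr_wpDl.
have fint : (\int[lam d]_x `|f x|%:E < +oo)%E.
  by under eq_integral do rewrite ger0_norm//; rewrite f1 ltry.
(* The oscillation is made small after kappa and M, hence M / c, are fixed; adding 1 keeps the
   divisor positive when M = 0. *)
have hosc := (ecvg0P osc0).1 (ball_shift_cvg mf fint rc) _ (divr_gt0 e4 Mc1).
near=> n.
have n2 : (2 <= n)%N by near: n; exact: nbhs_infty_ge.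
have hK : K <= n.-1%:R * (kappa * v * r n ^+ d / 2).
  have kv0 : 0 < kappa * v by exact: mulr_gt0.
  (* The 4 pays for n - 1 >= n / 2 and for the factor 1/2 in the lower bound on p. *)
  have h : 4 * K / (kappa * v) <= n%:R * r n ^+ d.
    by near: n; move: (4 * K / _); exact: cvgry_ge rn.
  apply: (@le_trans _ _ (n%:R / 2 * (kappa * v * r n ^+ d / 2))).
    move: h; rewrite ler_pdivrMr// => h.
    rewrite -(ler_pM2l p4) (le_trans h)// le_eqVlt; apply/orP; left; apply/eqP.
    by field.
  apply: ler_wpM2r.
    by rewrite divr_ge0 ?(ltW p2)// mulr_ge0 ?(ltW kv0)// exprn_ge0// ltW.
  rewrite ler_pdivrMr// -natrM ler_nat.
  by move: n2; case: (n) => [|[|k]] //= _; rewrite muln2 -addnn !addSn !ltnS addnS ltnS leq_addr.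
apply: (le_trans (WP_bound f0 mf mu1 muE eps0 kappa0 eta0 eta1 eta2 (r0 n) K4 hK)).
have -> : e = (e / 4 + e / 4 + e / 4) + e / 4 by field.
rewrite [in leRHS]EFinD; apply: leeD; last by rewrite lee_fin.
apply: (le_trans (bad_mass f0 mf muE kappa (r n) c0 (ler0n R k2))).
rewrite !EFinD; apply: leeD; first by apply: leeD.
have h : (\int[lam d]_x osc f (r n) x <= (e / 4 / (M / c + 1))%:E)%E by near: n.
apply: (@le_trans _ _ ((M / c)%:E * (e / 4 / (M / c + 1))%:E)%E).
  by apply: lee_wpmul2l; rewrite ?lee_fin.
rewrite -EFinM lee_fin mulrA ler_pdivrMr// [leRHS]mulrC.
by apply: ler_wpM2r; [exact: ltW|rewrite lerDl].
Unshelve. all: by end_near. Qed.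

End convergence_in_probability.

(** * Separation of the limits and conclusion *)

(** By monotonicity the value closest to w_d among the others is one of w_(d-1) and w_(d+1). *)
Lemma w_const_gap (R : realType) d : (1 <= d)%N -> exists2 g : R, 0 < g &
  forall s, (1 <= s)%N -> s != d -> g <= `|@w_const R s - @w_const R d|.
Proof.
move=> d1.
have lt1 := @w_const_lt R d d.+1 d1 (ltnSn d).
(* For d = 1 no smaller dimension competes, and any positive number will do. *)
pose g2 : R := if (2 <= d)%N then @w_const R d.-1 - @w_const R d else 1.
have g2_gt0 : 0 < g2.
  rewrite /g2; case: ifP => // d2; rewrite subr_gt0.
  by apply: w_const_lt; rewrite ?prednK// -ltnS prednK.
exists (Num.min (@w_const R d - @w_const R d.+1) g2); first by rewrite lt_min subr_gt0 lt1.
move=> s s1; rewrite neq_ltn => /orP[sd|ds].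
  have d2 : (2 <= d)%N by exact: leq_ltn_trans sd.
  apply: le_trans (ler_norm _); rewrite ge_min; apply/orP; right; rewrite /g2 d2 lerD2r.
  have : (s <= d.-1)%N by rewrite -ltnS prednK.
  by rewrite leq_eqVlt => /orP[/eqP ->//|sd1]; exact/ltW/w_const_lt.
rewrite distrC; apply: le_trans (ler_norm _); rewrite ge_min; apply/orP; left; rewrite lerD2l lerN2.
by move: ds; rewrite leq_eqVlt => /orP[/eqP <-//|ds]; exact/ltW/w_const_lt.
Qed.

Theorem theorem4 (R : realType) (d : nat) (dT : measure_display)
    (T : measurableType dT) (P : probability T R)
    (f : d.-tuple R -> R) (r : nat -> R) (X : nat -> T -> d.-tuple R) :
  (1 <= d)%N ->
  prob_density f ->
  (forall n, 0 < r n) ->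
  r @ \oo --> 0 ->
  (fun n => n%:R * r n ^+ d) @ \oo --> +oo ->
  (forall i, measurable_fun setT (X i)) ->
  (forall i, has_density P (X i) f) ->
  mutually_independent P X ->
  (* W_4 -> w_d in probability *)
  (forall eps : R, 0 < eps ->
     P [set w | eps <= `|W4 X n (r n) w - @w_const R d|] @[n --> \oo] --> 0%E)
  /\
  (* Delta_n = argmin_{s >= 1} |W_4 - w_s| -> d in probability, i.e. the
     probability that d is not the unique minimiser tends to 0 *)
  (P [set w | exists s : nat, [/\ (1 <= s)%N, s != d &
        `|W4 X n (r n) w - @w_const R s| <= `|W4 X n (r n) w - @w_const R d|]]
     @[n --> \oo] --> 0%E).
Proof.
move=> d1 [f0 mf f1] r0 rc rn mX dX iX.
(* The law of vertex 0; through the common density it is the law of every vertex. *)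
have [mu muP] := exists_law P (mX 0%N).
have mu1 : mu setT = 1%E by rewrite muP preimage_setT probability_setT.
have mfA A : measurable A -> measurable_fun setT (fun x => (f x * \1_A x)%:E).
  by move=> mA; apply: measfE; apply: measfM => //; exact: measurable_indic.
have muE A : measurable A -> (mu A = \int[lam d]_x (f x * \1_A x)%:E)%E.
  move=> mA; rewrite muP dX// lebesgue_intE//; first exact: mfA.
  by move=> x; rewrite lee_fin mulr_ge0.
have lawX i A : measurable A -> P (X i @^-1` A) = mu A.
  by move=> mA; rewrite muP !dX.
have f1' : (\int[lam d]_x (f x)%:E = 1)%E.
  by rewrite -lebesgue_intE//; exact: measfE.
have mW n : measurable_fun setT (W4 X n.+1 (r n.+1)).
  rewrite (_ : W4 _ _ _ = WP (r n.+1) (m:=n) \o tupX X n.+1).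
    apply: measurableT_comp; first exact: measurable_WP.
    exact: measurable_tupX.
  by apply/funext => w; exact: W4E.
have part1 (eps : R) : 0 < eps ->
    P [set w | eps <= `|W4 X n (r n) w - @w_const R d|] @[n --> \oo] --> 0%E.
  move=> eps0; apply/ecvg0P => // e e0.
  have h := WP_near f0 mf f1' mu1 muE r0 rc rn eps0 e0.
  near=> n.
  have n0 : (0 < n)%N by near: n; exact: nbhs_infty_ge.
  have : (pw mu n.-1.+1 [set s | (eps <= `|WP (r n) s - @w_const R d|)%R] <= e%:E)%E by near: n.
  move: (n) n0 => [//|m] _ /=; apply: le_trans.
  rewrite -(joint_law mX lawX iX); last first.
    apply: measurable_pred; have mWP := @measurable_WP R d (r m.+1) m; by meas.
  rewrite le_eqVlt; apply/orP; left; apply/eqP; congr (P _).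
  by apply/seteqP; split => w /=; rewrite W4E.
split => //.
have [g g0 hg] := @w_const_gap R d d1.
(* If s does at least as well as d, the triangle inequality gives |w_s - w_d| <= 2 |W4 - w_d|, so W4
   is at distance at least g / 2 from w_d and the first part applies. *)
have hE n w s : (1 <= s)%N -> s != d ->
    `|W4 X n (r n) w - @w_const R s| <= `|W4 X n (r n) w - @w_const R d| ->
    g / 2 <= `|W4 X n (r n) w - @w_const R d|.
  move=> s1 sd hs; rewrite ler_pdivrMr ?ltr0n//.
  apply: (le_trans (hg _ s1 sd)).
  have := ler_distD (W4 X n (r n) w) (@w_const R s) (@w_const R d).
  by move=> /le_trans; apply; rewrite distrC mulr_natr mulr2n lerD2r.
apply: (ecvg0_le _ _ (part1 _ (divr_gt0 g0 (ltr0n R 2)))) => //.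
near=> n.
have n0 : (0 < n)%N by near: n; exact: nbhs_infty_ge.
move: (n) n0 => [//|m] _.
apply: le_measure; rewrite ?inE; last first.
- by move=> w /= [s [s1 sd hs]]; exact: hE hs.
- by apply: measurable_pred; have mWn := mW m; meas.
(* The event is a countable union over s, hence measurable, as monotonicity of the probability
   requires. *)
rewrite (_ : [set w | _] = \bigcup_s [set w | [&& (1 <= s)%N, s != d &
   `|W4 X m.+1 (r m.+1) w - @w_const R s| <= `|W4 X m.+1 (r m.+1) w - @w_const R d|]]).
  by apply: bigcup_measurable => s _; apply: measurable_pred; have mWn := mW m; meas.
apply/seteqP; split => w /= [s]; first by move=> [s1 sd hs]; exists s => //=; apply/and3P.
by move=> _ /and3P[s1 sd hs]; exists s.
Unshelve. all: by end_near. Qed.
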